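(* The mean field game with common noise described in the context has a unique solution $(\mu^X,\hat\alpha)$. That is, there exists exactly one pair $(\mu^X,\hat\alpha)$ with $\mu^X\in\mathcal L^2_{\mathbb F}([0,T];\mathbb R)$ and $\hat\alpha\in\mathcal H^2_{\mathbb F}([0,T];\mathbb R)$ such that (i) $\hat\alpha$ maximises $J(\alpha;\mu^X)$ over $\alpha\in\mathcal H^2_{\mathbb F}([0,T];\mathbb R)$; and (ii) $\mu^X_t=\mathbb E[\hat X_t\mid\mathcal F^0_t]$ for all $t\in[0,T]$, where $\hat X$ is the optimal trajectory, i.e. the state process controlled by $\hat\alpha$.
   Context: Fix $T>0$. Let $W,W^0$ be independent one-dimensional Brownian motions on a complete probability space, and let $\xi_0$ be a non-negative random variable, independent of $(W,W^0)$, with $\mathbb E[\xi_0^2]<\infty$. $\mathbb F=(\mathcal F_t)_{t\in[0,T]}$ is the augmented filtration generated by $\xi_0,W,W^0$, and $\mathbb F^0=(\mathcal F^0_t)_{t\in[0,T]}$ is the augmented filtration generated by $W^0$. $\mathcal L^2_{\mathbb F}([0,T];\mathbb R)$ is the set of $\mathbb F$-progressively measurable real processes $\beta$ with $\mathbb E[\sup_{t\in[0,T]}|\beta_t|^2]<\infty$, and $\mathcal H^2_{\mathbb F}([0,T];\mathbb R)$ is the set of $\mathbb F$-progressively measurable real processes $\beta$ with $\mathbb E[\int_0^T|\beta_t|^2dt]<\infty$. Constants: $\delta\in(0,1)$, $c_p,c_i,c_a>0$, $\sigma,\sigma^0\neq0$. The price function $P:[0,T]\times\mathbb R\to\mathbb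 R$ is Lipschitz continuous in its second argument with constant $L$, uniformly in $t$, and $x\mapsto P(t,x)$ is decreasing. For $\alpha\in\mathcal H^2_{\mathbb F}([0,T];\mathbb R)$ the state process (generation capacity of a representative producer) is $$dX_t=(-\delta X_t+\alpha_t)\,dt+\sigma\,dW_t+\sigma^0\,dW^0_t,\qquad X_0=\xi_0,$$ and for $\mu\in\mathcal L^2_{\mathbb F}([0,T];\mathbb R)$ the expected profit is $$J(\alpha;\mu)=\mathbb E\Big[\int_0^T\big(X_t(P(t,\mu_t)-c_p)-c_i\alpha_t-c_a\alpha_t^2\big)dt\Big].$$
   Formalization: The price function t ↦ P(t,x) is additionally assumed measurable and integrable on [0,T] for each x, so that the expected profit J is well defined; without this (e.g. P(t,x)=1/t−x, ξ₀=1) J is +∞ for all controls and uniqueness fails. *)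

(* Defs.v *)
From HB Require Import structures.
From mathcomp Require Import all_boot all_order all_algebra.
From mathcomp Require Import all_classical all_reals all_analysis.

Set Implicit Arguments.
Unset Strict Implicit.
Unset Printing Implicit Defensive.

Import Order.TTheory GRing.Theory Num.Theory.
Import numFieldNormedType.Exports.

Local Open Scope classical_set_scope.
Local Open Scope ring_scope.

(* A process is a map R -> Omega -> R; only its values at times in [0, T]
   are ever constrained. *)

Section sigma_algebras.
Context d (Omega : measurableType d) (R : realType) (P : probability Omega R).

Definition independent (A B : set (set Omega)) : Prop :=
  forall a b, A a -> B b -> P (a `&` b) = (P a * P b)%E.

Definition generators (f : Omega -> R) : set (set Omega) :=
  preimage_set_system setT f measurable.

Definition history (X : R -> Omega -> R) (t : R) : set (set Omega) :=
  \bigcup_(s in `[0, t]) generators (X s).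

(* Augmentation adds all P-negligible sets to the raw filtrations; for
   filtrations generated by Brownian motions and a time-0 variable the result
   is already right-continuous. *)

Definition common_filtration (W0 : R -> Omega -> R) (t : R) :
    set (set Omega) :=
  <<s history W0 t `|` P.-negligible >>.

Definition full_filtration (xi0 : Omega -> R) (W W0 : R -> Omega -> R)
    (t : R) : set (set Omega) :=
  <<s generators xi0 `|` history W t `|` history W0 t `|` P.-negligible >>.

Definition brownian_motion (T : R) (W : R -> {RV P >-> R}) : Prop :=
  [/\ {ae P, forall w, W 0 w = 0},
      {ae P, forall w, {within `[0, T], continuous (fun t => W t w)}} &
      forall s t, 0 <= s -> s < t -> t <= T ->
        (forall B : set R, measurable B ->
          P ((W t \- W s) @^-1` B) = normal_prob 0 (Num.sqrt (t - s)) B) /\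
        independent <<s history W s >> <<s generators (W t \- W s) >>].

(* Z is a version of E[X | G]. *)
Definition is_cond_exp (G : set (set Omega)) (X Z : Omega -> R) : Prop :=
  [/\ P.-integrable setT (EFin \o X),
      P.-integrable setT (EFin \o Z),
      measurable_fun setT (Z : g_sigma_algebraType G -> R) &
      forall A, <<s G >> A ->
        (\int[P]_(w in A) (Z w)%:E = \int[P]_(w in A) (X w)%:E)%E].

End sigma_algebras.

Section processes.
Context d (Omega : measurableType d) (R : realType) (P : probability Omega R).
Variables (T : R) (F : R -> set (set Omega)).

Definition progressive (b : R -> Omega -> R) : Prop :=
  forall t, t \in `[0, T] ->
    measurable_fun (`[0, t]%classic `*` setT)
      (fun z : R * g_sigma_algebraType (F t) => b z.1 z.2).

(* The supremum is over an uncountable set; it is measurable in w for a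
   progressive b when P is complete, as is assumed where this is used. *)
Definition calL2 (b : R -> Omega -> R) : Prop :=
  progressive b /\
  (\int[P]_w ereal_sup [set (`|b t w| ^+ 2)%:E | t in `[0%R, T]%classic] < +oo)%E.

Definition calH2 (b : R -> Omega -> R) : Prop :=
  progressive b /\
  (\int[P]_w \int[lebesgue_measure]_(t in `[0%R, T]) (`|b t w| ^+ 2)%:E
     < +oo)%E.

End processes.

Section mean_field_game.
Context d (Omega : measurableType d) (R : realType) (P : probability Omega R).
Variables (T : R) (W W0 : R -> Omega -> R) (xi0 : Omega -> R).
Variables (delta cp ci ca sigma sigma0 : R) (price : R -> R -> R).

Let F := full_filtration P xi0 W W0.
Let F0 := common_filtration P W0.

(* The noise is additive, so the stochastic differential equation in integral
   form only involves a pathwise Lebesgue integral.  Path continuity matters: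
   without it the total Lebesgue integral could satisfy the equation
   spuriously. *)
Definition is_state (alpha X : R -> Omega -> R) : Prop :=
  [/\ progressive T F X,
      {ae P, forall w, {within `[0, T], continuous (fun t => X t w)}} &
      {ae P, forall w, forall t, t \in `[0, T] ->
        X t w = xi0 w
          + \int[lebesgue_measure]_(s in `[0, t]) (- delta * X s w + alpha s w)
          + sigma * W t w + sigma0 * W0 t w}].

(* The state is determined by alpha up to indistinguishability, so the profit
   of alpha is written with a state X of alpha as an additional argument. *)
Definition profit (mu alpha X : R -> Omega -> R) : \bar R :=
  'E_P[fun w => \int[lebesgue_measure]_(t in `[0, T])
    (X t w * (price t (mu t w) - cp) - ci * alpha t w
     - ca * alpha t w ^+ 2)].

Definition is_optimal (mu alpha X : R -> Omega -> R) : Prop :=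
  [/\ calH2 P T F alpha, is_state alpha X &
      forall beta Y, calH2 P T F beta -> is_state beta Y ->
        (profit mu beta Y <= profit mu alpha X)%E].

Definition mfg_solution (mu alpha : R -> Omega -> R) : Prop :=
  calL2 P T F mu /\
  exists X, is_optimal mu alpha X /\
    forall t, t \in `[0, T] -> is_cond_exp P (F0 t) (X t) (mu t).

End mean_field_game.

(* Main.v *)
(* The profit is a concave quadratic functional of the control, so a control
   alpha is optimal for mu iff the gradient k = G(mu) - ci - 2 ca alpha is
   orthogonal, in L2 (dt x P), to all F-progressive processes; here G(mu)_s is
   the integral of e^(-delta (t - s)) (P(t, mu_t) - cp) over t in [s, T], and G
   involves the adjoint of the control-to-state map.

   Existence.  For an F0-progressive alpha the conditional mean M of the state
   solves the same linear equation with xi0 and W replaced by their means.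
   Since P is decreasing, alpha |-> G(M) - ci - 2 ca alpha is strongly
   monotone, and it is Lipschitz; so for some alpha it is orthogonal to all
   F0-progressive processes.  It is then orthogonal to all F-progressive ones:
   by independence, increments of its primitive that are orthogonal to F0_s are
   orthogonal to F_s, so the primitive of its projection on the F-progressive
   processes is a martingale with paths of finite energy, hence zero.

   Uniqueness.  Subtracting the first order conditions of two solutions and
   testing with the difference of the controls gives
     2 ca |alpha - alpha'|^2 = E int (X - X') (P(mu) - P(mu'))
                             = E int (mu - mu') (P(mu) - P(mu')) <= 0. *)

Require Import Defs.
From HB Require Import structures.
From mathcomp Require Import all_boot all_order all_algebra.
From mathcomp Require Import all_classical all_reals all_analysis.
From mathcomp Require Import measurable_realfun.
From mathcomp Require Import ring lra.

Set Implicit Arguments.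
Unset Strict Implicit.
Unset Printing Implicit Defensive.

Import Order.TTheory GRing.Theory Num.Theory.
Import numFieldNormedType.Exports.

Local Open Scope classical_set_scope.
Local Open Scope ring_scope.

(** * Monotone operators on semi-inner product spaces *)

(** Processes are treated as functions on [R * Omega] vanishing outside [[0, T]], so that H2 becomes
    a complete subspace [V] of L2(dt x P) and optimality an orthogonality statement. Three
    difficulties shape the argument. The price at 0 is only integrable in time, so [gp u] may fail
    to be in L2: it is paired only with processes dominated by a square integrable variable, whereas
    its differences (by the Lipschitz bound) and its image [GP u] under the adjoint are square
    integrable. The adjoint looks into the future, so the gradient is not adapted but only
    measurable at time [T]; the first order condition is therefore orthogonality to a subspace and
    not a pointwise equation. Conditional expectations are never constructed: under an
    F0-progressive control the candidate [st0 a] is explicit, and [st a - st0 a] does not depend on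
    [a] and is, at each time, centred on every set of F0_T. The horizon [T] is arbitrary because the
    contraction comes from a small step along a monotone operator. *)

Lemma sqrD_le (R : realFieldType) (a b : R) :
  (a + b) ^+ 2 <= 2 * a ^+ 2 + 2 * b ^+ 2.
Proof. by have := sqr_ge0 (a - b); nra. Qed.

Section hilbert.
Context (R : realType) (U : lmodType R) (dot : U -> U -> R) (E : set U).

(** [U] is a space of all functions, on most of which the integral defining [dot] is meaningless, so
    additivity and homogeneity are required on [E] only. Functions equal almost everywhere are not
    identified; limits and fixed points below are therefore obtained up to distance zero. *)
Record semi_inner : Prop := SemiInner {
  si0 : E 0;
  siD : forall x y, E x -> E y -> E (x + y);
  siZ : forall a x, E x -> E (a *: x);
  siC : forall x y, dot x y = dot y x;
  siDl : forall x y z, E x -> E y -> E z -> dot (x + y) z = dot x z + dot y z;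
  siZl : forall a x y, E x -> E y -> dot (a *: x) y = a * dot x y;
  si_ge0 : forall x, 0 <= dot x x }.

Definition subspace (V : set U) :=
  [/\ V `<=` E, V 0, forall x y, V x -> V y -> V (x + y) &
      forall a x, V x -> V (a *: x)].

(** Geometric decay is what minimising sequences and contraction iterates offer, and such sequences
    in L2 converge almost everywhere without passing to a subsequence. *)
Definition complete_set (V : set U) := forall (f : nat -> U) (C q : R),
  0 <= C -> 0 < q < 1 -> (forall n, V (f n)) ->
  (forall n, dot (f n.+1 - f n) (f n.+1 - f n) <= C * q ^+ n) ->
  exists2 g, V g & (fun n => dot (f n - g) (f n - g)) @ \oo --> (0 : R).

Hypothesis si : semi_inner.

Lemma siN x : E x -> E (- x).
Proof. by move=> Ex; rewrite -scaleN1r; exact: (siZ si). Qed.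

Lemma siB x y : E x -> E y -> E (x - y).
Proof. by move=> Ex Ey; apply: (siD si) => //; exact: siN. Qed.

Lemma siNl x y : E x -> E y -> dot (- x) y = - dot x y.
Proof. by move=> Ex Ey; rewrite -scaleN1r (siZl si)// mulN1r. Qed.

Lemma siBl x y z : E x -> E y -> E z -> dot (x - y) z = dot x z - dot y z.
Proof. by move=> *; rewrite (siDl si)// ?siNl//; exact: siN. Qed.

Lemma siDr x y z : E x -> E y -> E z -> dot z (x + y) = dot z x + dot z y.
Proof. by move=> *; rewrite (siC si) (siDl si)// !((siC si) z). Qed.

Lemma siNr x y : E x -> E y -> dot y (- x) = - dot y x.
Proof. by move=> *; rewrite (siC si) siNl// (siC si). Qed.

Lemma siBr x y z : E x -> E y -> E z -> dot z (x - y) = dot z x - dot z y.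
Proof. by move=> *; rewrite (siC si) siBl// !((siC si) z). Qed.

Lemma siZr a x y : E x -> E y -> dot y (a *: x) = a * dot y x.
Proof. by move=> *; rewrite (siC si) (siZl si)// (siC si). Qed.

Lemma siDsq x y : E x -> E y ->
  dot (x + y) (x + y) = dot x x + 2 * dot x y + dot y y.
Proof.
move=> Ex Ey; rewrite (siDl si)// ?siDr//; last exact: (siD si).
by rewrite ((siC si) y x); ring.
Qed.

Lemma siBsq x y : E x -> E y ->
  dot (x - y) (x - y) = dot x x - 2 * dot x y + dot y y.
Proof.
move=> Ex Ey; have Eny := siN Ey.
by rewrite siDsq// siNr// siNl// siNr//; ring.
Qed.

(** The slack [e] is the gap of an approximate minimiser in [projection], a squared norm in
    Cauchy-Schwarz, and 0 at a maximiser of the profit. For [b > 0] the choice [t = a / b]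
    decides. *)
Lemma discriminant (a b e : R) : 0 <= b ->
  (forall t : R, 2 * t * a <= e + t ^+ 2 * b) -> a ^+ 2 <= e * b.
Proof.
move=> b0 h; have [b00|bn0] := eqVneq b 0.
  subst b; have [->|a0] := eqVneq a 0; first by rewrite expr0n/= mulr0.
  (* With [b = 0] and [a] nonzero this [t] yields the absurd [e + 1 <= e]. *)
  have := h ((e + 1) / (2 * a)).
  have -> : 2 * ((e + 1) / (2 * a)) * a = e + 1 by field.
  by rewrite mulr0 addr0; lra.
have bp : 0 < b by rewrite lt_neqAle eq_sym bn0.
have := h (a / b).
have -> : 2 * (a / b) * a = 2 * (a ^+ 2 / b) by field.
have -> : (a / b) ^+ 2 * b = a ^+ 2 / b by field.
move=> H; have : a ^+ 2 / b <= e by lra.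
by rewrite ler_pdivrMr.
Qed.

Lemma si_cauchy_schwarz x y : E x -> E y -> dot x y ^+ 2 <= dot x x * dot y y.
Proof.
move=> Ex Ey; apply: discriminant; first exact: (si_ge0 si).
move=> t; have := (si_ge0 si) (x - t *: y).
have Ety : E (t *: y) by exact: (siZ si).
rewrite siBsq// siZr// (siZl si)// siZr//; nra.
Qed.

Lemma sq_cvg0_eq0 (c : R) (u : nat -> R) :
  (forall n, c ^+ 2 <= u n) -> u @ \oo --> (0 : R) -> c = 0.
Proof.
move=> h u0; apply/eqP; rewrite -sqrf_eq0 eq_le sqr_ge0 andbT.
have := cvgP _ u0 => cu; rewrite -(cvg_lim _ u0)//.
by apply: limr_ge => //; near=> n; exact: h.
Unshelve. all: by end_near. Qed.

Lemma projection (V : set U) x : subspace V -> complete_set V -> E x ->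
  exists2 p, V p & forall v, V v -> dot (x - p) v = 0.
Proof.
move=> [VE V0 VD VZ] Vc Ex.
pose S := [set dot (x - v) (x - v) | v in V].
have Sinf : has_inf S.
  split; first by exists (dot (x - 0) (x - 0)), 0.
  by exists 0 => _ [v Vv <-]; exact: (si_ge0 si).
pose D := inf S.
have Dle v : V v -> D <= dot (x - v) (x - v).
  by move=> Vv; apply: ge_inf; [exact: Sinf.2 | exists v].
have ex n : exists p, V p /\ dot (x - p) (x - p) <= D + 2^-1 ^+ n.
  have /(@inf_adherent _ S) : 0 < (2^-1 : R) ^+ n by rewrite exprn_gt0// invr_gt0.
  by move=> /(_ Sinf) [_ [v Vv <-]] /ltW vle; exists v.
have /choice [p pP] := ex.
have Ep n : E (p n) by apply: VE; exact: (pP n).1.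
have half_le n : (2^-1 : R) ^+ n.+1 <= 2^-1 ^+ n.
  by rewrite exprS ler_piMl// ?exprn_ge0// ?invr_ge0//; lra.
(* The midpoint of [p n] and [p n.+1] has squared distance at least [D] from [x]; the parallelogram
   law then bounds the squared step by [2 / 2^(n+1) + 2 / 2^n <= 4 / 2^n]. *)
have [|||g Vg gP] := Vc p 4 2^-1 _ _ (fun n => (pP n).1).
- by [].
- by apply/andP; split; lra.
- move=> n; have [V1 p1] := pP n.+1; have [V2 p2] := pP n.
  have Vm : V (2^-1 *: (p n.+1 + p n)) by apply: VZ; exact: VD.
  have := Dle _ Vm.
  have E1 : E (p n.+1) by []. have E2 : E (p n) by [].
  have E12 : E (p n.+1 + p n) by exact: (siD si).
  have Em := VE _ Vm.
  move: p1 p2; rewrite !siBsq// !siZr// (siZl si)// siDsq// siDr//.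
  by have := half_le n; lra.
- exists g => // v Vv.
  have Eg := VE _ Vg. have Ev := VE _ Vv.
  have Exp n : E (x - p n) by exact: siB.
  apply: (@sq_cvg0_eq0 _ (fun n =>
    2 * (2^-1 ^+ n * dot v v) + 2 * (dot (p n - g) (p n - g) * dot v v))).
    move=> n; have -> : dot (x - g) v = dot (x - p n) v + dot (p n - g) v.
      by rewrite !siBl//; ring.
    (* An approximate minimiser is almost orthogonal to [V]: moving [p n] by [t *: v] cannot lower
       the squared distance by more than [2^-1 ^+ n]. *)
    have h1 : dot (x - p n) v ^+ 2 <= 2^-1 ^+ n * dot v v.
      apply: discriminant => [|t]; first exact: (si_ge0 si).
      have Etv : E (t *: v) by exact: (siZ si).
      have Vt : V (p n + t *: v) by apply: VD; [exact: (pP n).1 | exact: VZ].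
      have := Dle _ Vt; have := (pP n).2.
      rewrite opprD addrA (siBsq (Exp n) ((siZ si) t v Ev)) !siZr// ?(siZl si)//.
      nra.
    have h2 := si_cauchy_schwarz (siB (Ep n) Eg) Ev.
    apply: (le_trans (sqrD_le (dot (x - p n) v) (dot (p n - g) v))).
    by apply: lerD; rewrite ler_pM2l.
  have -> : (0 : R) = 2 * (0 * dot v v) + 2 * (0 * dot v v) by ring.
  apply: cvgD; apply: cvgM; first exact: cvg_cst.
  + apply: cvgM; last exact: cvg_cst.
    by apply: cvg_expr; rewrite ger0_norm//; lra.
  + exact: cvg_cst.
  + by apply: cvgM => //; exact: cvg_cst.
Qed.

(* For small t > 0 the map a |-> a + t * (projection of A a on V) is a contraction. *)
Lemma strongly_monotone_zero (V : set U) (A : U -> U) (m L : R) :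
  subspace V -> complete_set V -> (forall a, V a -> E (A a)) ->
  0 < m -> 0 <= L ->
  (forall a b, V a -> V b ->
     dot (A a - A b) (a - b) <= - (m * dot (a - b) (a - b))) ->
  (forall a b v, V a -> V b -> V v ->
     dot (A a - A b) v ^+ 2 <= L * dot (a - b) (a - b) * dot v v) ->
  exists2 a, V a & forall v, V v -> dot (A a) v = 0.
Proof.
move=> sV Vc AE m0 L0 Amon Alip; have [VE V0 VD VZ] := sV.
have VB x y : V x -> V y -> V (x - y).
  by move=> Vx Vy; apply: VD => //; rewrite -scaleN1r; exact: VZ.
have ex a : exists p, V a -> V p /\ forall v, V v -> dot (A a - p) v = 0.
  have [Va|nVa] := pselect (V a); last by exists 0.
  have [p Vp pP] := projection sV Vc (AE _ Va).
  by exists p.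
have /choice [p pP] := ex.
have Vp a : V a -> V (p a) by move=> /pP[].
have pA a v : V a -> V v -> dot (p a) v = dot (A a) v.
  move=> Va Vv; have [_ /(_ _ Vv)] := pP _ Va.
  rewrite siBl; [by move/eqP; rewrite subr_eq0 => /eqP| exact: AE | | exact: VE].
  by apply: VE; exact: Vp.
(* With [tau = m / K] the squared distance shrinks by the factor
   [1 - 2 tau m + tau^2 L <= 1 - tau m], since [tau L <= m]. The summand [m ^+ 2 + 1] keeps the
   ratio [q] positive, as [complete_set] demands. *)
pose K := L + m ^+ 2 + 1.
have K0 : 0 < K by rewrite /K; have := sqr_ge0 m; lra.
pose tau := m / K.
have tau0 : 0 < tau by exact: divr_gt0.
pose Phi a := a + tau *: p a.
have VPhi a : V a -> V (Phi a) by move=> Va; apply: VD => //; apply: VZ; exact: Vp.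
pose q := 1 - m ^+ 2 / K.
have q1 : q < 1 by rewrite /q ltrBlDr ltrDl divr_gt0// exprn_gt0.
have q0 : 0 < q by rewrite /q subr_gt0 ltr_pdivrMr// mul1r /K; lra.
have Phi_q a b : V a -> V b ->
    dot (Phi a - Phi b) (Phi a - Phi b) <= q * dot (a - b) (a - b).
  move=> Va Vb.
  have Vab := VB _ _ Va Vb. have Vpab := VB _ _ (Vp _ Va) (Vp _ Vb).
  have Eab := VE _ Vab. have Epab := VE _ Vpab.
  have Epa := VE _ (Vp _ Va). have Epb := VE _ (Vp _ Vb).
  have EA := siB (AE _ Va) (AE _ Vb).
  have pAB v : V v -> dot (p a - p b) v = dot (A a - A b) v.
    move=> Vv; have Ev := VE _ Vv.
    by rewrite !siBl// ?pA//; exact: AE.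
  have -> : Phi a - Phi b = (a - b) + tau *: (p a - p b).
    by rewrite /Phi scalerBr opprD addrACA.
  rewrite siDsq ?siZr// ?(siZl si) ?siZr//; do ?exact: (siZ si).
  rewrite ((siC si) (a - b)) pAB//.
  have h1 := Amon _ _ Va Vb. have := Alip _ _ _ Va Vb Vpab.
  rewrite -(pAB _ Vpab) => h2. have hS := (si_ge0 si) (p a - p b).
  have h3 := (si_ge0 si) (a - b).
  set N := dot (a - b) (a - b) in h1 h2 h3 *.
  set S := dot (p a - p b) _ in h2 hS *.
  set B := dot (A a - A b) (a - b) in h1 *.
  (* The Lipschitz bound tested with [v = p a - p b] reads [S^2 <= L N S]. *)
  have S1 : S <= L * N.
    have [->|S0] := eqVneq S 0; first exact: mulr_ge0.
    have Sp : 0 < S by rewrite lt_neqAle eq_sym S0.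
    by rewrite -(ler_pM2r Sp) -expr2.
  have eq1 : tau * K = m by rewrite /tau divfK// gt_eqF.
  have eq2 : q = 1 - m * tau by rewrite /q /tau; field; rewrite gt_eqF.
  rewrite eq2.
  have t1 : tau * B <= tau * - (m * N) by rewrite ler_pM2l.
  have t2 : tau * (tau * S) <= tau * (tau * (L * N)) by rewrite !ler_pM2l.
  have LK : L <= K by rewrite /K; have := sqr_ge0 m; lra.
  have t3 : tau * (tau * (L * N)) <= tau * (tau * (K * N)).
    by rewrite !ler_pM2l// ler_wpM2r.
  have t4 : tau * (tau * (K * N)) = tau * (m * N) by rewrite -eq1; ring.
  rewrite t4 in t3.
  have -> : (1 - m * tau) * N = N - tau * (m * N) by ring.
  have -> : 2 * (tau * B) = tau * B + tau * B by ring.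
  rewrite mulrN in t1.
  lra.
pose x n := iter n Phi 0.
have Vx n : V (x n) by elim: n => //= n; exact: VPhi.
have [|||g Vg gP] := Vc x (dot (x 1%N - x 0%N) (x 1%N - x 0%N)) q _ _ Vx.
- exact: (si_ge0 si).
- by rewrite q0.
- elim=> [|n IH]; first by rewrite expr0 mulr1.
  apply: (le_trans (Phi_q _ _ (Vx n.+1) (Vx n))).
  by rewrite exprS mulrCA ler_pM2l.
exists g => // v Vv; rewrite -pA//.
have Ev := VE _ Vv. have Eg := VE _ Vg. have Ex n := VE _ (Vx n).
have Epg := VE _ (Vp _ Vg).
(* [g] is fixed by [Phi] only up to distance zero, so [Phi g - g] is shown to be orthogonal to
   [v]. *)
suff /eqP : tau * dot (p g) v = 0 by rewrite mulf_eq0 (gt_eqF tau0) => /eqP.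
rewrite -(siZl si)//.
have -> : tau *: p g = Phi g - g by rewrite /Phi addrC addKr.
have EPg := VE _ (VPhi _ Vg).
apply: (@sq_cvg0_eq0 _ (fun n =>
  2 * (q * dot (x n - g) (x n - g) * dot v v)
  + 2 * (dot (x n.+1 - g) (x n.+1 - g) * dot v v))).
  move=> n; have -> : dot (Phi g - g) v
      = dot (x n.+1 - g) v + - dot (x n.+1 - Phi g) v by rewrite !siBl//; ring.
  have h1 := si_cauchy_schwarz (siB (Ex n.+1) Eg) Ev.
  have h2 := si_cauchy_schwarz (siB (Ex n.+1) EPg) Ev.
  have h3 := ler_wpM2r ((si_ge0 si) v) (Phi_q _ _ (Vx n) Vg).
  have := sqrD_le (dot (x n.+1 - g) v) (- dot (x n.+1 - Phi g) v).
  by move: h2 h3; rewrite -/(x n.+1) sqrrN /=; lra.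
have -> : (0 : R) = 2 * (q * 0 * dot v v) + 2 * (0 * dot v v) by ring.
apply: cvgD; apply: cvgM; first exact: cvg_cst.
- apply: cvgM; last exact: cvg_cst.
  by apply: cvgM => //; exact: cvg_cst.
- exact: cvg_cst.
- apply: cvgM; last exact: cvg_cst.
  by have := gP; rewrite -(cvg_shiftS (fun n => dot (x n - g) (x n - g))).
Qed.

End hilbert.

(** * Square integrable functions *)

Section integrable_functions.
Context d (T : measurableType d) (R : realType).
Variable mu : {measure set T -> \bar R}.

Definition itg (f : T -> R) := mu.-integrable setT (fun x => (f x)%:E).

Definition Rint (f : T -> R) : R := \int[mu]_x f x.

Implicit Types f g : T -> R.

Lemma itg_meas f : itg f -> measurable_fun setT f.
Proof. by move=> /measurable_int/measurable_EFinP. Qed.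

Lemma eq_itg f g : f =1 g -> itg f -> itg g.
Proof. by move=> fg; rewrite (funext fg). Qed.

Lemma eq_Rint f g : f =1 g -> Rint f = Rint g.
Proof. by move=> fg; rewrite (funext fg). Qed.

Lemma itg0 : itg (fun=> 0).
Proof. exact: integrable0. Qed.

Lemma itgD f g : itg f -> itg g -> itg (fun x => f x + g x).
Proof. by move=> fi gi; have := integrableD measurableT fi gi. Qed.

Lemma itgZ a f : itg f -> itg (fun x => a * f x).
Proof. by move=> fi; have := integrableZl measurableT a fi. Qed.

Lemma itgN f : itg f -> itg (fun x => - f x).
Proof. by move=> fi; have := integrableN fi. Qed.

Lemma itgB f g : itg f -> itg g -> itg (fun x => f x - g x).
Proof. by move=> fi gi; apply: itgD => //; exact: itgN. Qed.

Lemma itg_le f g : measurable_fun setT f -> (forall x, `|f x| <= g x) ->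
  itg g -> itg f.
Proof.
move=> mf fg; apply: le_integrable => //; first exact/measurable_EFinP.
move=> x _; rewrite /= lee_fin (le_trans (fg x))// ler_norm//.
Qed.

Lemma itg_norm f : itg f -> itg (fun x => `|f x|).
Proof. by move=> fi; have := integrable_abse fi. Qed.

Lemma RintE f : itg f -> (Rint f)%:E = (\int[mu]_x (f x)%:E)%E.
Proof. by move=> fi; rewrite fineK// integrable_fin_num. Qed.

Lemma RintD f g : itg f -> itg g ->
  Rint (fun x => f x + g x) = Rint f + Rint g.
Proof. by move=> fi gi; exact: RintegralD. Qed.

Lemma RintB f g : itg f -> itg g ->
  Rint (fun x => f x - g x) = Rint f - Rint g.
Proof. by move=> fi gi; exact: RintegralB. Qed.

Lemma RintZ a f : itg f -> Rint (fun x => a * f x) = a * Rint f.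
Proof. by move=> fi; exact: RintegralZl. Qed.

Lemma RintN f : itg f -> Rint (fun x => - f x) = - Rint f.
Proof.
move=> fi; rewrite -mulN1r -RintZ//; apply: eq_Rint => x; by rewrite mulN1r.
Qed.

Lemma Rint0 : Rint (fun=> 0) = 0.
Proof. by rewrite /Rint /Rintegral integral0. Qed.

Lemma Rint_ge0 f : (forall x, 0 <= f x) -> 0 <= Rint f.
Proof. by move=> f0; apply: Rintegral_ge0. Qed.

Lemma le_Rint f g : itg f -> itg g -> (forall x, f x <= g x) ->
  Rint f <= Rint g.
Proof. by move=> fi gi fg; apply: le_Rintegral. Qed.

Lemma Rint_norm f : itg f -> `|Rint f| <= Rint (fun x => `|f x|).
Proof. by move=> fi; apply: le_normr_Rintegral. Qed.

Lemma ae_EFin f g : {ae mu, forall x, f x = g x} ->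
  ae_eq mu setT (fun x => (f x)%:E) (fun x => (g x)%:E).
Proof. by apply: filterS => x fg _; rewrite fg. Qed.

Lemma Rint_ae f g : measurable_fun setT f -> measurable_fun setT g ->
  {ae mu, forall x, f x = g x} -> Rint f = Rint g.
Proof.
move=> mf mg fg; congr fine; apply: ae_eq_integral => //;
  by [exact/measurable_EFinP | exact: ae_EFin].
Qed.

Lemma itg_ae f g : itg f -> measurable_fun setT g ->
  {ae mu, forall x, f x = g x} -> itg g.
Proof.
move=> /integrableP[/measurable_EFinP mf ifo] mg fg.
apply/integrableP; split; first exact/measurable_EFinP.
rewrite (_ : (\int[mu]_x _)%E = (\int[mu]_x `|(f x)%:E|)%E)//.
apply: ae_eq_integral => //.
- by apply/measurable_EFinP; exact: measurableT_comp.
- by apply/measurable_EFinP; exact: measurableT_comp.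
- by apply: filterS fg => x fg _; rewrite fg.
Qed.

Lemma Rint_eq0_ae f : itg f -> (forall x, 0 <= f x) -> Rint f = 0 ->
  {ae mu, forall x, f x = 0}.
Proof.
move=> fi f0 fe; have mf := itg_meas fi.
have /ae_eq_integral_abs : measurable_fun setT (EFin \o f).
  exact/measurable_EFinP.
move=> /(_ mu measurableT)[+ _].
have -> : (\int[mu]_x `|(f x)%:E| = 0)%E.
  rewrite -[RHS](_ : (Rint f)%:E = 0%E) ?fe// -fe RintE//.
  by apply: eq_integral => x _; rewrite gee0_abs// lee_fin.
by move=> /(_ erefl); apply: filterS => x /(_ I) [].
Qed.

(** Truncating [|f|] at [g] gives a function bounded everywhere by [|g|] and almost everywhere equal
    to [|f|]. *)
Lemma itg_le_ae f g : measurable_fun setT f ->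
  {ae mu, forall x, `|f x| <= g x} -> itg g -> itg f.
Proof.
move=> mf fg gi; have mg := itg_meas gi.
have mn : measurable_fun setT (fun x => Num.min `|f x| (g x)).
  by apply: measurable_minr => //; exact: measurableT_comp.
have gi' := itg_norm gi.
have : itg (fun x => Num.min `|f x| `|g x|).
  apply: itg_le gi'.
    by apply: measurable_minr => //; exact: measurableT_comp.
  by move=> x; rewrite ger0_norm ?le_min ?normr_ge0// ge_min lexx orbT.
move=> mi; apply: (itg_le mf (g := fun x => `|f x|)) => //.
apply: itg_ae mi _ _; first exact: measurableT_comp.
apply: filterS fg => x fg; apply/min_idPl; rewrite (le_trans fg)// ler_norm//.
Qed.

Lemma le_Rint_ae f g : itg f -> itg g -> {ae mu, forall x, f x <= g x} ->
  Rint f <= Rint g.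
Proof.
move=> fi gi fg; rewrite -subr_ge0 -RintB//.
have -> : Rint (fun x => g x - f x) = Rint (fun x => `|g x - f x|).
  have gfi := itgB gi fi; apply: Rint_ae; [exact: itg_meas|exact: itg_meas (itg_norm gfi)|].
  by apply: filterS fg => x fg; rewrite ger0_norm// subr_ge0.
exact: Rint_ge0.
Qed.

Definition L2 f := measurable_fun setT f /\ itg (fun x => f x ^+ 2).

Definition dot f g := Rint (fun x => f x * g x).

Lemma itg_dot f g : L2 f -> L2 g -> itg (fun x => f x * g x).
Proof.
move=> [mf f2] [mg g2].
apply: (@itg_le _ (fun x => f x ^+ 2 + g x ^+ 2)).
- exact: measurable_funM.
- move=> x; rewrite normrM -(real_normK (num_real (f x))).
  rewrite -(real_normK (num_real (g x))).
  by have := sqr_ge0 (`|f x| - `|g x|); have := sqr_ge0 (`|f x| + `|g x|); nra.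
- exact: itgD.
Qed.

Lemma L2D f g : L2 f -> L2 g -> L2 (fun x => f x + g x).
Proof.
move=> Lf Lg; have [mf f2] := Lf; have [mg g2] := Lg; split.
  exact: measurable_funD.
apply: (eq_itg (f := fun x => (f x ^+ 2 + 2 * (f x * g x)) + g x ^+ 2)).
  by move=> x; ring.
by apply: itgD => //; apply: itgD => //; apply: itgZ; exact: itg_dot.
Qed.

Lemma L2Z a f : L2 f -> L2 (fun x => a * f x).
Proof.
move=> [mf f2]; split; first exact: measurable_funM.
apply: (eq_itg (f := fun x => a ^+ 2 * f x ^+ 2)); first by move=> x; ring.
exact: itgZ.
Qed.

Lemma L2N f : L2 f -> L2 (fun x => - f x).
Proof.
by move=> /(L2Z (-1)); rewrite (funext (fun x => mulN1r (f x))).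
Qed.

Lemma L2B f g : L2 f -> L2 g -> L2 (fun x => f x - g x).
Proof. by move=> Lf Lg; apply: L2D => //; exact: L2N. Qed.

Lemma L2_0 : L2 (fun=> 0).
Proof.
by split; [exact: measurable_cst|rewrite expr0n; exact: itg0].
Qed.

Lemma L2_le f g : measurable_fun setT f -> (forall x, `|f x| <= g x) ->
  L2 g -> L2 f.
Proof.
move=> mf fg [mg g2]; split=> //; apply: itg_le g2.
  exact: measurable_funX.
move=> x; rewrite ger0_norm ?sqr_ge0// -real_normK ?num_real//.
by rewrite lerXn2r// nnegrE (le_trans _ (fg x)).
Qed.

Lemma L2_norm f : L2 f -> L2 (fun x => `|f x|).
Proof.
move=> [mf f2]; split; first exact: measurableT_comp.
by apply: eq_itg f2 => x; rewrite real_normK ?num_real.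
Qed.

Lemma L2_indic A : measurable A -> itg (\1_A : T -> R) -> L2 (\1_A : T -> R).
Proof.
move=> mA; split; first exact: measurable_indic.
apply: (eq_itg (f := \1_A : T -> R)) => // x.
by rewrite indicE; case: (_ \in _); rewrite ?expr1n ?expr0n.
Qed.

Lemma L2_indic_mul A f : measurable A -> L2 f -> L2 (fun x => \1_A x * f x).
Proof.
move=> mA Lf; have [mf _] := Lf; apply: L2_le (L2_norm Lf).
  by apply: measurable_funM => //; exact: measurable_indic.
by move=> x; rewrite indicE; case: (_ \in _); rewrite ?mul1r// mul0r normr0.
Qed.

Lemma L2_ae f g : L2 f -> measurable_fun setT g ->
  {ae mu, forall x, f x = g x} -> L2 g.
Proof.
move=> [mf f2] mg fg; split=> //; apply: itg_ae f2 _ _.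
  exact: measurable_funX.
by apply: filterS fg => x ->.
Qed.

Lemma semi_inner_L2 : @semi_inner R (T -> R^o) dot L2.
Proof.
split.
- exact: L2_0.
- by move=> f g; exact: L2D.
- by move=> a f; exact: L2Z.
- by move=> f g; apply: eq_Rint => x; rewrite mulrC.
- move=> f g h Lf Lg Lh; rewrite /dot -RintD; [|exact: itg_dot..].
  by apply: eq_Rint => x; rewrite fctE mulrDl.
- move=> a f g Lf Lg; rewrite /dot -RintZ; last exact: itg_dot.
  by apply: eq_Rint => x; rewrite fctE mulrA.
- by move=> f; apply: Rint_ge0 => x; rewrite -expr2 sqr_ge0.
Qed.

Lemma dot_sqr f : dot f f = Rint (fun x => f x ^+ 2).
Proof. by apply: eq_Rint => x; rewrite expr2. Qed.

End integrable_functions.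

(** * Pointwise limits and completeness of L2 *)

Section fast_limit.
Context (R : realType).

(* A single formula for pointwise limits that preserves measurability for every
   sigma-algebra, whether or not the limit exists. *)
Definition rlim (u : nat -> R) : R := fine (limn_esup (fun n => (u n)%:E)).

Lemma rlimE (u : nat -> R) l : u @ \oo --> l -> rlim u = l.
Proof.
move=> ul; rewrite /rlim; have : (fun n => (u n)%:E) @ \oo --> l%:E.
  by apply: cvg_EFin => //; near=> n.
by move=> /cvg_limn_einf_sup[_ ->].
Unshelve. all: by end_near. Qed.

(** [K = S / (1 - t)] is the sum of the bounds and satisfies [K = S + K t]; hence [u n + K t^n]
    decreases, [u n - K t^n] increases, and the two enclose the limit. *)
Lemma geometric_cvg (u : nat -> R) (S t : R) : 0 <= S -> 0 < t < 1 ->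
  (forall n, `|u n.+1 - u n| <= S * t ^+ n) ->
  exists2 l, u @ \oo --> l & forall n, `|u n - l| <= S / (1 - t) * t ^+ n.
Proof.
move=> S0 /andP[t0 t1] du.
have t10 : 1 - t != 0 by rewrite subr_eq0 eq_sym lt_eqF.
pose K := S / (1 - t).
have K0 : 0 <= K by rewrite divr_ge0// subr_ge0 ltW.
have KS : K = S + K * t by rewrite /K; field.
pose a n := u n + K * t ^+ n; pose b n := u n - K * t ^+ n.
have tn n : 0 <= t ^+ n by rewrite exprn_ge0// ltW.
have step n : K * t ^+ n = S * t ^+ n + K * t ^+ n.+1.
  by rewrite {1}KS exprS mulrDl mulrA.
have a_dec : nonincreasing_seq a.
  apply/nonincreasing_seqP => n; rewrite /a.
  by have := du n; rewrite ler_norml => /andP[_]; have := step n; lra.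
have b_inc : nondecreasing_seq b.
  apply/nondecreasing_seqP => n; rewrite /b.
  by have := du n; rewrite ler_norml => /andP[+ _]; have := step n; lra.
have ba n : b n <= a n.
  by rewrite /a /b; have := mulr_ge0 K0 (tn n); lra.
have ca : cvgn a.
  apply: nonincreasing_is_cvgn => //; exists (b 0%N) => _ [n _ <-].
  by apply: le_trans (ba n); exact: b_inc.
have Kt0 : (fun n => K * t ^+ n) @ \oo --> 0.
  rewrite -[X in _ --> X](mulr0 K); apply: cvgM; first exact: cvg_cst.
  by apply: cvg_expr; rewrite gtr0_norm.
have uE : u = (fun n => a n - K * t ^+ n) by apply/funext => n; rewrite /a addrK.
have ul : u @ \oo --> limn a.
  rewrite {1}uE -[X in _ --> X]subr0; apply: cvgB => //.
have bE : b = (fun n => u n - K * t ^+ n) by [].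
have bl : b @ \oo --> limn a.
  by rewrite bE -[X in _ --> X]subr0; apply: cvgB.
exists (limn a) => // n.
have h1 := nonincreasing_cvgn_ge a_dec ca n.
have h2 : b n <= limn a.
  have <- : limn b = limn a by apply/cvg_lim.
  by apply: nondecreasing_cvgn_le => //; apply/cvg_ex; exists (limn a).
by move: h1 h2; rewrite -/K /a /b ler_norml; move=> ? ?; apply/andP; split; lra.
Qed.

End fast_limit.

Section riesz_fischer.
Context d (T : measurableType d) (R : realType).
Variable mu : {measure set T -> \bar R}.

Lemma measurable_rlim d' (T' : measurableType d') (D : set T') (f : nat -> T' -> R) :
  (forall n, measurable_fun D (f n)) ->
  measurable_fun D (fun z => rlim (fun n => f n z)).
Proof.
move=> mf; apply: (measurableT_comp (fine_measurable measurableT)).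
apply: (measurable_fun_limn_esup (f := fun n z => (f n z)%:E)) => n.
exact/measurable_EFinP.
Qed.

(* Geometric decay of the squared increments makes the series H of increments,
   weighted by t ^- 2n, integrable; H then dominates the tails pointwise. *)
Lemma riesz_fischer (f : nat -> T -> R) (C q : R) :
  0 <= C -> 0 < q < 1 -> (forall n, L2 mu (f n)) ->
  (forall n, dot mu (fun z => f n.+1 z - f n z) (fun z => f n.+1 z - f n z)
     <= C * q ^+ n) ->
  let g := fun z => rlim (fun n => f n z) in
  L2 mu g /\
  (fun n => dot mu (fun z => f n z - g z) (fun z => f n z - g z)) @ \oo
     --> (0 : R).
Proof.
move=> C0 /andP[q0 q1] Lf df g.
(* This [t] lies below 1, and [q < t ^+ 2] because [(1 - q)^2 > 0]; thus both [(q / t^2)^n], for the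
   mean of the series, and [t^n], for the pointwise steps, are summable. *)
pose t := (1 + q) / 2.
have t0 : 0 < t by rewrite /t; lra.
have t1 : t < 1 by rewrite /t; lra.
have qt : q < t ^+ 2 by rewrite /t; have : 0 < (1 - q) ^+ 2 by [rewrite exprn_gt0//; lra]; nra.
pose r := q / t ^+ 2.
have t20 : 0 < t ^+ 2 by rewrite exprn_gt0.
have r0 : 0 < r by rewrite divr_gt0.
have r1 : r < 1 by rewrite ltr_pdivrMr// mul1r.
pose e n z := (t ^+ 2) ^- n * (f n.+1 z - f n z) ^+ 2.
have e0 n z : 0 <= e n z.
  by rewrite mulr_ge0// ?sqr_ge0// invr_ge0 exprn_ge0// ltW.
have Ld n : L2 mu (fun z => f n.+1 z - f n z) by exact: L2B.
have ie n : itg mu (e n) by apply: itgZ; exact: (Ld n).2.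
have me n : measurable_fun setT (e n) by exact: itg_meas.
pose H z := (\sum_(n <oo) (e n z)%:E)%E.
have H0 z : (0 <= H z)%E by apply: nneseries_ge0 => n _ _; rewrite lee_fin.
have mH : measurable_fun setT H.
  by apply: ge0_emeasurable_sum => [n z _ _|n _]; [rewrite lee_fin|exact/measurable_EFinP].
have Hint : (\int[mu]_z H z <= (C / (1 - r))%:E)%E.
  rewrite integral_nneseries//; last first.
  - by move=> n z _; rewrite lee_fin.
  - by move=> n; exact/measurable_EFinP.
  apply: lime_le.
    by apply: is_cvg_nneseries => n _ _; apply: integral_ge0 => z _; rewrite lee_fin.
  near=> N; apply: (@le_trans _ _ (\sum_(0 <= n < N) (C * r ^+ n)%:E)%E).
    apply: lee_sum => n _; rewrite -RintE// lee_fin RintZ; last exact: (Ld n).2.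
    have := df n; rewrite dot_sqr => dfn.
    rewrite (_ : C * r ^+ n = (t ^+ 2) ^- n * (C * q ^+ n)); last first.
      by rewrite /r expr_div_n; ring.
    by rewrite ler_wpM2l// invr_ge0 exprn_ge0// ltW.
  rewrite sumEFin lee_fin.
  have := congr1 (@^~ N) (geometric_seriesE C (negbT (lt_eqF r1))).
  rewrite /series/= => ->; rewrite ler_pM2r ?invr_gt0 ?subr_gt0//.
  by rewrite ler_piMr// lerBlDr lerDl exprn_ge0// ltW.
have iH : mu.-integrable setT H.
  apply/integrableP; split=> //; apply: le_lt_trans (ltry (C / (1 - r))).
  by under eq_integral do rewrite gee0_abs//.
have aeH : {ae mu, forall z, H z \is a fin_num}.
  by have := integrable_ae measurableT iH; apply: filterS => z /(_ I).
pose h z := fine (H z).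
have mh : measurable_fun setT h by apply: (measurableT_comp (fine_measurable measurableT)).
have h0 z : 0 <= h z by exact: fine_ge0.
have ih : itg mu h.
  apply: le_integrable iH => //; first exact/measurable_EFinP.
  by move=> z _; rewrite /h; case: (H z) => //=; rewrite ?lee_fin ?normr0// leey.
pose K := (1 - t) ^- 2.
have K0 : 0 <= K by rewrite invr_ge0 sqr_ge0.
have key : {ae mu, forall z n,
    (f n z - g z) ^+ 2 <= (K * (t ^+ 2) ^+ n) * h z}.
  apply: filterS aeH => z Hz.
  have eh n : e n z <= h z.
    rewrite -lee_fin /h fineK//.
    have := @nneseries_lim_ge _ (fun n => (e n z)%:E) xpredT 0 n.+1
      (fun n _ _ => e0 n z).
    apply: le_trans; rewrite big_nat_recr//= leeDr// sume_ge0// => i _.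
    by rewrite lee_fin.
  have S0 : 0 <= Num.sqrt (h z) by exact: sqrtr_ge0.
  have tn n : 0 <= t ^+ n by rewrite exprn_ge0// ltW.
  have t01 : 0 < t < 1 by rewrite t0.
  have t2n n : (t ^+ 2) ^+ n = (t ^+ n) ^+ 2 by rewrite -!exprM mulnC.
  (* Each weighted term is at most the sum [h z], so the steps at [z] are at most
     [Num.sqrt (h z) * t ^+ n]; the tail bound for such steps produces [K]. *)
  have [|l fl lP] := geometric_cvg (u := f^~ z) S0 t01.
    move=> n; rewrite -ler_sqr ?nnegrE ?mulr_ge0//.
    rewrite real_normK ?num_real// exprMn sqr_sqrtr//.
    have := eh n; rewrite /e t2n mulrC ler_pdivrMr// exprn_gt0//.
    by rewrite exprn_gt0.
  move=> n; rewrite /g (rlimE fl) -real_normK ?num_real//.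
  apply: (@le_trans _ _ ((Num.sqrt (h z) / (1 - t) * t ^+ n) ^+ 2)).
    by rewrite ler_sqr ?nnegrE ?mulr_ge0// invr_ge0 subr_ge0 ltW.
  have E (x y w : R) : (x / y * w) ^+ 2 = x ^+ 2 * y ^- 2 * w ^+ 2.
    by rewrite !exprMn exprVn.
  by rewrite E sqr_sqrtr// t2n -/K (mulrC (h z)) mulrAC.
have mf n : measurable_fun setT (f n) := (Lf n).1.
have mg : measurable_fun setT g by exact: measurable_rlim.
have ib n : itg mu (fun z => (K * (t ^+ 2) ^+ n) * h z) by exact: itgZ.
have key1 n : {ae mu, forall z, (f n z - g z) ^+ 2 <= (K * (t ^+ 2) ^+ n) * h z}.
  by apply: filterS key => z /(_ n).
have Lfg n : L2 mu (fun z => f n z - g z).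
  have mfg : measurable_fun setT (fun z => f n z - g z) by exact: measurable_funB.
  split=> //; apply: itg_le_ae (ib n); first exact: measurable_funX.
  by apply: filterS (key1 n) => z; rewrite ger0_norm// sqr_ge0.
split.
  have -> : g = (fun z => f 0%N z - (f 0%N z - g z)).
    by apply/funext => z; rewrite opprB addrC subrK.
  exact: L2B.
have bnd n : dot mu (fun z => f n z - g z) (fun z => f n z - g z)
    <= K * Rint mu h * (t ^+ 2) ^+ n.
  rewrite dot_sqr mulrAC -RintZ//; apply: le_Rint_ae => //; exact: (Lfg n).2.
apply: (@squeeze_cvgr _ _ _ _ (fun=> 0) (fun n => K * Rint mu h * (t ^+ 2) ^+ n)).
- near=> n; rewrite bnd andbT; apply: Rint_ge0 => z.
  by rewrite -expr2 sqr_ge0.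
- exact: cvg_cst.
- rewrite -[X in _ --> X](mulr0 (K * Rint mu h)); apply: cvgM; first exact: cvg_cst.
  apply: cvg_expr; rewrite ger0_norm ?sqr_ge0//.
  by rewrite expr_lt1// ltW.
Unshelve. all: by end_near. Qed.

End riesz_fischer.

Import HBSimple HBNNSimple.

(** * Functions whose integral vanishes over a sigma-algebra *)

Section vanishing.
Context d (T : measurableType d) (R : realType).
Variable mu : {measure set T -> \bar R}.
Implicit Types f g : T -> R.

Lemma Rint_dominated (f_ : nat -> T -> R) f g :
  (forall n, measurable_fun setT (f_ n)) -> measurable_fun setT f ->
  (forall x, (fun n => f_ n x) @ \oo --> f x) ->
  (forall n x, `|f_ n x| <= g x) -> itg mu g ->
  itg mu f /\ (fun n => Rint mu (f_ n)) @ \oo --> Rint mu f.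
Proof.
move=> mf_ mf f_f f_g gi.
have [||||| iF _ cF] := @dominated_convergence _ T R mu setT measurableT
  (fun n x => (f_ n x)%:E) (fun x => (f x)%:E) (fun x => (g x)%:E).
- by move=> n; exact/measurable_EFinP.
- exact/measurable_EFinP.
- by apply: aeW => x _; apply: cvg_EFin; [near=> n | exact: f_f].
- exact: gi.
- by apply: aeW => x n _; rewrite /= lee_fin.
split; first exact: iF.
by rewrite -(RintE iF) in cF; exact: fine_cvg cF.
Unshelve. all: by end_near. Qed.

Lemma itg_indic_mul f A : measurable A -> itg mu f ->
  itg mu (fun x => \1_A x * f x).
Proof.
move=> mA fi; apply: itg_le (itg_norm fi).
  by apply: measurable_funM; [exact: measurable_indic | exact: (itg_meas fi)].
by move=> x; rewrite indicE; case: (_ \in _); rewrite ?mul1r// mul0r normr0.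
Qed.

Lemma Rint_sum (n : nat) (F : 'I_n -> T -> R) : (forall i, itg mu (F i)) ->
  itg mu (fun x => \sum_(i < n) F i x) /\
  Rint mu (fun x => \sum_(i < n) F i x) = \sum_(i < n) Rint mu (F i).
Proof.
elim: n F => [|n IH] F iF.
  rewrite (_ : (fun x => _) = fun=> 0) ?big_ord0 ?Rint0; first by split; [exact: itg0|].
  by apply/funext => x; rewrite big_ord0.
have [iS eS] := IH (fun i => F (widen_ord (leqnSn n) i)) (fun i => iF _).
rewrite (_ : (fun x => _) = fun x =>
  \sum_(i < n) F (widen_ord (leqnSn n) i) x + F ord_max x); last first.
  by apply/funext => x; rewrite big_ord_recr.
by rewrite big_ord_recr/= RintD// eS; split=> //; exact: itgD.
Qed.

(** The sets over which [f] integrates to 0 form a lambda-system: proper differences by linearity,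
    increasing unions by domination with [|f|], the whole space by [Rint mu f = 0]. This is the
    uniqueness theorem for measures in a form suited to signed [f]. *)
Lemma Rint_pi_lambda (G : set (set T)) f :
  setI_closed G -> G `<=` measurable -> itg mu f -> Rint mu f = 0 ->
  (forall A, G A -> Rint mu (fun x => \1_A x * f x) = 0) ->
  forall A, <<s G >> A -> Rint mu (fun x => \1_A x * f x) = 0.
Proof.
move=> GI Gm fi f0 Gf.
have indicT x : \1_[set: T] x = 1 :> R by rewrite indicE in_setT.
pose D := [set A | measurable A /\ Rint mu (fun x => \1_A x * f x) = 0].
have DD : lambda_system setT D.
  split.
  - by [].
  - by split=> //; rewrite -f0; apply: eq_Rint => x; rewrite indicT mul1r.
  - move=> A B BA [mA A0] [mB B0]; split; first exact: measurableD.
    rewrite (_ : (fun x => _) = fun x => \1_A x * f x - \1_B x * f x).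
      by rewrite RintB ?A0 ?B0 ?subr0//; exact: itg_indic_mul.
    apply/funext => x; rewrite -mulrBl; congr (_ * _).
    rewrite !indicE; have [xB|xB] := pselect (B x).
      by rewrite (mem_set xB) (mem_set (BA _ xB)) subrr memNset// => -[].
    rewrite (memNset xB) subr0; have [xA|xA] := pselect (A x).
      by rewrite !mem_set.
    by rewrite !memNset// => -[].
  - move=> F ndF DF; split.
      by apply: bigcup_measurable => k _; exact: (DF k).1.
    have mU : measurable (\bigcup_n F n).
      by apply: bigcup_measurable => k _; exact: (DF k).1.
    have [|||||_] := @Rint_dominated (fun n x => \1_(F n) x * f x)
      (fun x => \1_(\bigcup_n F n) x * f x) (fun x => `|f x|).
    + move=> n; apply: measurable_funM; last exact: itg_meas fi.
      by apply: measurable_indic; exact: (DF n).1.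
    + by apply: measurable_funM; [exact: measurable_indic | exact: itg_meas fi].
    + move=> x; apply: cvgM; last exact: cvg_cst.
      rewrite indicE; have [[n _ Fn]|nF] := pselect ((\bigcup_n F n) x).
        rewrite mem_set; last by exists n.
        apply: cvg_near_cst; near=> m; rewrite indicE mem_set//.
        have /ndF : (n <= m)%N by near: m; exists n.
        by move=> /subsetPset; apply.
      rewrite memNset//; apply: cvg_near_cst; near=> m; rewrite indicE memNset//.
      by move=> Fm; apply: nF; exists m.
    + move=> n x; rewrite indicE.
      by case: (_ \in _); rewrite ?mul1r// mul0r normr0.
    + exact: itg_norm.
    rewrite (_ : (fun n => _) = fun=> 0); last by apply/funext => n; rewrite (DF n).2.
    by move=> /cvg_lim <-//; rewrite lim_cst.
move=> A sA.
suff: D A by case.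
apply: (lambda_system_subset GI DD) => //.
by move=> B GB; split; [exact: Gm | exact: Gf].
Unshelve. all: by end_near. Qed.

(** Plays the role of taking known factors out of a conditional expectation. [Z] may be unbounded:
    integrability of [Z f] supplies the dominating function for simple approximations of its
    positive and negative parts. *)
Lemma Rint_vanish (G : set (set T)) f (Z : T -> R) :
  <<s G >> `<=` measurable -> itg mu f ->
  (forall A, <<s G >> A -> Rint mu (fun x => \1_A x * f x) = 0) ->
  measurable_fun setT (Z : g_sigma_algebraType G -> R) ->
  itg mu (fun x => Z x * f x) -> Rint mu (fun x => Z x * f x) = 0.
Proof.
move=> Gm fi f0 mZ Zfi.
have meas_sub (h : T -> R) : measurable_fun setT (h : g_sigma_algebraType G -> R) ->
    measurable_fun setT h.
  by move=> mh _ B mB; apply: Gm; exact: mh.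
suff main (Y : T -> R) : (forall x, 0 <= Y x) ->
    measurable_fun setT (Y : g_sigma_algebraType G -> R) ->
    (forall x, Y x <= `|Z x|) -> Rint mu (fun x => Y x * f x) = 0.
  have := main (fun x => Num.max (Z x) 0); have := main (fun x => Num.max (- Z x) 0).
  move=> h1 h2.
  have m1 : measurable_fun setT ((fun x => Num.max (Z x) 0) : g_sigma_algebraType G -> R).
    by apply: measurable_maxr => //; exact: measurable_cst.
  have m2 : measurable_fun setT ((fun x => Num.max (- Z x) 0) : g_sigma_algebraType G -> R).
    by apply: measurable_maxr; [exact: measurableT_comp | exact: measurable_cst].
  have b1 x : Num.max (Z x) 0 <= `|Z x| by rewrite ge_max normr_ge0 ler_norm.
  have b2 x : Num.max (- Z x) 0 <= `|Z x|.
    by rewrite ge_max normr_ge0 -normrN ler_norm.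
  have p1 x : 0 <= Num.max (Z x) 0 by rewrite le_max lexx orbT.
  have p2 x : 0 <= Num.max (- Z x) 0 by rewrite le_max lexx orbT.
  have i1 : itg mu (fun x => Num.max (Z x) 0 * f x).
    apply: itg_le (itg_norm Zfi).
      by apply: measurable_funM; [exact: meas_sub | exact: itg_meas fi].
    by move=> x; rewrite !normrM ler_wpM2r// ger0_norm.
  have i2 : itg mu (fun x => Num.max (- Z x) 0 * f x).
    apply: itg_le (itg_norm Zfi).
      by apply: measurable_funM; [exact: meas_sub | exact: itg_meas fi].
    by move=> x; rewrite !normrM ler_wpM2r// ger0_norm.
  rewrite (_ : (fun x => _) =
      fun x => Num.max (Z x) 0 * f x - Num.max (- Z x) 0 * f x).
    by rewrite RintB// h1// h2// subrr.
  apply/funext => x; rewrite -mulrBl; congr (_ * _).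
  have [Z0|Z0] := leP 0 (Z x).
    by have /max_idPr -> : - Z x <= 0; rewrite ?oppr_le0// subr0.
  by have /max_idPl -> : 0 <= - Z x; rewrite ?oppr_ge0 ?ltW// sub0r opprK.
move=> Y0 mY YZ.
have mYe : measurable_fun setT ((fun x => (Y x)%:E) : g_sigma_algebraType G -> \bar R).
  exact/measurable_EFinP.
(* The approximation is taken in the sigma-algebra generated by [G], so its level sets are among
   those over which [f] integrates to 0. *)
pose s n := nnsfun_approx measurableT mYe n.
have Yf0 x : setT x -> (0 <= (Y x)%:E)%E by rewrite lee_fin.
have sY n x : s n x <= Y x.
  by rewrite /s nnsfun_approxE -lee_fin; exact: (le_approx n Yf0 (x := x) I).
have s0 n x : 0 <= s n x by exact: fun_ge0.
have s_cvg x : (fun n => s n x) @ \oo --> Y x.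
  have := cvg_nnsfun_approx measurableT mYe Yf0 (x := x) I.
  exact: fine_cvg.
have [|||||_] := @Rint_dominated (fun n x => s n x * f x) (fun x => Y x * f x)
  (fun x => `|Z x * f x|).
- move=> n; apply: measurable_funM; last exact: itg_meas fi.
  by apply: meas_sub; exact: measurable_funPT.
- by apply: measurable_funM; [exact: meas_sub | exact: itg_meas fi].
- by move=> x; apply: cvgM => //; exact: cvg_cst.
- move=> n x; rewrite !normrM ler_wpM2r// ger0_norm//.
  exact: le_trans (sY n x) (YZ x).
- exact: itg_norm.
rewrite (_ : (fun n => _) = fun=> 0); first by move=> /cvg_lim <-//; rewrite lim_cst.
apply/funext => n.
have [k [c sE]] : exists k (c : nat -> R), forall x,
    s n x = \sum_(i < k) c i * \1_(s n @^-1` [set c i]) x.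
  by eexists; exists (fun i => (finmap.enum_fset (fset_set (range (s n))))`_i) => x; exact: fimfunEord.
rewrite (_ : (fun x => _) = fun x =>
  \sum_(i < k) (c i * (\1_(s n @^-1` [set c i]) x * f x))).
  have ii i : itg mu (fun x => c i * (\1_(s n @^-1` [set c i]) x * f x)).
    apply: itgZ; apply: itg_indic_mul => //; apply: Gm.
    exact: (measurable_funPTI (s n)).
  have [_ ->] := Rint_sum (F := fun (i : 'I_k) x =>
    c i * (\1_(s n @^-1` [set c i]) x * f x)) (fun i => ii i).
  apply: big1 => i _; rewrite RintZ ?f0 ?mulr0//.
    exact: (measurable_funPTI (s n)).
  apply: itg_indic_mul => //; apply: Gm; exact: (measurable_funPTI (s n)).
by apply/funext => x; rewrite sE mulr_suml; apply: eq_bigr => i _; rewrite mulrA.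
Qed.

End vanishing.

(** * Fubini's theorem for real-valued integrals *)

Section real_fubini.
Context d1 d2 (T1 : measurableType d1) (T2 : measurableType d2) (R : realType).
Variable m1 : {sigma_finite_measure set T1 -> \bar R}.
Variable m2 : {sigma_finite_measure set T2 -> \bar R}.
Implicit Type f : T1 * T2 -> R.

Lemma itg_fubini1 f : itg (m1 \x m2)%E f ->
  {ae m1, forall x, itg m2 (fun y => f (x, y))} /\
  itg m1 (fun x => Rint m2 (fun y => f (x, y))) /\
  Rint (m1 \x m2)%E f = Rint m1 (fun x => Rint m2 (fun y => f (x, y))).
Proof.
move=> fi; have aei := ae_integrable1 fi; split=> //.
have iF := integrable_fubini_F fi.
have mF := measurable_fubini_F fi.
have eF := integral12_prod_meas1 fi.
have aeF : {ae m1, forall x, (\int[m2]_y (f (x, y))%:E)%E =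
    (Rint m2 (fun y => f (x, y)))%:E}.
  by apply: filterS aei => x ix; rewrite RintE.
have mR : measurable_fun setT (fun x => Rint m2 (fun y => f (x, y))).
  exact: measurableT_comp (fine_measurable measurableT) mF.
have iR : itg m1 (fun x => Rint m2 (fun y => f (x, y))).
  apply: le_integrable iF => //; first exact/measurable_EFinP.
  move=> x _; rewrite /= /Rint /Rintegral -[fubini_F _ _ _]/(\int[m2]_y (f (x, y))%:E)%E.
  by case: (\int[m2]_y _)%E => //=; rewrite ?normr0 ?leey.
split=> //; apply: EFin_inj; rewrite !RintE// -eF.
apply: ae_eq_integral => //; first exact/measurable_EFinP.
by apply: filterS aeF => x + _.
Qed.

Lemma itg_fubini2 f : itg (m1 \x m2)%E f ->
  {ae m2, forall y, itg m1 (fun x => f (x, y))} /\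
  itg m2 (fun y => Rint m1 (fun x => f (x, y))) /\
  Rint (m1 \x m2)%E f = Rint m2 (fun y => Rint m1 (fun x => f (x, y))).
Proof.
move=> fi; have aei := ae_integrable2 fi; split=> //.
have mf := measurable_int _ fi.
have mF : measurable_fun setT (fun y => \int[m1]_x (f (x, y))%:E)%E.
  exact: (measurable_fubini_G fi).
have iF : m2.-integrable setT (fun y => \int[m1]_x (f (x, y))%:E)%E.
  apply/integrableP; split => //.
  have lt : (\int[m2]_y \int[m1]_x `|(f (x, y))%:E| < +oo)%E.
    by have [+ _] := integrable21ltyP m1 m2 mf; apply.
  apply: le_lt_trans lt.
  apply: ge0_le_integral => //.
  - exact: measurableT_comp.
  - apply: (measurable_fun_fubini_tonelli_G (fun z => `|(f z)%:E|)%E) => //.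
    exact: measurableT_comp.
  - move=> y _; apply: le_abse_integral => //.
    exact: measurableT_comp mf (measurable_pair2 y).
have eF := integral21_prod_meas1 fi.
have aeF : {ae m2, forall y, (\int[m1]_x (f (x, y))%:E)%E =
    (Rint m1 (fun x => f (x, y)))%:E}.
  by apply: filterS aei => x ix; rewrite RintE.
have mR : measurable_fun setT (fun y => Rint m1 (fun x => f (x, y))).
  exact: measurableT_comp (fine_measurable measurableT) mF.
have iR : itg m2 (fun y => Rint m1 (fun x => f (x, y))).
  apply: le_integrable iF => //; first exact/measurable_EFinP.
  move=> x _; rewrite /= /Rint /Rintegral.
  by case: (\int[m1]_x _)%E => //=; rewrite ?normr0 ?leey.
split=> //; apply: EFin_inj; rewrite !RintE// -eF.
apply: ae_eq_integral => //; first exact/measurable_EFinP.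
by apply: filterS aeF => x + _.
Qed.

Lemma itg_prod f (g : T1 -> R) : measurable_fun setT f ->
  (forall x, itg m2 (fun y => f (x, y))) ->
  (forall x, Rint m2 (fun y => `|f (x, y)|) <= g x) -> itg m1 g ->
  itg (m1 \x m2)%E f.
Proof.
move=> mf fi fg gi; apply/integrable12ltyP; first exact/measurable_EFinP.
apply: (@le_lt_trans _ _ (\int[m1]_x (g x)%:E)%E).
  apply: ge0_le_integral => //.
  - by move=> x _; apply: integral_ge0.
  - apply: (measurable_fun_fubini_tonelli_F (fun z => (`|f z|)%:E)) => //.
    by apply/measurable_EFinP; exact: measurableT_comp.
  - exact: measurable_int gi.
  - by move=> x _ /=; have /itg_norm/RintE <- := fi x; rewrite lee_fin.
by rewrite -RintE// ltry.
Qed.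

End real_fubini.

(** * Exponential kernels and linear equations *)

Section time_integrals.
Context (R : realType).
Local Notation leb := (@lebesgue_measure R).
Local Notation TR := (measurableTypeR R).

(** Tonelli applies to the positive and the negative part separately, so sections that fail to be
    integrable are harmless: [fine] gives them a default value in a measurable way. In the
    applications sections are integrable only almost surely. *)
Lemma measurable_Rint_param d1 d2 (T1 : measurableType d1)
    (T2 : measurableType d2) (m2 : {sigma_finite_measure set T2 -> \bar R})
    (f : T1 * T2 -> R) : measurable_fun setT f ->
  measurable_fun setT (fun x => Rint m2 (fun y => f (x, y))).
Proof.
move=> mf; have mfe : measurable_fun setT (fun z => (f z)%:E).
  exact/measurable_EFinP.
have : measurable_fun setT (fun x => \int[m2]_y (f (x, y))%:E)%E; last first.
  by move=> mi; exact: measurableT_comp (fine_measurable measurableT) mi.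
rewrite (_ : (fun x => _) = (fun x =>
  (\int[m2]_y (fun z => (f z)%:E)^\+ (x, y)) -
  (\int[m2]_y (fun z => (f z)%:E)^\- (x, y)))%E); last first.
  apply/funext => x; rewrite integralE.
  by congr (_ - _)%E; apply: eq_integral => y _; rewrite ?funeposE ?funenegE.
apply: emeasurable_funB.
- apply: (measurable_fun_fubini_tonelli_F (fun z => (f z)%:E)^\+)%E => //.
  exact: measurable_funepos.
- apply: (measurable_fun_fubini_tonelli_F (fun z => (f z)%:E)^\-)%E => //.
  exact: measurable_funeneg.
Qed.

Lemma measurable_Rint_time d (T : measurableType d) (f : R * T -> R) :
  measurable_fun setT (f : TR * T -> R) ->
  measurable_fun setT (fun w => Rint leb (fun r => f (r, w))).
Proof.
move=> mf; apply: (measurable_Rint_param leb (f := fun y : T * TR => f (y.2, y.1))).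
have mi : measurable_fun setT (fun y : T * TR => (y.2, y.1) : TR * T).
  by apply: measurable_fun_pair; [exact: measurable_snd | exact: measurable_fst].
exact: measurableT_comp mf mi.
Qed.

Lemma measurable_fst_itv d (T : measurableType d) (i : interval R) :
  measurable_fun setT (fun z : TR * T => \1_[set` i] z.1 : R).
Proof.
apply: (measurableT_comp (f := \1_[set` i] : TR -> R)); last exact: measurable_fst.
by apply: measurable_indic; exact: measurable_itv.
Qed.

(** Rounding the second argument to multiples of [1 / (n + 1)] leaves countably many measurable
    sections of [h]; the Lipschitz bound makes the rounded functions converge pointwise. *)
Lemma caratheodory_measurable d (T : measurableType d) (h : R -> R -> R)
    (L : R) (t : T -> R) (x : T -> R) :
  (forall y, measurable_fun setT (h ^~ y)) ->
  (forall s y y', `|h s y - h s y'| <= L * `|y - y'|) ->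
  measurable_fun setT t -> measurable_fun setT x ->
  measurable_fun setT (fun z => h (t z) (x z)).
Proof.
move=> mh Lh mt mx.
pose r (n : nat) (y : R) : R := (Num.floor (n.+1%:R * y))%:~R / n.+1%:R.
have r_bound n y : `|r n y - y| <= n.+1%:R^-1.
  rewrite /r; have n0 : 0 < n.+1%:R :> R by [].
  have -> : (Num.floor (n.+1%:R * y))%:~R / n.+1%:R - y =
      ((Num.floor (n.+1%:R * y))%:~R - n.+1%:R * y) / n.+1%:R.
    by field; rewrite gt_eqF.
  have n1 : 0 <= n.+1%:R^-1 :> R by rewrite invr_ge0 ltW.
  rewrite normrM (ger0_norm n1) ler_piMl//.
  have := floor_le (n.+1%:R * y); have := floorD1_gt (n.+1%:R * y).
  rewrite intrD; move=> h1 h2; rewrite ler_norml; apply/andP; split; lra.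
apply: (measurable_fun_cvg (h := fun n => fun z => h (t z) (r n (x z)))).
- move=> n _ B mB; rewrite setTI.
  rewrite (_ : _ @^-1` _ = \bigcup_(k : int)
    ((t @^-1` ((h ^~ (k%:~R / n.+1%:R)) @^-1` B)) `&`
     (x @^-1` [set y | Num.floor (n.+1%:R * y) = k]))); last first.
    apply/seteqP; split => [z /= Bz|z /= [k _ [Bz kz]]].
      by exists (Num.floor (n.+1%:R * x z)).
    by rewrite /r kz.
  apply: countable_bigcupT_measurable => // k.
  apply: measurableI.
    rewrite -[X in measurable X]setTI; apply: mt => //.
    by rewrite -[X in measurable X]setTI; apply: mh.
  rewrite -[X in measurable X]setTI; apply: mx => //.
  rewrite (_ : [set y | _] = `[k%:~R / n.+1%:R, (k + 1)%:~R / n.+1%:R[%classic).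
    exact: measurable_itv.
  have n0 : 0 < n.+1%:R :> R by [].
  apply/seteqP; split => y /=; rewrite in_itv/= ler_pdivrMr// ltr_pdivlMr// mulrC.
    by move=> <-; rewrite floor_le floorD1_gt.
  by move=> /andP[h1 h2]; apply: floor_def; rewrite h1.
(* The sign of [L] is unknown here; for [L <= 0] the function [h] is constant in its second
   argument. *)
- move=> z _; apply/cvgrPdist_le => e e0; have [L0|L0] := leP L 0.
    near=> n; apply: (le_trans (Lh _ _ _)).
    by rewrite (le_trans _ (ltW e0))// mulr_le0_ge0.
  have eL : 0 < L^-1 * e by rewrite mulr_gt0// invr_gt0.
  near=> n; apply: (le_trans (Lh _ _ _)).
  rewrite -ler_pdivlMl// distrC (le_trans (r_bound _ _))//.
  by near: n; apply: filterS (near_infty_natSinv_lt (PosNum eL)) => n /ltW.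
Unshelve. all: by end_near. Qed.

(** Variation of constants for [x' = - d x + y], cut off outside [0 <= s <= t]. At [d = 0] it is the
    indicator of [[0, t]], so that plain integration and the resolvent are instances of one operator
    [Kp]. *)
Definition kern (d t s : R) : R :=
  if (0 <= s) && (s <= t) then expR (- d * (t - s)) else 0.

Definition Kp (d : R) (y : R -> R) (t : R) : R := Rint leb (fun s => kern d t s * y s).

Lemma kern_ge0 d t s : 0 <= kern d t s.
Proof. by rewrite /kern; case: ifP => // _; exact: expR_ge0. Qed.

Lemma kern_le1 d t s : 0 <= d -> kern d t s <= 1.
Proof.
move=> d0; rewrite /kern; case: ifP => [/andP[s0 st]|] //.
by rewrite -[leRHS]expR0 ler_expR mulNr oppr_le0 mulr_ge0// subr_ge0.
Qed.

Lemma kern0E t s : kern 0 t s = \1_(`[0, t]%classic) s.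
Proof.
rewrite /kern oppr0 mul0r expR0 indicE; case: ifP => ts.
  by rewrite mem_set//= in_itv.
by rewrite memNset//= in_itv/= ts.
Qed.

Lemma measurable_kern d (d' : measure_display) (T : measurableType d')
    (t s : T -> R) : measurable_fun setT t -> measurable_fun setT s ->
  measurable_fun setT (fun z => kern d (t z) (s z)).
Proof.
move=> mt ms; apply: measurable_fun_ifT.
- apply: measurable_and; apply: measurable_fun_ler => //; exact: measurable_cst.
- apply: (measurableT_comp (@measurable_expR R)); apply: measurable_funM.
    exact: measurable_cst.
  exact: measurable_funB.
- exact: measurable_cst.
Qed.

Lemma measurable_Kp d (d' : measure_display) (T : measurableType d')
    (t : T -> R) (b : R * T -> R) : measurable_fun setT t ->
  measurable_fun setT (b : TR * T -> R) ->
  measurable_fun setT (fun z => Kp d (fun s => b (s, z)) (t z)).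
Proof.
move=> mt mb.
apply: (measurable_Rint_param leb
  (f := fun z : T * TR => kern d (t z.1) z.2 * b (z.2, z.1))).
apply: measurable_funM.
  apply: measurable_kern; last exact: measurable_snd.
  by apply: measurableT_comp => //; exact: measurable_fst.
apply: measurableT_comp => //; apply: measurable_fun_pair.
  exact: measurable_snd.
exact: measurable_fst.
Qed.

Lemma itg_kern d t (y : R -> R) : 0 <= d -> itg leb y ->
  itg leb (fun s => kern d t s * y s).
Proof.
move=> d0 iy; apply: itg_le (itg_norm iy).
  apply: measurable_funM; last exact: (itg_meas iy).
  by apply: measurable_kern; [exact: measurable_cst|exact: measurable_id].
move=> s; rewrite normrM ler_piMl// ger0_norm ?kern_ge0//.
exact: kern_le1.
Qed.

Lemma KpD d t (y z : R -> R) : 0 <= d -> itg leb y -> itg leb z ->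
  Kp d (fun s => y s + z s) t = Kp d y t + Kp d z t.
Proof.
move=> d0 iy iz; rewrite /Kp -RintD; [|exact: itg_kern..].
by apply: eq_Rint => s; rewrite mulrDr.
Qed.

Lemma KpZ d t a (y : R -> R) : 0 <= d -> itg leb y ->
  Kp d (fun s => a * y s) t = a * Kp d y t.
Proof.
move=> d0 iy; rewrite /Kp -RintZ; last exact: itg_kern.
by apply: eq_Rint => s; ring.
Qed.

Lemma Kp_norm d t (y : R -> R) : 0 <= d -> itg leb y ->
  `|Kp d y t| <= Rint leb (fun s => `|y s|).
Proof.
move=> d0 iy; apply: (le_trans (Rint_norm (itg_kern t d0 iy))).
apply: le_Rint => [||s]; [|exact: itg_norm|].
  by apply: itg_norm; exact: itg_kern.
by rewrite normrM ler_piMl// ger0_norm ?kern_ge0// kern_le1.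
Qed.

Lemma Kp0E (y : R -> R) t : Kp 0 y t = \int[leb]_(s in `[0, t]) y s.
Proof.
rewrite Rintegral_mkcond; apply: eq_Rint => s; rewrite kern0E /patch indicE.
by case: ifP => _; rewrite ?mul1r ?mul0r.
Qed.

End time_integrals.

(** * Resolvent identities and the linear integral equation *)

Section volterra.
Context (R : realType).
Local Notation leb := (@lebesgue_measure R).
Local Notation TR := (measurableTypeR R).

Lemma itg_itv (a b : R) : itg leb (\1_(`[a, b]%classic) : R -> R).
Proof. by have := @integrable_indic_itv R a b true false. Qed.

Lemma Rint_itv (a b : R) : a <= b -> Rint leb (\1_(`[a, b]%classic) : R -> R) = b - a.
Proof.
move=> ab; apply: EFin_inj; rewrite RintE; last exact: itg_itv.
rewrite integral_indic// setIT; apply: (etrans (@lebesgue_measure_itv R `[a, b])).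
rewrite /= lte_fin; by case: ltgtP ab => // -> _; rewrite subrr.
Qed.

Lemma integral_expR (alpha beta r t : R) : r <= t ->
  \int[leb]_(s in `[r, t]) (beta * expR (alpha + beta * s)) =
  expR (alpha + beta * t) - expR (alpha + beta * r).
Proof.
rewrite le_eqVlt => /predU1P[->|rt].
  by rewrite set_itv1 Rintegral_set1 subrr.
have dg (s : R) : is_derive s 1 (fun s : R => alpha + beta * s) beta.
  have h : is_derive s 1 ((cst alpha : R -> R) \+ ((cst beta : R -> R) \* (id : R -> R)))
      (0 + (beta *: 1 + s *: 0)).
    exact: is_deriveD.
  apply: (is_derive_eq h); rewrite add0r.
  by rewrite scaler0 addr0 /GRing.scale/= mulr1.
have dF (s : R) : is_derive s 1 (fun s => expR (alpha + beta * s))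
    (beta * expR (alpha + beta * s)).
  by apply: (is_derive_eq (is_derive1_comp _ (dg s))); rewrite mulrC.
have cF : continuous (fun s : R => expR (alpha + beta * s)).
  by move=> s; apply: differentiable_continuous; apply/derivable1_diffP.
have cf : continuous (fun s : R => beta * expR (alpha + beta * s)).
  by move=> s; apply: cvgM; [exact: cvg_cst | exact: cF].
rewrite /Rintegral (continuous_FTC2 (F := fun s => expR (alpha + beta * s)) rt)//.
- by apply: continuous_subspaceT.
- split.
  + by move=> x _.
  + exact/cvg_at_right_filter/cF.
  + exact/cvg_at_left_filter/cF.
- by move=> x _; rewrite derive1E derive_val.
Qed.

(** Kernel form of the resolvent identity [d K_0 K_d = K_0 - K_d]. For [0 <= r <= t] the integrand
    is, up to sign, the derivative in [s] of [expR (d r - d s)] on [[r, t]]; otherwise both sides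
    vanish. *)
Lemma kern_conv0d (d t r : R) : 0 <= d ->
  d * Rint leb (fun s => kern 0 t s * kern d s r) = kern 0 t r - kern d t r.
Proof.
move=> d0; have [r0t|nr] := boolP ((0 <= r) && (r <= t)); last first.
  rewrite /kern (negbTE nr) subrr.
  rewrite (_ : (fun s => _) = fun=> 0) ?Rint0 ?mulr0//.
  apply/funext => s; case: ifP => [/andP[_ st]|]; last by rewrite mul0r.
  case: ifP => [/andP[r0 rs]|]; last by rewrite mulr0.
  by rewrite r0 (le_trans rs st) in nr.
have [r0 rt] := andP r0t.
have := integral_expR (d * r) (- d) rt; rewrite Rintegral_mkcond.
rewrite (_ : (_ \_ _) = fun s => - d * (kern 0 t s * kern d s r)); last first.
  apply/funext => s; rewrite /patch /kern oppr0 mul0r expR0.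
  have [/set_mem/=|/negP ns] := boolP (s \in `[r, t]%classic).
    rewrite in_itv/= => /andP[rs st]; rewrite st r0 rs (le_trans r0 rs)/= mul1r.
    by congr (_ * expR _); ring.
  case: ifP => [/andP[s0 st]|]; last by rewrite mul0r mulr0.
  case: ifP => [/andP[_ rs]|]; last by rewrite !mulr0.
  by exfalso; apply: ns; rewrite inE/= in_itv/= rs.
have iF : itg leb (fun s => kern 0 t s * kern d s r).
  apply: itg_le (itg_itv 0 t).
    by apply: measurable_funM; apply: measurable_kern => //; exact: measurable_cst.
  move=> s; rewrite kern0E normrM ger0_norm ?indic_ge0//.
  by rewrite ler_piMr ?indic_ge0// ger0_norm ?kern_ge0// kern_le1.
rewrite -/(Rint _ _) RintZ// /kern r0t oppr0 mul0r expR0.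
have -> : d * r + - d * t = - d * (t - r) by ring.
have -> : d * r + - d * r = 0 by ring.
by rewrite expR0; lra.
Qed.

(** The opposite order of composition, with antiderivative [expR (- d t + d s)]. *)
Lemma kern_convd0 (d t r : R) : 0 <= d ->
  d * Rint leb (fun s => kern d t s * kern 0 s r) = kern 0 t r - kern d t r.
Proof.
move=> d0; have [r0t|nr] := boolP ((0 <= r) && (r <= t)); last first.
  rewrite /kern (negbTE nr) subrr.
  rewrite (_ : (fun s => _) = fun=> 0) ?Rint0 ?mulr0//.
  apply/funext => s; case: ifP => [/andP[_ st]|]; last by rewrite mul0r.
  case: ifP => [/andP[r0 rs]|]; last by rewrite mulr0.
  by rewrite r0 (le_trans rs st) in nr.
have [r0 rt] := andP r0t.
have := integral_expR (- d * t) d rt; rewrite Rintegral_mkcond.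
rewrite (_ : (_ \_ _) = fun s => d * (kern d t s * kern 0 s r)); last first.
  apply/funext => s; rewrite /patch /kern oppr0 mul0r expR0.
  have [/set_mem/=|/negP ns] := boolP (s \in `[r, t]%classic).
    rewrite in_itv/= => /andP[rs st]; rewrite st r0 rs (le_trans r0 rs)/= mulr1.
    by congr (_ * expR _); ring.
  case: ifP => [/andP[s0 st]|]; last by rewrite mul0r mulr0.
  case: ifP => [/andP[_ rs]|]; last by rewrite !mulr0.
  by exfalso; apply: ns; rewrite inE/= in_itv/= rs.
have iF : itg leb (fun s => kern d t s * kern 0 s r).
  apply: itg_le (itg_itv 0 t).
    by apply: measurable_funM; apply: measurable_kern => //; exact: measurable_cst.
  move=> s; rewrite -kern0E normrM !ger0_norm ?kern_ge0//.
  apply: (@le_trans _ _ (kern d t s)).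
    by rewrite ler_piMr ?kern_ge0// kern_le1.
  by rewrite /kern; case: ifP => // /andP[s0 st]; rewrite oppr0 mul0r ler_expR
    mulNr oppr_le0 mulr_ge0// subr_ge0.
rewrite -/(Rint _ _) RintZ// /kern r0t oppr0 mul0r expR0.
have -> : - d * t + d * t = 0 by ring.
have -> : - d * t + d * r = - d * (t - r) by ring.
by rewrite expR0.
Qed.

Lemma itg_kern_bounded (a t C : R) (y : R -> R) : 0 <= a ->
  measurable_fun setT (y : TR -> R) -> (forall s, `|y s| <= C) ->
  itg leb (fun s => kern a t s * y s).
Proof.
move=> a0 my yC; apply: itg_le (itgZ C (itg_itv 0 t)).
  apply: measurable_funM => //; apply: measurable_kern => //; exact: measurable_cst.
move=> s; rewrite normrM mulrC; apply: ler_pM => //.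
rewrite -kern0E ger0_norm ?kern_ge0//.
by rewrite /kern; case: ifP => // /andP[s0 st]; rewrite oppr0 mul0r ler_expR
    mulNr oppr_le0 mulr_ge0// subr_ge0.
Qed.

Lemma measurable_Kp_path (d : R) (y : R -> R) : measurable_fun setT (y : TR -> R) ->
  measurable_fun setT (Kp d y : TR -> R).
Proof.
move=> my; apply: (measurable_Kp d (T := TR) (t := fun z : TR => z)
  (b := fun z : R * TR => y z.1)) => //.
by apply: measurableT_comp => //; exact: measurable_fst.
Qed.

Lemma itg_kern_Kp (a b t : R) (y : R -> R) : 0 <= a -> 0 <= b -> itg leb y ->
  itg leb (fun s => kern a t s * Kp b y s).
Proof.
move=> a0 b0 iy; apply: (@itg_kern_bounded _ _ (Rint leb (fun s => `|y s|))) => //.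
  by apply: measurable_Kp_path; exact: (itg_meas iy).
by move=> s; exact: Kp_norm.
Qed.

Lemma Kp_comp (a b t : R) (y : R -> R) : 0 <= a -> 0 <= b -> itg leb y ->
  Kp a (Kp b y) t =
  Rint leb (fun r => Rint leb (fun s => kern a t s * kern b s r) * y r).
Proof.
move=> a0 b0 iy.
pose f (z : TR * TR) := kern a t z.1 * kern b z.1 z.2 * y z.2.
have mf : measurable_fun setT f.
  apply: measurable_funM.
    by apply: measurable_funM; apply: measurable_kern.
  by apply: measurableT_comp; [exact: (itg_meas iy) | exact: measurable_snd].
have fi s : itg leb (fun r => f (s, r)).
  apply: (eq_itg (f := fun r : TR => kern a t s * (kern b s r * y r))).
    by move=> r; rewrite /f/= mulrA.
  by apply: itgZ; exact: itg_kern.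
have ifm : itg (leb \x leb)%E f.
  apply: (itg_prod (g := fun s : TR => kern a t s * Rint leb (fun r => `|y r|))) => //.
    move=> s; rewrite -RintZ; last exact: itg_norm.
    apply: le_Rint; [exact: itg_norm | apply: itgZ; exact: itg_norm|].
    move=> r; rewrite /f/= -mulrA !normrM (ger0_norm (kern_ge0 a t s)).
    by rewrite ler_wpM2l ?kern_ge0// ler_piMl// ger0_norm ?kern_ge0// kern_le1.
  apply: (@itg_kern_bounded _ _ (Rint leb (fun s => `|y s|))) => //.
  by move=> s; rewrite ger0_norm// Rint_ge0.
have [_ [_ e1]] := itg_fubini1 ifm; have [_ [_ e2]] := itg_fubini2 ifm.
transitivity (Rint leb (fun s => Rint leb (fun r => f (s, r)))).
  apply: eq_Rint => s; rewrite -RintZ; last exact: itg_kern.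
  by apply: eq_Rint => r; rewrite /f/= mulrA.
rewrite -e1 e2; apply: eq_Rint => r.
rewrite mulrC -RintZ; first by apply: eq_Rint => s; rewrite /f/= mulrC.
apply: (@itg_kern_bounded _ _ 1) => //.
  by apply: measurable_kern => //; exact: measurable_cst.
by move=> s; rewrite ger0_norm ?kern_ge0// kern_le1.
Qed.

Lemma itg_conv (a b t : R) (y : R -> R) : 0 <= a -> 0 <= b -> itg leb y ->
  itg leb (fun r => Rint leb (fun s => kern a t s * kern b s r) * y r).
Proof.
move=> a0 b0 iy; have [t0|t0] := leP 0 t; last first.
  apply: (eq_itg (f := fun=> 0 : R)); last exact: itg0.
  move=> r; rewrite (_ : (fun s => _) = fun=> 0 : R) ?Rint0 ?mul0r//.
  apply/funext => s; rewrite {1}/kern; case: ifP => [/andP[s0 st]|]; last by rewrite mul0r.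
  by have := le_trans s0 st; rewrite leNgt t0.
apply: itg_le (itgZ t (itg_norm iy)).
  apply: measurable_funM; last exact: (itg_meas iy).
  apply: (measurable_Rint_param leb
    (f := fun z : TR * TR => kern a t z.2 * kern b z.2 z.1)).
  by apply: measurable_funM; apply: measurable_kern.
move=> r; rewrite normrM ler_wpM2r//.
have ik : itg leb (fun s => kern a t s * kern b s r).
  apply: (@itg_kern_bounded _ _ 1) => //.
    by apply: measurable_kern => //; exact: measurable_cst.
  by move=> s; rewrite ger0_norm ?kern_ge0// kern_le1.
rewrite ger0_norm; last by apply: Rint_ge0 => s; rewrite mulr_ge0 ?kern_ge0.
rewrite -[leRHS]subr0 -(Rint_itv t0); apply: le_Rint => //; first exact: itg_itv.
move=> s; apply: (@le_trans _ _ (kern a t s)).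
  by rewrite ler_piMr ?kern_ge0// kern_le1.
by rewrite -kern0E /kern; case: ifP => // /andP[s0 st]; rewrite oppr0 mul0r ler_expR
    mulNr oppr_le0 mulr_ge0// subr_ge0.
Qed.

Lemma resolvent0d (d t : R) (y : R -> R) : 0 <= d -> itg leb y ->
  d * Kp 0 (Kp d y) t = Kp 0 y t - Kp d y t.
Proof.
move=> d0 iy; rewrite Kp_comp// /Kp -RintB; [|exact: itg_kern..].
rewrite -RintZ; last exact: itg_conv.
by apply: eq_Rint => r; rewrite mulrA kern_conv0d// mulrBl.
Qed.

(** Composition in this order cancels the unknown in [linear_ode_unique]; the other order yields
    [Kp0_resolvent]. *)
Lemma resolventd0 (d t : R) (y : R -> R) : 0 <= d -> itg leb y ->
  d * Kp d (Kp 0 y) t = Kp 0 y t - Kp d y t.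
Proof.
move=> d0 iy; rewrite Kp_comp// /Kp -RintB; [|exact: itg_kern..].
rewrite -RintZ; last exact: itg_conv.
by apply: eq_Rint => r; rewrite mulrA kern_convd0// mulrBl.
Qed.

Lemma eq_Kp (d t : R) (y z : R -> R) : (forall s, 0 <= s <= t -> y s = z s) ->
  Kp d y t = Kp d z t.
Proof.
move=> yz; apply: eq_Rint => s; rewrite /kern; case: ifP => [/yz ->//|_].
by rewrite !mul0r.
Qed.

(* x = z - d K z solves x = z - d * int x, so that K z = int x. *)
Lemma Kp0_resolvent (d t : R) (z : R -> R) : 0 <= d -> itg leb z ->
  Kp 0 (fun s => z s - d * Kp d z s) t = Kp d z t.
Proof.
move=> d0 iz; have := resolvent0d t d0 iz.
have -> : Kp 0 (fun s => z s - d * Kp d z s) t = Kp 0 z t - d * Kp 0 (Kp d z) t.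
  rewrite /Kp -RintZ ?itg_kern_Kp// -RintB; last 2 first.
  - exact: itg_kern.
  - by apply: itgZ; exact: itg_kern_Kp.
  by apply: eq_Rint => s; rewrite mulrBr; congr (_ - _); rewrite mulrCA.
by move=> ->; rewrite opprB addrC subrK.
Qed.

(** Applying [Kp d] to the equation gives [K_d y = - d K_d K_0 y = K_d y - K_0 y]. Hence
    [K_0 y = 0], and the equation itself then gives [y = 0]. *)
Lemma linear_ode_unique (d T : R) (y : R -> R) : 0 <= d -> itg leb y ->
  (forall t, 0 <= t <= T -> y t = - d * Kp 0 y t) ->
  forall t, 0 <= t <= T -> y t = 0.
Proof.
move=> d0 iy yE t /andP[t0 tT].
have : Kp d y t = - (d * Kp d (Kp 0 y) t).
  rewrite (@eq_Kp _ _ _ (fun s => - d * Kp 0 y s)); last first.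
    by move=> s /andP[s0 st]; apply: yE; rewrite s0 (le_trans st tT).
  rewrite -mulNr /Kp -RintZ ?itg_kern_Kp//.
  by apply: eq_Rint => s; rewrite mulrCA.
rewrite resolventd0// opprB => /eqP; rewrite -subr_eq0 opprB addrC subrK => /eqP K0.
by rewrite yE ?t0// K0 mulr0.
Qed.

(** By [Kp0_resolvent], [Kp d y] is the primitive of [y - d * Kp d y], and primitives of integrable
    functions are continuous. *)
Lemma continuous_Kp (d T : R) (y : R -> R) : 0 <= d -> 0 <= T -> itg leb y ->
  {within `[0, T], continuous (Kp d y)}.
Proof.
move=> d0 T0 iy.
pose g s := y s - d * Kp d y s.
have mg : measurable_fun setT (g : TR -> R).
  apply: measurable_funB; first exact: (itg_meas iy).
  apply: measurable_funM; first exact: measurable_cst.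
  by apply: measurable_Kp_path; exact: (itg_meas iy).
have ig : leb.-integrable `[0, T] (EFin \o g).
  apply/integrable_mkcond => //.
  have : itg leb (fun s => \1_(`[0, T]%classic) s * y s -
      d * (kern 0 T s * Kp d y s)).
    apply: itgB; first by apply: itg_indic_mul.
    by apply: itgZ; exact: itg_kern_Kp.
  apply: eq_integrable => //= s _; rewrite kern0E /patch indicE /g.
  by case: ifP => _ /=; [congr EFin; ring | rewrite !mul0r mulr0 subrr].
have := parameterized_integral_continuous T0 ig.
apply: subspace_eq_continuous => t; rewrite inE/= in_itv/= => /andP[t0 tT].
change (parameterized_integral leb 0 t g = Kp d y t).
rewrite /parameterized_integral -Kp0E.
rewrite -(Kp0_resolvent t d0 iy); apply: eq_Kp => s /andP[s0 st].
by [].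
Qed.

(** Cauchy-Schwarz against a kernel whose square is at most the indicator of [[0, t]]. *)
Lemma sqr_Kp_le (d t T : R) (y : R -> R) : 0 <= d -> 0 <= t <= T ->
  L2 leb y -> Kp d y t ^+ 2 <= T * Rint leb (fun s => y s ^+ 2).
Proof.
move=> d0 /andP[t0 tT] Ly.
have mk : measurable_fun setT (kern d t : TR -> R).
  by apply: measurable_kern => //; exact: measurable_cst.
have kle s : kern d t s ^+ 2 <= \1_(`[0, t]%classic) s.
  rewrite indicE /kern; case: ifP => [/andP[s0 st]|_]; last by rewrite expr0n/= ler0n.
  rewrite mem_set/=; last by rewrite in_itv/= s0.
  rewrite expr_le1 ?expR_ge0// -[leRHS]expR0 ler_expR mulNr oppr_le0 mulr_ge0//.
  by rewrite subr_ge0.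
have ik : itg leb (fun s => kern d t s ^+ 2).
  apply: itg_le (itg_itv 0 t); first exact: measurable_funX.
  by move=> s; rewrite ger0_norm ?sqr_ge0.
have Lk : L2 leb (kern d t) by [].
apply: (le_trans (si_cauchy_schwarz (semi_inner_L2 leb) Lk Ly)).
rewrite !dot_sqr ler_wpM2r ?Rint_ge0// => [s|]; first exact: sqr_ge0.
rewrite (le_trans _ tT)// -[leRHS]subr0 -(Rint_itv t0).
by apply: le_Rint => //; exact: itg_itv.
Qed.

(** Identifies the adjoint of [Kp d] on a single path; the inner integral on the right is what [GP]
    is made of. *)
Lemma kernel_fubini (d : R) (p y : R -> R) : 0 <= d -> itg leb p -> itg leb y ->
  Rint leb (fun t => p t * Kp d y t) =
  Rint leb (fun s => y s * Rint leb (fun t => kern d t s * p t)).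
Proof.
move=> d0 ip iy.
pose f (z : TR * TR) := p z.1 * (kern d z.1 z.2 * y z.2).
have mp := itg_meas ip; have my := itg_meas iy.
have mf : measurable_fun setT f.
  apply: measurable_funM; first by apply: measurableT_comp.
  apply: measurable_funM; first exact: measurable_kern.
  by apply: measurableT_comp.
have fi t : itg leb (fun s => f (t, s)) by exact: (itgZ (p t) (itg_kern t d0 iy)).
have ifm : itg (leb \x leb)%E f.
  apply: (itg_prod (g := fun t : TR => `|p t| * Rint leb (fun s => `|y s|))) => //.
    move=> t; rewrite -RintZ; last exact: itg_norm.
    apply: le_Rint; [exact: itg_norm | apply: itgZ; exact: itg_norm|].
    move=> s; rewrite /f/= normrM ler_wpM2l// normrM ler_piMl//.
    by rewrite ger0_norm ?kern_ge0// kern_le1.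
  apply: (eq_itg (f := fun t : TR => Rint leb (fun s => `|y s|) * `|p t|)).
    by move=> t; rewrite mulrC.
  by apply: itgZ; exact: itg_norm.
have [_ [_ e1]] := itg_fubini1 ifm; have [_ [_ e2]] := itg_fubini2 ifm.
transitivity (Rint leb (fun t => Rint leb (fun s => f (t, s)))).
  by apply: eq_Rint => t; rewrite -RintZ// ; exact: itg_kern.
rewrite -e1 e2; apply: eq_Rint => s.
rewrite -RintZ; first by apply: eq_Rint => t; rewrite /f/=; ring.
apply: itg_le (itg_norm ip).
  apply: measurable_funM => //; apply: measurable_kern => //; exact: measurable_cst.
move=> t; rewrite normrM ler_piMl// ger0_norm ?kern_ge0// kern_le1//.
Qed.

End volterra.

(** * Brownian motion *)

Section gaussian.
Context d (Omega : measurableType d) (R : realType) (P : probability Omega R).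
Local Notation leb := (@lebesgue_measure R).
Local Notation TR := (measurableTypeR R).

(** With [u = 3 x^2 / (8 s^2)], the difference of the exponents [x^2 / (2 s^2)] and [x^2 / (8 s^2)],
    the bound amounts to [u * expR (- u) <= 1]. Finiteness of second moments thus reduces to
    integrability of the density with standard deviation [2 * s]. *)
Lemma normal_sqr_bound (s x : R) : 0 < s ->
  x ^+ 2 * normal_pdf 0 s x <=
  (8 * s ^+ 2 / 3 * (normal_peak s / normal_peak (2 * s))) * normal_pdf 0 (2 * s) x.
Proof.
move=> s0; have sn0 : s != 0 by rewrite gt_eqF.
have s20 : 2 * s != 0 by rewrite mulf_neq0.
rewrite !normal_pdfE//; set p1 := normal_peak s; set p2 := normal_peak (2 * s).
have p10 : 0 < p1 by exact: normal_peak_gt0.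
have p20 : 0 < p2 by exact: normal_peak_gt0.
pose u := 3 * x ^+ 2 / (8 * s ^+ 2).
have uE : x ^+ 2 = 8 * s ^+ 2 / 3 * u by rewrite /u; field.
have u1 : u * expR (- u) <= 1.
  rewrite expRN ler_pdivrMr ?expR_gt0// mul1r.
  by have := expR_ge1Dx u; lra.
have fE : normal_fun 0 s x = expR (- u) * normal_fun 0 (2 * s) x.
  rewrite /normal_fun -expRD; congr expR; rewrite /u subr0; field.
  by rewrite sn0.
rewrite fE.
have -> : x ^+ 2 * (p1 * (expR (- u) * normal_fun 0 (2 * s) x)) =
    (8 * s ^+ 2 / 3 * p1 * normal_fun 0 (2 * s) x) * (u * expR (- u)).
  by rewrite {1}uE; ring.
have -> : 8 * s ^+ 2 / 3 * (p1 / p2) * (p2 * normal_fun 0 (2 * s) x) =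
    8 * s ^+ 2 / 3 * p1 * normal_fun 0 (2 * s) x.
  by field; rewrite gt_eqF.
apply: ler_piMr => //; rewrite mulr_ge0 ?normal_fun_ge0// mulr_ge0 ?(ltW p10)//.
by rewrite divr_ge0// mulr_ge0// sqr_ge0.
Qed.

(** Both functions integrate to [normal_prob 0 s] over every measurable set; integrals against the
    law can then be bounded through the explicit density. *)
Lemma normal_RN (s : R) :
  {ae leb, forall x, Radon_Nikodym_SigmaFinite.f (normal_prob 0 s) leb x =
    (normal_pdf 0 s x)%:E}.
Proof.
have nd : normal_prob 0 s `<< leb := normal_prob_dominates 0 s.
have mpdf : measurable_fun setT (fun x : TR => (normal_pdf 0 s x)%:E).
  by apply/measurable_EFinP; exact: measurable_normal_pdf.
have : ae_eq leb setT (Radon_Nikodym_SigmaFinite.f (normal_prob 0 s) leb)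
    (fun x : TR => (normal_pdf 0 s x)%:E).
  apply: integral_ae_eq => //.
    exact: (Radon_Nikodym_SigmaFinite.f_integrable nd).
  by move=> E _ mE; rewrite -Radon_Nikodym_SigmaFinite.f_integral.
by apply: filterS => x /(_ I).
Qed.

Lemma gaussian_integral (X : Omega -> R) (s : R) (f : TR -> \bar R) :
  measurable_fun setT X ->
  (forall B : set R, measurable B -> P (X @^-1` B) = normal_prob 0 s B) ->
  measurable_fun setT f -> (forall x, (0 <= f x)%E) ->
  (\int[P]_w f (X w) = \int[normal_prob 0 s]_x f x)%E.
Proof.
move=> mX0 PX mf f0.
have mX : measurable_fun setT (X : Omega -> TR).
  by move=> _ B mB; exact: mX0.
have := @ge0_integral_pushforward _ _ Omega TR R X mX P setT f measurableT mf.
rewrite preimage_setT => <-; last by move=> x _; exact: f0.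
by apply: eq_measure_integral => A mA _; exact: PX.
Qed.

Lemma gaussian_L2 (X : Omega -> R) (s : R) : measurable_fun setT X -> 0 < s ->
  (forall B : set R, measurable B -> P (X @^-1` B) = normal_prob 0 s B) ->
  L2 P X.
Proof.
move=> mX s0 PX; split=> //.
have nd : normal_prob 0 s `<< leb := normal_prob_dominates 0 s.
apply/integrableP; split.
  by apply/measurable_EFinP; exact: measurable_funX.
have mx2 : measurable_fun setT (fun x : TR => (x ^+ 2)%:E).
  by apply/measurable_EFinP; exact: measurable_funX.
have x20 (x : TR) : (0 <= (x ^+ 2)%:E :> \bar R)%E by rewrite lee_fin sqr_ge0.
rewrite (_ : (\int[P]_x _)%E = (\int[normal_prob 0 s]_x (x ^+ 2)%:E)%E); last first.
  rewrite -(gaussian_integral mX PX)//.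
  by apply: eq_integral => w _ /=; rewrite ger0_norm// sqr_ge0.
rewrite -(Radon_Nikodym_SigmaFinite.change_of_variables nd)//.
pose K := 8 * s ^+ 2 / 3 * (normal_peak s / normal_peak (2 * s)).
apply: (@le_lt_trans _ _ (\int[leb]_x (K * normal_pdf 0 (2 * s) x)%:E)%E).
  apply: ae_ge0_le_integral => //.
  - by move=> x _; rewrite mule_ge0// Radon_Nikodym_SigmaFinite.f_ge0.
  - apply: emeasurable_funM => //.
    exact: measurable_int (Radon_Nikodym_SigmaFinite.f_integrable nd).
  - move=> x _; rewrite lee_fin mulr_ge0 ?normal_pdf_ge0//.
    rewrite /K mulr_ge0//; first by rewrite divr_ge0// mulr_ge0// sqr_ge0.
    by rewrite divr_ge0// normal_peak_ge0.
  - apply/measurable_EFinP; apply: measurable_funM; first exact: measurable_cst.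
    exact: measurable_normal_pdf.
  - apply: filterS (normal_RN s) => x -> _.
    by rewrite -EFinM lee_fin normal_sqr_bound.
have iK : itg leb (fun x => K * normal_pdf 0 (2 * s) x).
  by apply: itgZ; exact: integrable_normal_pdf.
by rewrite -RintE// ltry.
Qed.

Lemma normal_probN (s : R) (B : set R) : s != 0 -> measurable B ->
  normal_prob 0 s (-%R @^-1` B) = normal_prob 0 s B.
Proof.
move=> s0 mB; rewrite /normal_prob.
have mpdf : measurable_fun setT (fun x : TR => (normal_pdf 0 s x)%:E).
  by apply/measurable_EFinP; exact: measurable_normal_pdf.
have mN : measurable_fun setT (-%R : TR -> TR) by exact: oppr_measurable.
have := @ge0_integral_pushforward _ _ TR TR R _ mN leb B
  (fun x => (normal_pdf 0 s x)%:E) mB (measurable_funTS mpdf).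
rewrite (eq_measure_integral leb); last by move=> A mA _; exact: lebesgue_measureN.
move=> ->; last by move=> x _; rewrite lee_fin normal_pdf_ge0.
apply: eq_integral => x _ /=; congr EFin; rewrite normal_pdfE//.
by rewrite /normal_fun !subr0 sqrrN.
Qed.

(** By symmetry of the law the positive and negative parts of [X] have the same finite mean. *)
Lemma gaussian_mean0 (X : Omega -> R) (s : R) : measurable_fun setT X -> 0 < s ->
  (forall B : set R, measurable B -> P (X @^-1` B) = normal_prob 0 s B) ->
  Rint P X = 0.
Proof.
move=> mX s0 PX.
have [_ iX2] := gaussian_L2 mX s0 PX.
have iX : itg P X.
  apply: itg_le (itgD (g := fun=> 1) iX2 _) => //; last first.
    exact: finite_measure_integrable_cst.
  move=> w; rewrite ler_norml; apply/andP; split;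
    by have := sqr_ge0 (X w - 1); have := sqr_ge0 (X w + 1); nra.
have m1 : measurable_fun setT (fun x : TR => (Num.max x 0)%:E).
  by apply/measurable_EFinP; apply: measurable_maxr => //; exact: measurable_cst.
have m2 : measurable_fun setT (fun x : TR => (Num.max (- x) 0)%:E).
  apply/measurable_EFinP; apply: measurable_maxr; last exact: measurable_cst.
  exact: oppr_measurable.
have p1 (x : R) : (0 <= (Num.max x 0)%:E)%E by rewrite lee_fin le_max lexx orbT.
have e1 := gaussian_integral mX PX m1 (fun x => p1 x).
have e2 := gaussian_integral mX PX m2 (fun x => p1 (- x)).
have i1 : itg P (fun w => Num.max (X w) 0).
  apply: itg_le (itg_norm iX); first by apply: measurable_maxr => //; exact: measurable_cst.
  by move=> w; rewrite ger0_norm ?le_max ?lexx ?orbT// ge_max normr_ge0 ler_norm.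
have i2 : itg P (fun w => Num.max (- X w) 0).
  apply: itg_le (itg_norm iX).
    by apply: measurable_maxr; [exact: measurableT_comp|exact: measurable_cst].
  by move=> w; rewrite ger0_norm ?le_max ?lexx ?orbT// ge_max normr_ge0 -normrN ler_norm.
have -> : Rint P X = Rint P (fun w => Num.max (X w) 0) - Rint P (fun w => Num.max (- X w) 0).
  rewrite -RintB//; apply: eq_Rint => w; have [x0|x0] := leP 0 (X w).
    by have /max_idPr -> : - X w <= 0; rewrite ?oppr_le0// subr0.
  by have /max_idPl -> : 0 <= - X w; rewrite ?oppr_ge0 ?ltW// sub0r opprK.
apply/eqP; rewrite subr_eq0; apply/eqP/EFin_inj; rewrite !RintE// e1 e2.
have mN : measurable_fun setT (-%R : TR -> TR) by exact: oppr_measurable.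
have := @ge0_integral_pushforward _ _ TR TR R _ mN (normal_prob 0 s) setT
  (fun x => (Num.max x 0)%:E) measurableT m1.
rewrite (eq_measure_integral (normal_prob 0 s)); last first.
  by move=> A mA _; by apply: normal_probN; rewrite ?gt_eqF.
by rewrite preimage_setT => -> // x _; exact: p1.
Qed.

End gaussian.

(** * Generated sigma-algebras and independence *)

Section sub_sigma_algebras.
Context d (Omega : measurableType d) (R : realType).
Implicit Types G H : set (set Omega).

Lemma g_sigma_sub G H : G `<=` <<s H >> -> <<s G >> `<=` <<s H >>.
Proof. by move=> GH; apply: smallest_sub => //; exact: smallest_sigma_algebra. Qed.

Lemma g_sigma_measurable G : G `<=` measurable -> <<s G >> `<=` measurable.
Proof. by move=> Gm; apply: smallest_sub => //; exact: sigma_algebra_measurable. Qed.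

Lemma meas_gP G (f : Omega -> R) :
  (measurable_fun setT (f : g_sigma_algebraType G -> R)) <->
  (forall B, measurable B -> <<s G >> (f @^-1` B)).
Proof.
split=> [mf B mB|mf _ B mB]; last by rewrite setTI; exact: mf.
by have := mf measurableT B mB; rewrite setTI.
Qed.

Lemma meas_g_mono G H (f : Omega -> R) : <<s G >> `<=` <<s H >> ->
  measurable_fun setT (f : g_sigma_algebraType G -> R) ->
  measurable_fun setT (f : g_sigma_algebraType H -> R).
Proof. by move=> GH /meas_gP mf; apply/meas_gP => B /mf; exact: GH. Qed.

Lemma meas_g_sub G (f : Omega -> R) : <<s G >> `<=` measurable ->
  measurable_fun setT (f : g_sigma_algebraType G -> R) -> measurable_fun setT f.
Proof. by move=> GH /meas_gP mf _ B mB; rewrite setTI; apply: GH; exact: mf. Qed.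

Lemma generatorsP (f : Omega -> R) A :
  generators f A <-> exists2 B, measurable B & A = f @^-1` B.
Proof.
split=> [[B mB <-]|[B mB ->]]; first by exists B; rewrite ?setTI.
by exists B => //; rewrite setTI.
Qed.

Lemma generators_measurable (f : Omega -> R) : measurable_fun setT f ->
  generators f `<=` measurable.
Proof. by move=> mf A [B mB <-]; exact: mf. Qed.

Lemma historyP (X : R -> Omega -> R) t A :
  history X t A <-> exists s B, [/\ 0 <= s <= t, measurable B & A = X s @^-1` B].
Proof.
split=> [[s /=]|[s [B [st mB ->]]]].
  by rewrite in_itv/= => st /generatorsP[B mB ->]; exists s, B.
by exists s; rewrite /= ?in_itv//; apply/generatorsP; exists B.
Qed.

Lemma history_measurable (X : R -> Omega -> R) t :
  (forall s, measurable_fun setT (X s)) -> history X t `<=` measurable.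
Proof. by move=> mX A [s _]; apply: generators_measurable. Qed.

Lemma meas_generators (f : Omega -> R) :
  measurable_fun setT (f : g_sigma_algebraType (generators f) -> R).
Proof.
by apply/meas_gP => B mB; apply: sub_sigma_algebra; apply/generatorsP; exists B.
Qed.

Lemma meas_history (X : R -> Omega -> R) s t : 0 <= s <= t ->
  measurable_fun setT (X s : g_sigma_algebraType (history X t) -> R).
Proof.
by move=> st; apply/meas_gP => B mB; apply: sub_sigma_algebra; apply/historyP; exists s, B.
Qed.

End sub_sigma_algebras.

Section independence.
Context d (Omega : measurableType d) (R : realType) (P : probability Omega R).

Lemma itg_cst (c : R) : itg P (fun=> c).
Proof. exact: finite_measure_integrable_cst. Qed.

Lemma Rint_cst (c : R) : Rint P (fun=> c) = c.
Proof.
by have := expectation_cst P c; rewrite unlock /Rint /Rintegral => ->.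
Qed.

Lemma L2_cst (c : R) : L2 P (fun=> c).
Proof. by split; [exact: measurable_cst | exact: itg_cst]. Qed.

Lemma L2_itg (f : Omega -> R) : L2 P f -> itg P f.
Proof.
move=> Lf; apply: (eq_itg (f := fun w => f w * 1)); first by move=> w; rewrite mulr1.
by apply: itg_dot => //; exact: L2_cst.
Qed.

Lemma Rint_indic A : measurable A -> Rint P (\1_A : Omega -> R) = fine (P A).
Proof. by move=> mA; rewrite /Rint /Rintegral integral_indic// setIT. Qed.

Lemma itg_indic A : measurable A -> itg P (\1_A : Omega -> R).
Proof.
move=> mA; apply: (eq_itg (f := fun w => \1_A w * (1 : R))).
  by move=> w; rewrite mulr1.
by apply: itg_indic_mul => //; exact: itg_cst.
Qed.

(** [Rint_vanish] is used twice: the centred indicator of [a] is orthogonal to [Y], so the centred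
    [Y] integrates to 0 over every such [a], and is therefore orthogonal to [X]. *)
Lemma indep_Rint (A B : set (set Omega)) (X Y : Omega -> R) :
  <<s A >> `<=` measurable -> <<s B >> `<=` measurable ->
  independent P <<s A >> <<s B >> ->
  measurable_fun setT (X : g_sigma_algebraType A -> R) ->
  measurable_fun setT (Y : g_sigma_algebraType B -> R) ->
  L2 P X -> L2 P Y -> Rint P (fun w => X w * Y w) = Rint P X * Rint P Y.
Proof.
move=> Am Bm AB mX mY LX LY.
have iX := L2_itg LX. have iY := L2_itg LY.
have finP (C : set Omega) : measurable C -> P C \is a fin_num.
  by move=> mC; exact: fin_num_measure.
have h a : <<s A >> a -> Rint P (fun w => \1_a w * (Y w - Rint P Y)) = 0.
  move=> sa; have ma := Am _ sa.
  have i1 : itg P (fun w => \1_a w - fine (P a)).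
    by apply: itgB; [exact: itg_indic | exact: itg_cst].
  have := @Rint_vanish _ _ _ P B (fun w => \1_a w - fine (P a)) Y Bm i1.
  move=> /(_ _ mY _) e.
  have i2 : itg P (fun w => \1_a w * Y w) by exact: itg_indic_mul.
  have i3 : itg P (fun w => Y w * (\1_a w - fine (P a))).
    apply: (eq_itg (f := fun w => \1_a w * Y w - fine (P a) * Y w)).
      by move=> w; ring.
    by apply: itgB => //; exact: itgZ.
  have {e} : Rint P (fun w => Y w * (\1_a w - fine (P a))) = 0.
    apply: e => // b sb; have mb := Bm _ sb.
    rewrite (_ : (fun w => _) = fun w => \1_(a `&` b) w - fine (P a) * \1_b w).
      rewrite RintB; [|by apply: itg_indic; exact: measurableI
        |by apply: itgZ; exact: itg_indic].
      rewrite RintZ ?itg_indic// !Rint_indic//; last exact: measurableI.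
      by rewrite AB// fineM ?finP// subrr.
    by apply/funext => w; rewrite indicI/=; ring.
  rewrite (_ : (fun w => Y w * _) = fun w => \1_a w * Y w - fine (P a) * Y w).
    rewrite RintB ?itgZ// RintZ// => e.
    rewrite (_ : (fun w => \1_a w * _) = fun w => \1_a w * Y w - Rint P Y * \1_a w).
      by rewrite RintB ?itgZ ?itg_indic// RintZ ?itg_indic// Rint_indic// mulrC.
    by apply/funext => w; ring.
  by apply/funext => w; ring.
have LYc : L2 P (fun w => Y w - Rint P Y) by apply: L2B => //; exact: L2_cst.
have := Rint_vanish Am (L2_itg LYc) h mX (itg_dot LX LYc).
rewrite (_ : (fun w => _) = fun w => X w * Y w - Rint P Y * X w); last first.
  by apply/funext => w; ring.
rewrite RintB; [|exact: itg_dot|exact: itgZ].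
rewrite RintZ// => /eqP; rewrite subr_eq0 => /eqP ->.
by rewrite mulrC.
Qed.

End independence.

(** * Doob's maximal inequality in L2 *)

Section doob.
Context d (Omega : measurableType d) (R : realType) (P : probability Omega R).
Variable S : nat -> Omega -> R.

(** The start value 0 stands for [S 0], which vanishes in the inequalities below, and keeps the
    maximum nonnegative. *)
Fixpoint running_max (n : nat) (w : Omega) : R :=
  if n is n'.+1 then Num.max (running_max n' w) (S n w) else 0.

Lemma running_max_ge0 n w : 0 <= running_max n w.
Proof. by elim: n => //= n IH; rewrite le_max IH. Qed.

Lemma le_running_max n k w : (k < n)%N -> S k.+1 w <= running_max n w.
Proof.
elim: n => // n IH; rewrite ltnS leq_eqVlt => /predU1P[->|kn] /=.
  by rewrite le_max lexx orbT.
by rewrite le_max IH.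
Qed.

(* A pathwise Doob inequality: for a martingale S the sum on the left has mean 0. *)
Lemma running_max_step n w : S 0%N w = 0 ->
  \sum_(i < n) running_max i w * (S i.+1 w - S i w) <=
  running_max n w * S n w - running_max n w ^+ 2 / 2.
Proof.
move=> S0; elim: n => [|n IH]; first by rewrite big_ord0/= mul0r expr0n/= mul0r subr0.
rewrite big_ord_recr/=; set m := running_max n w in IH *.
apply: (le_trans (lerD IH (lexx _))).
have [mS|mS] := leP m (S n.+1 w); last by lra.
by have := sqr_ge0 (S n.+1 w - m); nra.
Qed.

Lemma L2_max (f g : Omega -> R) : L2 P f -> L2 P g ->
  L2 P (fun w => Num.max (f w) (g w)).
Proof.
move=> [mf f2] [mg g2]; split; first exact: measurable_maxr.
apply: itg_le (itgD f2 g2).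
  by apply: measurable_funX; exact: measurable_maxr.
move=> w; rewrite ger0_norm ?sqr_ge0//.
by have := sqr_ge0 (f w); have := sqr_ge0 (g w); have [_|_] := leP (f w) (g w); lra.
Qed.

Lemma L2_running_max n : (forall i, L2 P (S i)) -> L2 P (running_max n).
Proof. by move=> LS; elim: n => [|n IH]; [exact: L2_0 | exact: L2_max]. Qed.

(** The martingale property enters as orthogonality of each step to the current maximum. The factor
    4 comes from the completed square [M S - M^2 / 2 <= S^2 - M^2 / 4]. *)
Lemma doob n : (forall w, S 0%N w = 0) -> (forall i, L2 P (S i)) ->
  (forall i, (i < n)%N ->
     Rint P (fun w => running_max i w * (S i.+1 w - S i w)) = 0) ->
  Rint P (fun w => running_max n w ^+ 2) <= 4 * Rint P (fun w => S n w ^+ 2).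
Proof.
move=> S0 LS orth; have LM i := L2_running_max i LS.
have ii i : itg P (fun w => running_max i w * (S i.+1 w - S i w)).
  by apply: itg_dot => //; exact: L2B.
have [iS eS] := Rint_sum (F := fun (i : 'I_n) w =>
  running_max i w * (S i.+1 w - S i w)) (fun i => ii i).
have E0 : Rint P (fun w => \sum_(i < n) running_max i w * (S i.+1 w - S i w)) = 0.
  by rewrite eS big1// => i _; exact: orth.
pose u w := running_max n w ^+ 2 / 4.
have iM2 := (LM n).2. have iSn2 := (LS n).2.
have : Rint P (fun w => \sum_(i < n) running_max i w * (S i.+1 w - S i w)) <=
    Rint P (fun w => S n w ^+ 2 - 4^-1 * running_max n w ^+ 2).
  apply: le_Rint => //; first by apply: itgB => //; exact: itgZ.
  move=> w; apply: (le_trans (running_max_step n (S0 w))).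
  by have := sqr_ge0 (S n w - running_max n w / 2); lra.
by rewrite E0 RintB ?itgZ// RintZ//; lra.
Qed.

End doob.

(** * Time grids and sampled processes *)

Section grid.
Context (R : realType).
Local Notation TR := (measurableTypeR R).

(** Times are rounded down: a path sampled at [grid T n t] uses only what is known at [t], so
    sampling preserves adaptedness. *)
Definition grid (T : R) (n : nat) (t : R) : R :=
  T * (Num.trunc (n.+1%:R * t / T))%:R / n.+1%:R.

Lemma grid_itv (T : R) n t : 0 < T -> 0 <= t -> 0 <= grid T n t <= t.
Proof.
move=> T0 t0; have n0 : 0 < n.+1%:R :> R by [].
have h0 : 0 <= n.+1%:R * t / T by apply: divr_ge0 (ltW T0); apply: mulr_ge0 (ltW n0) _.
rewrite /grid; apply/andP; split.
  by apply: divr_ge0 (ltW n0); apply: mulr_ge0 (ltW T0) _.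
rewrite ler_pdivrMr//.
have /andP[h _] := truncn_itv h0.
by move: h; rewrite ler_pdivlMr//; lra.
Qed.

Lemma grid_cvg (T : R) t : 0 < T -> 0 <= t -> (fun n => grid T n t) @ \oo --> t.
Proof.
move=> T0 t0; apply/cvgrPdist_le => e e0.
have eT : 0 < T^-1 * e by rewrite mulr_gt0// invr_gt0.
near=> n; have n0 : 0 < n.+1%:R :> R by [].
have h0 : 0 <= n.+1%:R * t / T by apply: divr_ge0 (ltW T0); apply: mulr_ge0 (ltW n0) _.
have /andP[g0 gt] := grid_itv n T0 t0.
rewrite ger0_norm ?subr_ge0//.
have /andP[_ h] := truncn_itv h0.
have : t < T * (Num.trunc (n.+1%:R * t / T)).+1%:R / n.+1%:R.
  by rewrite ltr_pdivlMr//; move: h; rewrite ltr_pdivrMr//; lra.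
rewrite -natr1 mulrDr mulr1 mulrDl -/(grid T n t) => {}h.
have : T / n.+1%:R <= e.
  rewrite -ler_pdivlMl//; apply: ltW.
  by near: n; exact: (near_infty_natSinv_lt (PosNum eT)).
by move=> he; rewrite lerBlDl (le_trans (ltW h))// lerD2l.
Unshelve. all: by end_near. Qed.

Lemma within_cvg_seq (T t : R) (f : R -> R) (u : nat -> R) :
  {within `[0, T], continuous f} -> 0 <= t <= T ->
  (forall n, 0 <= u n <= T) -> u @ \oo --> t -> (fun n => f (u n)) @ \oo --> f t.
Proof.
move=> cf tT uT ut; have tA : `[0, T]%classic t by rewrite /= in_itv.
move=> B nB; have := cf t B nB; rewrite /nbhs/= -nbhs_subspace_in// => {}nB.
change (\forall n \near \oo, B (f (u n))).
have un : \forall n \near \oo, `[0, T]%classic (u n) -> B (f (u n)) := ut _ nB.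
by apply: filterS un => n; apply; rewrite /= in_itv; exact: uT.
Qed.

(** On each of countably many time cells the sampled process is one fixed random variable, so
    preimages are countable unions of rectangles. *)
Lemma measurable_grid_comp d (Omega : measurableType d) (T t0 : R) n
    (b : R -> Omega -> R) : 0 < T ->
  (forall s, 0 <= s <= t0 -> measurable_fun setT (b s)) ->
  measurable_fun setT (fun z : TR * Omega =>
    \1_(`[0, t0]%classic) z.1 * b (grid T n z.1) z.2).
Proof.
move=> T0 mb; have n0 : 0 < n.+1%:R :> R by [].
pose c (j : nat) : R := T * j%:R / n.+1%:R.
pose D (j : nat) : set R := [set t | 0 <= t <= t0 /\ Num.trunc (n.+1%:R * t / T) = j].
have DE j : D j = `[0, t0]%classic `&` `[T * j%:R / n.+1%:R, T * j.+1%:R / n.+1%:R[%classic.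
  apply/seteqP; split => t /=.
    move=> [/andP[t1 t2] tj]; rewrite !in_itv/= t1 t2; split=> //.
    have h0 : 0 <= n.+1%:R * t / T by apply: divr_ge0 (ltW T0); apply: mulr_ge0 (ltW n0) _.
    have /andP[h1 h2] := truncn_itv h0; rewrite tj in h1 h2.
    rewrite ler_pdivrMr// ltr_pdivlMr//.
    move: h1 h2; rewrite ler_pdivlMr// ltr_pdivrMr//.
    by rewrite ![_ * T]mulrC ![_ * t]mulrC => -> ->.
  rewrite !in_itv/= => -[tt]; rewrite ler_pdivrMr// ltr_pdivlMr// => /andP[h1 h2].
  split=> //; apply: truncn_def; rewrite ler_pdivlMr// ltr_pdivrMr//.
  by rewrite ![_ * T]mulrC ![_ * t]mulrC h1 h2.
have mD j : measurable (D j : set TR) by rewrite DE; apply: measurableI.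
(* Where the indicator vanishes the value is 0, so the preimage of a set missing 0 lies over
   [[0, t0]]; sets containing 0 follow by complement. *)
have main : forall B : set R, measurable B -> ~ B 0 -> measurable
   ((fun z : TR * Omega => \1_(`[0, t0]%classic) z.1 * b (grid T n z.1) z.2) @^-1` B).
  move=> B mB nB0.
  rewrite (_ : _ @^-1` _ = \bigcup_j (D j `*` (if pselect (0 <= c j <= t0)
      is left _ then b (c j) @^-1` B else set0))).
    apply: bigcupT_measurable => j; apply: measurableX => //.
    case: pselect => // cj; rewrite -[X in measurable X]setTI.
    exact: mb.
  apply/seteqP; split => [[t w]/= |[t w]/= [j _ [[tt tj]]]].
    rewrite indicE; have [tt|tt] := boolP (t \in _); last by rewrite mul0r.
    rewrite mul1r => Bw; have {}tt := set_mem tt; rewrite /= in_itv/= in tt.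
    have /andP[t1 t2] := tt.
    exists (Num.trunc (n.+1%:R * t / T)) => //; split=> //=.
    case: pselect => // nc; exfalso; apply: nc.
    have /andP[g1 g2] := grid_itv n T0 t1.
    by rewrite -/(grid T n t) g1 (le_trans g2).
  case: pselect => // cj; rewrite indicE mem_set/=; last by rewrite in_itv.
  by rewrite mul1r /grid tj.
move=> _ B mB; rewrite setTI; have [B0|nB0] := pselect (B 0); last exact: main.
rewrite -[X in measurable X]setCK; apply: measurableC.
exact: (main (~` B) (measurableC mB) (fun h => h B0)).
Qed.

End grid.

Section limn_einf.
Context (R : realType).
Local Open Scope ereal_scope.

Lemma limn_einf_ge (u : nat -> \bar R) x :
  (\forall n \near \oo, x <= u n) -> x <= limn_einf u.
Proof.
move=> [N _ xu]; rewrite limn_einf_lim; apply: lime_ge; first exact: is_cvg_einfs.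
near=> n; apply: le_ereal_inf_tmp => _ [k /= nk <-]; apply: xu => /=.
by apply: leq_trans nk; near: n; exists N.
Unshelve. all: by end_near. Qed.

Lemma limn_einf_le (u : nat -> \bar R) x : (forall n, u n <= x) -> limn_einf u <= x.
Proof.
move=> ux; rewrite limn_einf_lim; apply: lime_le; first exact: is_cvg_einfs.
near=> n; apply: le_trans (ux n); apply: ereal_inf_lbound; exists n => //=.
Unshelve. all: by end_near. Qed.

Lemma limn_einf_mono (u v : nat -> \bar R) : (forall n, u n <= v n) ->
  limn_einf u <= limn_einf v.
Proof.
move=> uv; rewrite !limn_einf_lim; apply: lee_lim; [exact: is_cvg_einfs..|].
near=> n; apply: le_ereal_inf_tmp => _ [k /= nk <-].
by apply: le_trans (uv k); apply: ereal_inf_lbound; exists k.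
Unshelve. all: by end_near. Qed.

End limn_einf.

Section brownian_sup.
Context d (Omega : measurableType d) (R : realType) (P : probability Omega R).
Variables (T : R) (W : R -> {RV P >-> R}).
Hypotheses (T0 : 0 < T) (BW : brownian_motion T W).

Let mW s : measurable_fun setT (W s). Proof. exact: measurable_funPT. Qed.

Lemma brownian_increment s t : 0 <= s -> s < t -> t <= T ->
  [/\ L2 P (fun w => W t w - W s w), Rint P (fun w => W t w - W s w) = 0 &
   independent P <<s history W s >> <<s generators (W t \- W s) >>].
Proof.
move=> s0 st tT; have [_ _ /(_ _ _ s0 st tT) [g ind]] := BW.
have r0 : 0 < Num.sqrt (t - s) by rewrite sqrtr_gt0 subr_gt0.
have mi : measurable_fun setT (W t \- W s) by exact: measurable_funB.
split=> //; first exact: (gaussian_L2 mi r0 g).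
exact: (gaussian_mean0 mi r0 g).
Qed.

Lemma brownian0 : {ae P, forall w, W 0 w = 0}. Proof. by case: BW. Qed.

Lemma brownian_L2_0 t : 0 <= t <= T -> L2 P (fun w => W t w - W 0 w).
Proof.
move=> /andP[t0 tT]; move: t0; rewrite le_eqVlt => /predU1P[<-|t0].
  by apply: (L2_ae (@L2_0 _ _ _ P)); [exact: measurable_funB
    | apply: aeW => w; rewrite subrr].
by have [] := brownian_increment (lexx 0) t0 tT.
Qed.

Lemma brownian_L2 t : 0 <= t <= T -> L2 P (W t).
Proof.
move=> tT; apply: L2_ae (brownian_L2_0 tT) _ _ => //.
by apply: filterS brownian0 => w ->; rewrite subr0.
Qed.

Lemma brownian_mean t : 0 <= t <= T -> Rint P (W t) = 0.
Proof.
move=> tT; rewrite (@Rint_ae _ _ _ P _ (fun w => W t w - W 0 w))//; last first.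
- by apply: filterS brownian0 => w ->; rewrite subr0.
- exact: measurable_funB.
have /andP[t0 t1] := tT; move: t0; rewrite le_eqVlt => /predU1P[<-|t0].
  by rewrite -[RHS](Rint0 P); apply: eq_Rint => w; rewrite subrr.
by have [] := brownian_increment (lexx 0) t0 t1.
Qed.

(** The index is capped at [n.+1] so that all times stay in [[0, T]]: [doob] asks for square
    integrability along the whole sequence. *)
Let tt n (i : nat) : R := T * (minn i n.+1)%:R / n.+1%:R.

Let tt_itv n i : 0 <= tt n i <= T.
Proof.
have n0 : 0 < n.+1%:R :> R by [].
rewrite /tt; apply/andP; split.
  by apply: divr_ge0 (ltW n0); apply: mulr_ge0 (ltW T0) _.
by rewrite ler_pdivrMr// ler_pM2l// ler_nat geq_minr.
Qed.

(** The sign [c] turns the one-sided maximum into bounds for both [W] and [- W]. Subtracting [W 0]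
    makes the sequence start at 0 everywhere, since [W 0 = 0] is known only almost surely. *)
Let S (c : R) n i w : R := c * (W (tt n i) w - W 0 w).

Let LS c n i : L2 P (S c n i).
Proof. by apply: L2Z; apply: brownian_L2_0; exact: tt_itv. Qed.

Let S0 c n w : S c n 0%N w = 0.
Proof. by rewrite /S /tt min0n mulr0 mul0r subrr mulr0. Qed.

Let meas_S c n i k : (k <= i)%N ->
  measurable_fun setT (S c n k : g_sigma_algebraType (history W (tt n i)) -> R).
Proof.
move=> ki; have n0 : 0 < n.+1%:R :> R by [].
have /andP[k0 _] := tt_itv n k. have /andP[i0 _] := tt_itv n i.
apply: measurable_funM; first exact: measurable_cst.
apply: measurable_funB; apply: meas_history; last by rewrite lexx.
rewrite k0 /tt ler_pM2r ?invr_gt0// ler_pM2l// ler_nat leq_min geq_minr andbT.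
by rewrite (leq_trans _ ki)// geq_minl.
Qed.

Let meas_max c n i k : (k <= i)%N ->
  measurable_fun setT (running_max (S c n) k : g_sigma_algebraType (history W (tt n i)) -> R).
Proof.
elim: k => [|k IH] ki /=; first exact: measurable_cst.
by apply: measurable_maxr; [apply: IH; exact: ltnW | exact: meas_S].
Qed.

(** The running maximum up to step [i] is measurable for the history of [W] at [tt n i], and the
    next increment is independent of that history with mean 0. *)
Let orth c n i : (i < n.+1)%N ->
  Rint P (fun w => running_max (S c n) i w * (S c n i.+1 w - S c n i w)) = 0.
Proof.
move=> iN; have n0 : 0 < n.+1%:R :> R by [].
have lt : tt n i < tt n i.+1.
  rewrite /tt ltr_pM2r ?invr_gt0// ltr_pM2l// ltr_nat.
  by rewrite (minn_idPl iN) (minn_idPl (ltnW iN)).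
have /andP[i0 _] := tt_itv n i. have /andP[_ i1] := tt_itv n i.+1.
have [LD mD indD] := brownian_increment i0 lt i1.
have LM := L2_running_max i (LS c n).
rewrite (_ : (fun w => _) = fun w => c *
   (running_max (S c n) i w * (W (tt n i.+1) w - W (tt n i) w))); last first.
  by apply/funext => w; rewrite /S; ring.
rewrite RintZ; last exact: itg_dot.
rewrite (indep_Rint _ _ indD)// ?mD ?mulr0//.
- by apply: g_sigma_measurable; exact: history_measurable.
- by apply: g_sigma_measurable; apply: generators_measurable; exact: measurable_funB.
- exact: meas_max.
- exact: meas_generators.
Qed.

(* B ^ 2 is the lower limit of squared maxima over refining grids; Doob bounds
   their means uniformly and Fatou passes to the limit. *)
Lemma brownian_sup : exists B : Omega -> R,
  [/\ L2 P B, forall w, 0 <= B w &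
    {ae P, forall w t, 0 <= t <= T -> `|W t w| <= B w}].
Proof.
pose Q n w := running_max (S 1 n) n.+1 w ^+ 2 + running_max (S (-1) n) n.+1 w ^+ 2.
(* Doob's factor 4, once for each sign. *)
pose C := 8 * Rint P (fun w => (W T w - W 0 w) ^+ 2).
have TT : 0 <= T <= T by rewrite lexx ltW.
have iQ n : itg P (Q n) by apply: itgD; exact: (L2_running_max _ (LS _ n)).2.
have ttn n : tt n n.+1 = T by rewrite /tt minnn mulfK.
have QC n : Rint P (Q n) <= C.
  rewrite /Q RintD; [|exact: (L2_running_max _ (LS _ n)).2..].
  have h c : Rint P (fun w => running_max (S c n) n.+1 w ^+ 2) <=
      4 * Rint P (fun w => S c n n.+1 w ^+ 2).
    by apply: doob => // i; exact: orth.
  have := h 1; have := h (-1).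
  have e c : c ^+ 2 = 1 -> Rint P (fun w => S c n n.+1 w ^+ 2) =
      Rint P (fun w => (W T w - W 0 w) ^+ 2).
    by move=> c1; apply: eq_Rint => w; rewrite /S ttn exprMn c1 mul1r.
  by rewrite !e ?expr1n ?sqrrN ?expr1n// /C; lra.
have Q0 n w : 0 <= Q n w by rewrite addr_ge0 ?sqr_ge0.
have mQ n : measurable_fun setT (fun w => (Q n w)%:E).
  by apply/measurable_EFinP; exact: itg_meas (iQ n).
pose q w := limn_einf (fun n => (Q n w)%:E).
have q0 w : (0 <= q w)%E.
  by apply: limn_einf_ge; apply: nearW => n; rewrite lee_fin.
have mq : measurable_fun setT q.
  rewrite (_ : q = fun w => (- limn_esup (fun n => - (Q n w)%:E))%E); last first.
    apply/funext => w; rewrite /q -limn_einfN; congr limn_einf.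
    by apply/funext => n; rewrite /comp oppeK.
  apply: measurableT_comp => //; apply: measurable_fun_limn_esup => n.
  exact: measurableT_comp.
have qC : (\int[P]_w q w <= C%:E)%E.
  have Q0e n w : setT w -> (0 <= (Q n w)%:E)%E by rewrite lee_fin.
  apply: (le_trans (fatou P measurableT mQ Q0e)).
  by apply: limn_einf_le => n; rewrite -RintE// lee_fin.
have iq : P.-integrable setT q.
  apply/integrableP; split=> //; apply: le_lt_trans (ltry C).
  by under eq_integral do rewrite gee0_abs//.
have aeq : {ae P, forall w, q w \is a fin_num}.
  by have := integrable_ae measurableT iq; apply: filterS => z /(_ I).
pose h w := fine (q w).
have mh : measurable_fun setT h by apply: (measurableT_comp (fine_measurable measurableT)).
have h0 w : 0 <= h w by exact: fine_ge0.
have ih : itg P h.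
  apply: le_integrable iq => //; first exact/measurable_EFinP.
  by move=> z _; rewrite /h; case: (q z) => //=; rewrite ?lee_fin ?normr0// leey.
exists (fun w => Num.sqrt (h w)); split.
- split.
    have ms : measurable_fun setT (@Num.sqrt R).
      by apply: continuous_measurable_fun; exact: sqrt_continuous.
    exact: measurableT_comp ms mh.
  by apply: eq_itg ih => w; rewrite sqr_sqrtr.
- by move=> w; exact: sqrtr_ge0.
have [_ cW _] := BW.
apply: filterS3 aeq cW brownian0 => w qw cw W0w t /andP[t0 tT].
rewrite -ler_sqr ?nnegrE ?sqrtr_ge0// sqr_sqrtr// real_normK ?num_real//.
rewrite -lee_fin /h fineK//.
have c1 : (fun n => (W (grid T n t) w ^+ 2)%:E) @ \oo --> (W t w ^+ 2)%:E.
  apply: cvg_EFin; first by near=> n.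
  apply: (cvg_comp _ (fun x : R => x ^+ 2)); last exact: exprn_continuous.
  apply: (within_cvg_seq cw); first by rewrite t0.
    move=> n; have /andP[g0 g1] := grid_itv n T0 t0.
    by rewrite g0 (le_trans g1).
  exact: grid_cvg.
have [<- _] := cvg_limn_einf_sup c1.
apply: limn_einf_mono => n; rewrite lee_fin.
have n0 : 0 < n.+1%:R :> R by [].
have /andP[g0 g1] := grid_itv n T0 t0.
(* The rounded time is the grid point [tt n j], so the value there is controlled by the two running
   maxima. The case [j = 0] is separate because they start at index 1; there [W 0 w = 0] is used. *)
pose j := Num.trunc (n.+1%:R * t / T).
have jn : (j <= n.+1)%N.
  rewrite -(ler_nat R) -(ler_pM2l T0) -ler_pdivrMr//.
  by rewrite -/(grid T n t) (le_trans g1).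
have -> : grid T n t = tt n j by rewrite /tt (minn_idPl jn).
have [j0|j0] := posnP j.
  by rewrite j0 /tt min0n mulr0 mul0r W0w expr0n/=.
have jE : j = j.-1.+1 by rewrite prednK.
have jl : (j.-1 < n.+1)%N by rewrite prednK.
have h1 := le_running_max (S 1 n) w jl.
have h2 := le_running_max (S (-1) n) w jl.
have m1 := running_max_ge0 (S 1 n) n.+1 w.
have m2 := running_max_ge0 (S (-1) n) n.+1 w.
rewrite -jE /S W0w subr0 mul1r in h1; rewrite -jE /S W0w subr0 mulN1r in h2.
rewrite /Q; move: h1 h2 m1 m2.
set a := running_max _ _ _; set b := running_max _ _ _; set x := W _ w.
move=> h1 h2 m1 m2; have [x0|x0] := leP 0 x; first by have := sqr_ge0 b; nra.
by have := sqr_ge0 a; nra.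
Unshelve. all: by end_near. Qed.

End brownian_sup.

(** * Progressively measurable processes *)

Section filtrations.
Context d (Omega : measurableType d) (R : realType) (P : probability Omega R).
Variables (T : R) (F : R -> set (set Omega)).
Hypothesis T0 : 0 < T.
Local Notation leb := (@lebesgue_measure R).
Local Notation TR := (measurableTypeR R).
Local Notation m := (leb \x P)%E.

(** Null sets belong to every stage, so paths can be corrected on a null set without losing
    adaptedness. *)
Record complete_filtration : Prop := CompleteFiltration {
  fil_meas : forall t, <<s F t >> `<=` measurable;
  fil_mono : forall s t, s <= t -> <<s F s >> `<=` <<s F t >>;
  fil_null : forall t A, P.-negligible A -> <<s F t >> A }.

Hypothesis fil : complete_filtration.

Implicit Types f g : R * Omega -> R.

Lemma ind_itv (a b t : R) : \1_(`[a, b]%classic) t = (if a <= t <= b then 1 else 0) :> R.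
Proof.
rewrite indicE; case: ifPn => h; first by rewrite mem_set//= in_itv.
by rewrite memNset//= in_itv/=; exact/negP.
Qed.

(** The indicator replaces measurability on the strip [[0, t]] by measurability on the whole
    product, where sums, products and limits are available directly. *)
Definition prog f := forall t, 0 <= t <= T ->
  measurable_fun setT (fun z : TR * g_sigma_algebraType (F t) =>
    \1_(`[0, t]%classic) z.1 * f z).

Lemma progressiveP f : prog f <-> progressive T F (fun t w => f (t, w)).
Proof.
have key t : measurable_fun setT (fun z : TR * g_sigma_algebraType (F t) =>
    \1_(`[0, t]%classic) z.1 * f z) <->
  measurable_fun (`[0, t]%classic `*` setT)
      (fun z : R * g_sigma_algebraType (F t) => f (z.1, z.2)).
  have mD : measurable (`[0, t]%classic `*` setT : set (TR * g_sigma_algebraType (F t))).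
    by apply: measurableX => //; exact: measurable_itv.
  rewrite (_ : (fun z : TR * g_sigma_algebraType (F t) => _) =
      (fun z : TR * g_sigma_algebraType (F t) => f (z.1, z.2)) \_ (`[0, t]%classic `*` setT)).
    by split=> /(measurable_restrictT _ mD).
  apply/funext => -[s w]; rewrite /patch ind_itv/=.
  case: ifPn => h; last by rewrite mul0r memNset//= in_itv/= => -[/(negP h)].
  by rewrite mul1r mem_set//= in_itv.
by split=> h t tT; [apply/key; apply: h; move: tT; rewrite in_itv
  | apply/key; apply: h; rewrite in_itv].
Qed.

Lemma prog_adapted f t : prog f -> 0 <= t <= T ->
  measurable_fun setT ((fun w => f (t, w)) : g_sigma_algebraType (F t) -> R).
Proof.
move=> pf tT; have := measurableT_comp (pf t tT) (pair1_measurable t).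
rewrite /comp/=; have -> : \1_(`[0, t]%classic) t = 1 :> R.
  by rewrite ind_itv lexx; case/andP: tT => ->.
by under eq_fun do rewrite mul1r.
Qed.

Lemma meas_prod_mono (G H : set (set Omega)) f : <<s G >> `<=` <<s H >> ->
  measurable_fun setT (f : TR * g_sigma_algebraType G -> R) ->
  measurable_fun setT (f : TR * g_sigma_algebraType H -> R).
Proof.
move=> GH mf.
pose i (z : TR * g_sigma_algebraType H) : TR * g_sigma_algebraType G := (z.1, z.2).
have mi : measurable_fun setT i.
  apply: measurable_fun_pair; first exact: measurable_fst.
  move=> _ A mA; rewrite setTI.
  rewrite (_ : _ @^-1` _ = setT `*` (A : set (g_sigma_algebraType H))).
    by apply: measurableX => //; exact: GH.
  by apply/seteqP; split => z //= -[].
rewrite (_ : f = (f : TR * g_sigma_algebraType G -> R) \o i); last first.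
  by apply/funext => -[].
exact: measurableT_comp.
Qed.

Lemma meas_prod_sub (G : set (set Omega)) f : <<s G >> `<=` measurable ->
  measurable_fun setT (f : TR * g_sigma_algebraType G -> R) ->
  measurable_fun setT (f : TR * Omega -> R).
Proof.
move=> GH mf.
pose i (z : TR * Omega) : TR * g_sigma_algebraType G := (z.1, z.2).
have mi : measurable_fun setT i.
  apply: measurable_fun_pair; first exact: measurable_fst.
  move=> _ A mA; rewrite setTI.
  rewrite (_ : _ @^-1` _ = setT `*` (A : set Omega)).
    by apply: measurableX => //; exact: GH.
  by apply/seteqP; split => z //= -[].
rewrite (_ : f = (f : TR * g_sigma_algebraType G -> R) \o i); last first.
  by apply/funext => -[].
exact: measurableT_comp.
Qed.

(** For such functions integrals over [[0, T]] become integrals over the whole line. *)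
Definition supp f := forall z, ~ (0 <= z.1 <= T) -> f z = 0.

Lemma supp_ind f z : supp f -> \1_(`[0, T]%classic) z.1 * f z = f z.
Proof.
move=> sf; rewrite ind_itv; case: ifPn => [_|/negP/sf ->]; first by rewrite mul1r.
by rewrite mulr0.
Qed.

Lemma prog_measT f : prog f -> supp f ->
  measurable_fun setT (f : TR * g_sigma_algebraType (F T) -> R).
Proof.
move=> pf sf; have := pf T; rewrite lexx ltW// => /(_ isT).
by under eq_fun do rewrite supp_ind//.
Qed.

Lemma prog_meas f : prog f -> supp f -> measurable_fun setT (f : TR * Omega -> R).
Proof.
by move=> pf sf; apply: (meas_prod_sub (fil_meas fil (t := T))); exact: prog_measT.
Qed.

Lemma progD f g : prog f -> prog g -> prog (fun z => f z + g z).
Proof.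
move=> pf pg t tT; under eq_fun do rewrite mulrDr.
by apply: measurable_funD; [exact: pf|exact: pg].
Qed.

Lemma progZ a f : prog f -> prog (fun z => a * f z).
Proof.
move=> pf t tT; under eq_fun do rewrite mulrCA.
by apply: measurable_funM; [exact: measurable_cst|exact: pf].
Qed.

Lemma progM f g : prog f -> prog g -> prog (fun z => f z * g z).
Proof.
move=> pf pg t tT.
rewrite (_ : (fun z : TR * g_sigma_algebraType (F t) => _) = fun z =>
  (\1_(`[0, t]%classic) z.1 * f z) * (\1_(`[0, t]%classic) z.1 * g z)).
  by apply: measurable_funM; [exact: pf|exact: pg].
by apply/funext => z; rewrite ind_itv; case: ifP => _; rewrite ?mul1r ?mul0r.
Qed.

Lemma prog_time (h : R -> R) : measurable_fun setT (h : TR -> R) ->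
  prog (fun z => h z.1).
Proof.
move=> mh t tT; apply: measurable_funM.
  exact: measurable_fst_itv.
by apply: (measurableT_comp mh); exact: measurable_fst.
Qed.

Lemma prog_state (X : Omega -> R) :
  (forall t, 0 <= t -> measurable_fun setT (X : g_sigma_algebraType (F t) -> R)) ->
  prog (fun z => X z.2).
Proof.
move=> mX t /andP[t0 tT]; apply: measurable_funM.
  exact: measurable_fst_itv.
by apply: (measurableT_comp (mX t t0)); exact: measurable_snd.
Qed.

Lemma prog_rlim (f : nat -> R * Omega -> R) : (forall n, prog (f n)) ->
  prog (fun z => rlim (fun n => f n z)).
Proof.
move=> pf t tT.
rewrite (_ : (fun z : TR * g_sigma_algebraType (F t) => _) = fun z =>
  rlim (fun n => \1_(`[0, t]%classic) z.1 * f n z)).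
  by apply: measurable_rlim => n; exact: pf.
apply/funext => z; rewrite ind_itv; case: ifP => _.
  by rewrite mul1r; congr rlim; apply/funext => n; rewrite mul1r.
rewrite mul0r; apply/esym/rlimE.
rewrite (_ : (fun n => _) = fun=> 0); first exact: cvg_cst.
by apply/funext => n; rewrite mul0r.
Qed.

(** Rounding times down by [grid] approximates the process on [[0, t]] by step processes that only
    use times up to [t]; continuity gives the pointwise limit. *)
Lemma prog_continuous (b : R -> Omega -> R) :
  (forall s, 0 <= s <= T -> measurable_fun setT (b s : g_sigma_algebraType (F s) -> R)) ->
  (forall w, {within `[0, T], continuous (fun t => b t w)}) ->
  prog (fun z => b z.1 z.2).
Proof.
move=> mb cb t /andP[t0 tT].
apply: (measurable_fun_cvg (h := fun n (z : TR * g_sigma_algebraType (F t)) =>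
   \1_(`[0, t]%classic) z.1 * b (grid T n z.1) z.2)).
  move=> n; apply: measurable_grid_comp => // s /andP[s0 st].
  apply: (meas_g_mono (fil_mono fil st)); apply: mb.
  by rewrite s0 (le_trans st).
move=> [s w] _ /=; rewrite ind_itv; case: ifPn => [/andP[s0 st]|_]; last first.
  by rewrite mul0r; under eq_fun do rewrite mul0r; exact: cvg_cst.
rewrite mul1r; under eq_fun do rewrite mul1r.
apply: (within_cvg_seq (cb w)); first by rewrite s0 (le_trans st).
  move=> n; have /andP[g0 g1] := grid_itv n T0 s0.
  by rewrite g0 (le_trans g1)// (le_trans st).
exact: grid_cvg.
Qed.

Definition KP (delta : R) f z : R :=
  \1_(`[0, T]%classic) z.1 * Kp delta (fun s => f (s, z.2)) z.1.

Lemma supp_ind_mul f : supp (fun z => \1_(`[0, T]%classic) z.1 * f z).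
Proof. by move=> z /negP/negbTE nz; rewrite ind_itv nz mul0r. Qed.

Lemma supp_KP delta f : supp (KP delta f).
Proof. exact: supp_ind_mul. Qed.

(** Up to time [t] the operator sees its integrand on [[0, t]] only; cutting the integrand there
    changes nothing and makes joint measurability for [F t] apply. *)
Lemma prog_KP delta f : prog f -> prog (KP delta f).
Proof.
move=> pf t /andP[t0 tT].
rewrite (_ : (fun z : TR * g_sigma_algebraType (F t) => _) = fun z =>
  \1_(`[0, t]%classic) z.1 * Kp delta (fun s => \1_(`[0, t]%classic) s * f (s, z.2)) z.1).
  apply: measurable_funM.
    exact: measurable_fst_itv.
  apply: (measurable_Kp delta
    (b := fun y : R * (TR * g_sigma_algebraType (F t)) =>
      \1_(`[0, t]%classic) y.1 * f (y.1, y.2.2))); first exact: measurable_fst.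
  pose i (y : TR * (TR * g_sigma_algebraType (F t))) : TR * g_sigma_algebraType (F t) :=
    (y.1, y.2.2).
  have mi : measurable_fun setT i.
    apply: measurable_fun_pair; first exact: measurable_fst.
    by apply: measurableT_comp; exact: measurable_snd.
  have tT' : 0 <= t <= T by rewrite t0.
  exact: measurableT_comp (pf t tT') mi.
apply/funext => -[s w]; rewrite /KP !ind_itv/=.
case: ifPn => [/andP[s0 st]|_]; last by rewrite !mul0r.
rewrite s0 (le_trans st tT)/= !mul1r; apply: eq_Kp => r /andP[r0 rs].
by rewrite ind_itv r0 (le_trans rs st) mul1r.
Qed.

Lemma ae_prod (Q : Omega -> Prop) : {ae P, forall w, Q w} ->
  {ae m, forall z : R * Omega, Q z.2}.
Proof.
move=> [N [mN N0 QN]]; exists (setT `*` N); split.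
- exact: measurableX.
- by rewrite (product_measure1E leb P measurableT mN) [X in (_ * X)%E]N0 mule0.
- by move=> [t w] /= nQ; split=> //; exact: QN.
Qed.

Lemma L2_ind : L2 m (fun z => \1_(`[0, T]%classic) z.1).
Proof.
have mi : measurable_fun setT (fun z : TR * Omega => \1_(`[0, T]%classic) z.1 : R) by exact: measurable_fst_itv.
split=> //; apply: (itg_prod (g := \1_(`[0, T]%classic) : TR -> R)).
- exact: measurable_funX.
- by move=> x; exact: (itg_cst P (\1_(`[0, T]%classic) x ^+ 2)).
- move=> x; rewrite /= (Rint_cst P `|\1_(`[0, T]%classic) x ^+ 2|) ind_itv ger0_norm ?sqr_ge0//.
  by case: ifP => _; rewrite ?expr1n ?expr0n.
- exact: itg_itv.
Qed.

(** H2 as a subspace of L2(dt x P); [calH2_V] and [V_calH2] translate. *)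
Definition V f := [/\ supp f, prog f & L2 m f].

Lemma V_itg f : V f -> itg m f.
Proof.
move=> [sf pf Lf].
apply: (eq_itg (f := fun z : TR * Omega => \1_(`[0, T]%classic) z.1 * f z)).
  by move=> z; rewrite supp_ind.
exact: itg_dot L2_ind Lf.
Qed.

Lemma V_subspace : @subspace R (R * Omega -> R^o) (L2 m) V.
Proof.
split=> [f [] //||f g [sf pf Lf] [sg pg Lg]|a f [sf pf Lf]].
- split; [by [] | | exact: L2_0].
  have := progZ 0 (prog_time (h := fun=> 0) (measurable_cst _)).
  by under eq_fun do rewrite mulr0.
- split; [|exact: progD|exact: L2D].
  by move=> z nz; rewrite fctE sf// sg// addr0.
- split; [|exact: progZ|exact: L2Z].
  by move=> z nz; rewrite fctE sf// scaler0.
Qed.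

(** The limit is the everywhere defined [rlim], so it is progressive as it stands and not merely
    almost everywhere equal to a progressive process. *)
Lemma V_complete : @complete_set R (R * Omega -> R^o) (dot m) V.
Proof.
move=> f C q C0 q01 Vf df.
have Lf n : L2 m (f n) by case: (Vf n).
have [Lg cg] := riesz_fischer C0 q01 Lf df.
exists (fun z => rlim (fun n => f n z)) => //; split=> //.
- move=> z nz; apply: rlimE; rewrite (_ : (fun n => _) = fun=> 0).
    exact: cvg_cst.
  by apply/funext => n; have [sf _ _] := Vf n; rewrite sf.
- by apply: prog_rlim => n; case: (Vf n).
Qed.

Definition cut (b : R -> Omega -> R) (z : R * Omega) : R :=
  \1_(`[0, T]%classic) z.1 * b z.1 z.2.

Lemma supp_cut b : supp (cut b). Proof. exact: supp_ind_mul. Qed.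

Lemma cutE b t w : 0 <= t <= T -> cut b (t, w) = b t w.
Proof. by move=> tT; rewrite /cut ind_itv/= tT mul1r. Qed.

Lemma prog_cut b : progressive T F b -> prog (cut b).
Proof.
move=> pb; apply: progM; last exact/progressiveP.
apply: (prog_time (h := \1_(`[0, T]%classic))).
by apply: measurable_indic; exact: measurable_itv.
Qed.

Lemma H2_integral (b : R -> Omega -> R) : measurable_fun setT (cut b : TR * Omega -> R) ->
  (\int[P]_w \int[leb]_(t in `[0%R, T]) (`|b t w| ^+ 2)%:E =
   \int[m]_z (cut b z ^+ 2)%:E)%E.
Proof.
move=> mb; rewrite (fubini_tonelli2 (fun z : TR * Omega => (cut b z ^+ 2)%:E)).
- apply: eq_integral => w _; rewrite integral_mkcond; apply: eq_integral => t _.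
  rewrite /patch /cut ind_itv real_normK ?num_real//; case: ifPn.
    by rewrite inE/= in_itv/= => ->; rewrite mul1r.
  rewrite notin_setE/= in_itv/= => /negP/negbTE ->.
  by rewrite mul0r expr0n.
- by apply/measurable_EFinP; exact: measurable_funX.
- by move=> z; rewrite lee_fin sqr_ge0.
Qed.

Lemma calH2_V b : calH2 P T F b -> V (cut b).
Proof.
move=> [pb hb]; have sb := supp_cut b; have pc := prog_cut pb.
have mb := prog_meas pc sb.
split=> //; split=> //; apply/integrableP; split.
  by apply/measurable_EFinP; exact: measurable_funX.
under eq_integral do rewrite abse_EFin ger0_norm ?sqr_ge0//.
by rewrite -H2_integral.
Qed.

Lemma V_calH2 f : V f -> calH2 P T F (fun t w => f (t, w)).
Proof.
move=> [sf pf [mf if2]]; split; first exact/progressiveP.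
have cf : cut (fun t w => f (t, w)) = f.
  by apply/funext => -[t w]; rewrite /cut (supp_ind (t, w) sf).
by rewrite H2_integral cf// -RintE// ltry.
Qed.

End filtrations.

(** * Continuous processes with a square integrable bound *)

Section sup_processes.
Context d (Omega : measurableType d) (R : realType) (P : probability Omega R).
Variables (T : R) (F : R -> set (set Omega)).
Hypothesis T0 : 0 < T.
Hypothesis fil : complete_filtration P F.
Local Notation leb := (@lebesgue_measure R).
Local Notation TR := (measurableTypeR R).
Local Notation m := (leb \x P)%E.
Local Notation V := (V P T F).

Implicit Types f g : R * Omega -> R.

Definition cts_paths f :=
  {ae P, forall w, {within `[0, T], continuous (fun t => f (t, w))}}.

(** The measurable bound [B] stands in for the supremum over time and so avoids questions about its
    measurability. *)
Definition dominated f := exists B : Omega -> R,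
  [/\ L2 P B, forall w, 0 <= B w & {ae P, forall w t, `|f (t, w)| <= B w}].

Definition S2 f := [/\ supp T f, prog T F f, cts_paths f & dominated f].

Lemma meas_section f w : measurable_fun setT (f : TR * Omega -> R) ->
  measurable_fun setT ((fun t => f (t, w)) : TR -> R).
Proof. by move=> mf; have := measurableT_comp mf (pair2_measurable w). Qed.

Lemma ae_prodI (Q : R -> Omega -> Prop) : {ae P, forall w t, Q t w} ->
  {ae m, forall z : R * Omega, Q z.1 z.2}.
Proof.
by move=> /ae_prod; apply: (filterS (F := almost_everywhere m)) => -[t w] /(_ t).
Qed.

Lemma dominated_L2 f : supp T f -> measurable_fun setT (f : TR * Omega -> R) ->
  dominated f -> L2 m f.
Proof.
move=> sf mf [B [[mB B2] B0 fB]]; split=> //.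
apply: (itg_le_ae (g := fun z : TR * Omega => \1_(`[0, T]%classic) z.1 * B z.2 ^+ 2)).
- exact: measurable_funX.
- apply: (filterS (F := almost_everywhere m) _ (ae_prodI fB)) => -[t w] /= fle.
  rewrite ind_itv; case: ifPn => [_|/negP nt]; last first.
    by rewrite mul0r (sf (t, w))// expr0n/= normr0.
  rewrite mul1r ger0_norm ?sqr_ge0// -real_normK ?num_real//.
  by rewrite lerXn2r// nnegrE.
- have mI : measurable_fun setT (fun z : TR * Omega => \1_(`[0, T]%classic) z.1 : R).
    exact: measurable_fst_itv.
  apply: (itg_prod (g := fun t : TR => Rint P (fun w => B w ^+ 2) * \1_(`[0, T]%classic) t)).
  + apply: measurable_funM => //; apply: measurable_funX.
    by apply: measurableT_comp => //; exact: measurable_snd.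
  + by move=> t; have := itgZ (\1_(`[0, T]%classic) t) B2.
  + move=> t; rewrite mulrC -RintZ// le_eqVlt; apply/orP; left; apply/eqP.
    have i0 : 0 <= \1_(`[0, T]%classic) t :> R by rewrite indicE ler0n.
    by apply: eq_Rint => w; rewrite /= ger0_norm// mulr_ge0// sqr_ge0.
  + by apply: itgZ; exact: itg_itv.
Qed.

Lemma S2_V f : S2 f -> V f.
Proof.
by move=> [sf pf _ df]; split=> //; apply: dominated_L2 => //; exact: (prog_meas T0 fil pf sf).
Qed.

Lemma cts_pathsD f g : cts_paths f -> cts_paths g -> cts_paths (fun z => f z + g z).
Proof. by apply: filterS2 => w cf cg t; exact: cvgD (cf t) (cg t). Qed.

Lemma cts_pathsZ a f : cts_paths f -> cts_paths (fun z => a * f z).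
Proof. by apply: filterS => w cf t; exact: cvgM (cvg_cst _) (cf t). Qed.

Lemma S2D f g : S2 f -> S2 g -> S2 (fun z => f z + g z).
Proof.
move=> [sf pf cf [B [LB B0 fB]]] [sg pg cg [C [LC C0 gC]]]; split.
- by move=> z nz; rewrite sf// sg// addr0.
- exact: progD.
- exact: cts_pathsD.
- exists (fun w => B w + C w); split; [exact: L2D|by move=> w; rewrite addr_ge0|].
  by apply: filterS2 fB gC => w fw gw t; rewrite (le_trans (ler_normD _ _))// lerD.
Qed.

Lemma S2Z a f : S2 f -> S2 (fun z => a * f z).
Proof.
move=> [sf pf cf [B [LB B0 fB]]]; split.
- by move=> z nz; rewrite sf// mulr0.
- exact: progZ.
- exact: cts_pathsZ.
- exists (fun w => `|a| * B w); split; [exact: L2Z|by move=> w; rewrite mulr_ge0|].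
  by apply: filterS fB => w fw t; rewrite normrM ler_wpM2l.
Qed.

Lemma S2B f g : S2 f -> S2 g -> S2 (fun z => f z - g z).
Proof.
move=> Sf /(S2Z (-1)) Sg; have := S2D Sf Sg.
by under eq_fun do rewrite mulN1r.
Qed.

Lemma V_paths f : V f -> {ae P, forall w,
  L2 leb (fun t => f (t, w)) /\ itg leb (fun t => f (t, w))}.
Proof.
move=> Vf; have [sf pf [mf if2]] := Vf.
have [h1 _] := itg_fubini2 if2; have [h2 _] := itg_fubini2 (V_itg Vf).
apply: filterS2 h1 h2 => w i2 i1; split=> //; split=> //.
exact: meas_section.
Qed.

(** Pathwise Cauchy-Schwarz bounds the whole path by the square root of [T] times its energy, which
    has finite mean by Fubini. *)
Lemma S2_KP (delta : R) f : 0 <= delta -> V f -> S2 (KP T delta f).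
Proof.
move=> d0 Vf; have [sf pf [mf if2]] := Vf; split.
- exact: supp_KP.
- exact: prog_KP.
- apply: filterS (V_paths Vf) => w [_ iw].
  apply: subspace_eq_continuous (continuous_Kp d0 (ltW T0) iw) => t.
  rewrite inE/= in_itv/= => tT.
  by change (Kp delta (fun s => f (s, w)) t = KP T delta f (t, w));
    rewrite /KP ind_itv tT mul1r.
- pose h w := T * Rint leb (fun t => f (t, w) ^+ 2).
  have h0 w : 0 <= h w by rewrite mulr_ge0 ?Rint_ge0 ?ltW// => t; exact: sqr_ge0.
  have [_ [ih _]] := itg_fubini2 if2.
  have mh : measurable_fun setT h.
    by apply: measurable_funM; [exact: measurable_cst | exact: itg_meas ih].
  exists (fun w => Num.sqrt (h w)); split.
  + split.
      have ms : measurable_fun setT (@Num.sqrt R).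
        by apply: continuous_measurable_fun; exact: sqrt_continuous.
      exact: measurableT_comp ms mh.
    apply: (eq_itg (f := h)); first by move=> w; rewrite sqr_sqrtr.
    exact: itgZ.
  + by move=> w; exact: sqrtr_ge0.
  + apply: filterS (V_paths Vf) => w [Lw _] t.
    rewrite -ler_sqr ?nnegrE ?sqrtr_ge0// sqr_sqrtr// real_normK ?num_real//.
    rewrite /KP ind_itv/=; case: ifP => [tT|_]; last by rewrite mul0r expr0n/=.
    by rewrite mul1r; exact: sqr_Kp_le.
Qed.

Lemma S2_section f t : S2 f -> 0 <= t <= T -> L2 P (fun w => f (t, w)).
Proof.
move=> [sf pf _ [B [[mB B2] B0 fB]]] tT.
have mt : measurable_fun setT (fun w => f (t, w)).
  by apply: (meas_g_sub (fil_meas fil (t := t))); exact: (prog_adapted pf tT).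
split=> //; apply: itg_le_ae B2; first exact: measurable_funX.
apply: filterS fB => w /(_ t) fw; rewrite ger0_norm ?sqr_ge0//.
by rewrite -real_normK ?num_real// lerXn2r// nnegrE.
Qed.

Lemma S2_state (X : Omega -> R) : L2 P X ->
  (forall t, 0 <= t -> measurable_fun setT (X : g_sigma_algebraType (F t) -> R)) ->
  S2 (fun z => \1_(`[0, T]%classic) z.1 * X z.2).
Proof.
move=> LX mX; split.
- exact: supp_ind_mul.
- apply: progM; last exact: prog_state.
  apply: (prog_time (h := \1_(`[0, T]%classic))).
  by apply: measurable_indic; exact: measurable_itv.
- apply: aeW => w; apply: (@subspace_eq_continuous _ _ _ (fun=> X w)).
    move=> t; rewrite inE/= in_itv/= => tT.
    by change (X w = \1_(`[0, T]%classic) t * X w); rewrite ind_itv tT mul1r.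
  by move=> t; exact: cvg_cst.
- exists (fun w => `|X w|); split=> [|//|]; first exact: L2_norm.
  apply: aeW => w t; rewrite normrM ler_piMl// ind_itv.
  by case: ifP; rewrite ?normr1 ?normr0.
Qed.

(** Continuity holds only almost surely. Setting the path to 0 off the continuity set costs no
    adaptedness, because the complement of that set is null and so belongs to every [F s]. The
    square integrable bound is [brownian_sup]. *)
Lemma S2_brownian (W : R -> {RV P >-> R}) : brownian_motion T W ->
  (forall s, 0 <= s <= T -> measurable_fun setT (W s : g_sigma_algebraType (F s) -> R)) ->
  exists2 f, S2 f & {ae P, forall w t, 0 <= t <= T -> f (t, w) = W t w}.
Proof.
move=> BW mW; have [_ cW _] := BW.
pose A := [set w | {within `[0, T], continuous (fun t => W t w)}].
have nA : P.-negligible (~` A) by exact: cW.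
pose b t w : R := \1_A w * W t w.
have bE w t : A w -> b t w = W t w by move=> Aw; rewrite /b indicE mem_set// mul1r.
have mb s : 0 <= s <= T -> measurable_fun setT (b s : g_sigma_algebraType (F s) -> R).
  move=> sT; apply: measurable_funM; last exact: mW.
  apply: (measurable_indic (T := g_sigma_algebraType (F s)) (U := A)) => //.
  have mC : measurable (~` A : set (g_sigma_algebraType (F s))).
    by have := fil_null fil; move=> /(_ s _ nA).
  by have := measurableC mC; rewrite setCK.
have cb w : {within `[0, T], continuous (fun t => b t w)}.
  have [Aw|nAw] := pselect (A w).
    by rewrite (_ : (fun t => b t w) = fun t => W t w)//; apply/funext => t; exact: bE.
  rewrite (_ : (fun t => b t w) = fun=> 0); first by move=> t; exact: cvg_cst.
  by apply/funext => t; rewrite /b indicE memNset// mul0r.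
have [B [LB B0 WB]] := brownian_sup T0 BW.
have fW w t : A w -> 0 <= t <= T -> cut T b (t, w) = W t w.
  by move=> Aw tT; rewrite cutE// bE.
exists (cut T b); last by apply: filterS cW => w Aw t tT; exact: fW.
split.
- exact: supp_cut.
- apply: progM; last exact: (prog_continuous T0 fil mb cb).
  apply: (prog_time (h := \1_(`[0, T]%classic))).
  by apply: measurable_indic; exact: measurable_itv.
- apply: aeW => w; apply: subspace_eq_continuous (cb w) => t.
  rewrite inE/= in_itv/= => tT.
  by change (b t w = cut T b (t, w)); rewrite cutE.
- exists B; split=> //; apply: filterS2 cW WB => w Aw WBw t.
  have [tT|/negP nt] := boolP (0 <= t <= T); first by rewrite fW// WBw.
  by rewrite supp_cut// normr0.
Qed.

End sup_processes.

(** * The equilibrium condition *)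

Section dot_algebra.
Context d (T : measurableType d) (R : realType).
Variable mu : {measure set T -> \bar R}.
Implicit Types f g h : T -> R.
Let si := semi_inner_L2 mu.

Lemma dotC f g : dot mu f g = dot mu g f.
Proof. exact: (siC si). Qed.

Lemma dot_ge0 f : 0 <= dot mu f f.
Proof. exact: (si_ge0 si). Qed.

Lemma dotDl f g h : L2 mu f -> L2 mu g -> L2 mu h ->
  dot mu (fun z => f z + g z) h = dot mu f h + dot mu g h.
Proof. exact: (siDl si). Qed.

Lemma dotBl f g h : L2 mu f -> L2 mu g -> L2 mu h ->
  dot mu (fun z => f z - g z) h = dot mu f h - dot mu g h.
Proof. exact: (siBl si). Qed.

Lemma dotZl a f g : L2 mu f -> L2 mu g ->
  dot mu (fun z => a * f z) g = a * dot mu f g.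
Proof. exact: (siZl si). Qed.

Lemma dotDr f g h : L2 mu f -> L2 mu g -> L2 mu h ->
  dot mu h (fun z => f z + g z) = dot mu h f + dot mu h g.
Proof. exact: (siDr si). Qed.

Lemma dotBr f g h : L2 mu f -> L2 mu g -> L2 mu h ->
  dot mu h (fun z => f z - g z) = dot mu h f - dot mu h g.
Proof. exact: (siBr si). Qed.

Lemma dotZr a f g : L2 mu f -> L2 mu g ->
  dot mu g (fun z => a * f z) = a * dot mu g f.
Proof. exact: (siZr si). Qed.

Lemma dot_cauchy_schwarz f g : L2 mu f -> L2 mu g ->
  dot mu f g ^+ 2 <= dot mu f f * dot mu g g.
Proof. exact: (si_cauchy_schwarz si). Qed.

Lemma dot_ae f f' g : measurable_fun setT f -> measurable_fun setT f' ->
  measurable_fun setT g -> {ae mu, forall z, f z = f' z} ->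
  dot mu f g = dot mu f' g.
Proof.
move=> mf mf' mg ff; apply: Rint_ae; [exact: measurable_funM..|].
by apply: filterS ff => z ->.
Qed.

Lemma dot_eq0_ae f : L2 mu f -> dot mu f f = 0 -> {ae mu, forall z, f z = 0}.
Proof.
move=> [mf if2]; rewrite dot_sqr => /(Rint_eq0_ae if2 (fun=> sqr_ge0 _)).
by apply: filterS => z /eqP; rewrite sqrf_eq0 => /eqP.
Qed.

End dot_algebra.

(** * The price term and the first order condition *)

Section price.
Context d (Omega : measurableType d) (R : realType) (P : probability Omega R).
Variables (T : R) (F : R -> set (set Omega)).
Hypothesis T0 : 0 < T.
Hypothesis fil : complete_filtration P F.
Local Notation leb := (@lebesgue_measure R).
Local Notation TR := (measurableTypeR R).
Local Notation m := (leb \x P)%E.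
Local Notation V := (V P T F).

Variables (pr : R -> R -> R) (L delta : R).
Hypotheses (L0 : 0 <= L) (delta0 : 0 <= delta).
Hypothesis pr_meas : forall x, measurable_fun setT (pr ^~ x : TR -> R).
Hypothesis pr_lip : forall t x y, `|pr t x - pr t y| <= L * `|x - y|.
Hypothesis pr_itg : itg leb (fun t => pr t 0).
Hypothesis pr_decr : forall t x y, x <= y -> pr t y <= pr t x.

Hypothesis pr_supp : forall t x, ~ (0 <= t <= T) -> pr t x = 0.

Implicit Types f g u y : R * Omega -> R.

Definition gp u (z : R * Omega) : R := pr z.1 (u z).

(* The adjoint of the control-to-state map KP, applied to the net price. *)
Definition GP u (z : R * Omega) : R :=
  \1_(`[0, T]%classic) z.1 * Rint leb (fun t => kern delta t z.1 * pr t (u (t, z.2))).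

Lemma gp_bound u z : `|gp u z| <= `|pr z.1 0| + L * `|u z|.
Proof.
have := pr_lip z.1 (u z) 0; rewrite subr0 /gp => h.
by rewrite (le_trans _ (lerD (lexx _) h))// -{1}(addrNK (pr z.1 0) (pr z.1 (u z))) addrC ler_normD.
Qed.

Lemma measurable_gp d' (Omega' : measurableType d') (u : R * Omega' -> R) :
  measurable_fun setT (u : TR * Omega' -> R) ->
  measurable_fun setT (fun z : TR * Omega' => pr z.1 (u z)).
Proof.
by move=> mu; apply: (caratheodory_measurable (L := L)).
Qed.

Lemma measurable_indT d' (Omega' : measurableType d') :
  measurable_fun setT (fun z : TR * Omega' => \1_(`[0, T]%classic) z.1 : R).
Proof.
exact: measurable_fst_itv.
Qed.

(** The probability factor is left arbitrary so that it can carry the sigma-algebra of F0 at time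
    [T]: [GP u] depends on the future of [u] and need not be progressive. *)
Lemma measurable_GP d' (Omega' : measurableType d') (u : R * Omega' -> R) :
  measurable_fun setT (u : TR * Omega' -> R) ->
  measurable_fun setT (fun z : TR * Omega' => \1_(`[0, T]%classic) z.1 *
    Rint leb (fun t => kern delta t z.1 * pr t (u (t, z.2)))).
Proof.
move=> mu; apply: measurable_funM; first exact: measurable_indT.
apply: (measurable_Rint_param leb (f := fun y : (TR * Omega') * TR =>
  kern delta y.2 y.1.1 * pr y.2 (u (y.2, y.1.2)))).
apply: measurable_funM.
  apply: measurable_kern; first exact: measurable_snd.
  by apply: measurableT_comp => //; exact: measurable_fst.
pose i (y : (TR * Omega') * TR) : TR * Omega' := (y.2, y.1.2).
have mi : measurable_fun setT i.
  apply: measurable_fun_pair; first exact: measurable_snd.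
  by apply: measurableT_comp => //; exact: measurable_fst.
exact: measurableT_comp (measurable_gp mu) mi.
Qed.

Lemma itg_gp_path u w : itg leb (fun t => u (t, w)) ->
  measurable_fun setT (u : TR * Omega -> R) ->
  itg leb (fun t => pr t (u (t, w))).
Proof.
move=> iu mu; apply: (itg_le (g := fun t : TR => `|pr t 0| + L * `|u (t, w)|)).
- exact: (meas_section w (measurable_gp mu)).
- by move=> t; exact: (gp_bound u (t, w)).
- by apply: itgD; [exact: itg_norm | apply: itgZ; exact: itg_norm].
Qed.

(** [pr t 0] is integrable in time but perhaps not square integrable, so the L2 pairing handles only
    the Lipschitz part; the part at 0 relies on the bound of [y] uniform in time. *)
Lemma itg_dominated_gp u y : V u -> supp T y ->
  measurable_fun setT (y : TR * Omega -> R) -> dominated P y ->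
  itg m (fun z => gp u z * y z).
Proof.
move=> [su pu Lu] sy my dy.
have mu : measurable_fun setT (u : TR * Omega -> R) := prog_meas T0 fil pu su.
have mgp := measurable_gp mu.
have Ly := dominated_L2 sy my dy.
have [B [LB B0 yB]] := dy; have iB := L2_itg LB.
apply: (itg_le_ae (g := fun z : TR * Omega =>
  `|pr z.1 0| * B z.2 + L * `|u z * y z|)).
- exact: measurable_funM.
- apply: (filterS (F := almost_everywhere m) _ (ae_prodI yB)) => -[t w] /= yle.
  rewrite normrM; apply: (le_trans (ler_wpM2r _ (gp_bound u (t, w)))) => //=.
  by rewrite mulrDl normrM mulrA lerD// ler_wpM2l.
- apply: itgD; last by apply: itgZ; apply: itg_norm; exact: itg_dot.
  apply: (itg_prod (g := fun t : TR => Rint P B * `|pr t 0|)).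
  + apply: measurable_funM.
      apply: measurableT_comp => //.
      by apply: (measurableT_comp (pr_meas 0)); exact: measurable_fst.
    by apply: (measurableT_comp LB.1); exact: measurable_snd.
  + by move=> t; exact: (itgZ `|pr t 0| iB).
  + move=> t; rewrite mulrC -RintZ// le_eqVlt; apply/orP; left; apply/eqP.
    by apply: eq_Rint => w; rewrite /= ger0_norm// mulr_ge0.
  + by apply: itgZ; exact: itg_norm.
Qed.

Lemma Rint_path_norm f w : supp T f -> L2 leb (fun t => f (t, w)) ->
  Rint leb (fun t => `|f (t, w)|) ^+ 2 <= T * Rint leb (fun t => f (t, w) ^+ 2).
Proof.
move=> sf [mf f2].
have Ln : L2 leb (fun t => `|f (t, w)|) by exact: L2_norm.
have := @sqr_Kp_le R 0 T T _ (lexx 0) _ Ln; rewrite lexx ltW//= => /(_ isT).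
rewrite (@eq_Rint _ _ _ leb (fun t => `|f (t, w)| ^+ 2) (fun t => f (t, w) ^+ 2)); last first.
  by move=> t; rewrite real_normK ?num_real.
congr (_ ^+ 2 <= _); apply: eq_Rint => t; rewrite kern0E ind_itv.
case: ifPn => [_|/negP nt]; first by rewrite mul1r.
by rewrite (sf (t, w))// normr0 mul0r.
Qed.

(** Integration over time turns the merely integrable [pr t 0] into a constant, and Cauchy-Schwarz
    on the path bounds the Lipschitz part; hence [GP u] is in L2 even when [gp u] is not. *)
Lemma dominated_GP u : V u -> dominated P (GP u).
Proof.
move=> Vu; have [su pu Lu] := Vu.
have mu : measurable_fun setT (u : TR * Omega -> R) := prog_meas T0 fil pu su.
pose h w := T * Rint leb (fun t => u (t, w) ^+ 2).
have h0 w : 0 <= h w by rewrite mulr_ge0 ?Rint_ge0 ?ltW// => t; exact: sqr_ge0.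
have [_ [ih _]] := itg_fubini2 Lu.2.
have mh : measurable_fun setT h.
  by apply: measurable_funM; [exact: measurable_cst | exact: itg_meas ih].
have Lh : L2 P (fun w => Num.sqrt (h w)).
  split.
    have ms : measurable_fun setT (@Num.sqrt R).
      by apply: continuous_measurable_fun; exact: sqrt_continuous.
    exact: measurableT_comp ms mh.
  apply: (eq_itg (f := h)); first by move=> w; rewrite sqr_sqrtr.
  exact: itgZ.
pose c := Rint leb (fun t => `|pr t 0|).
have c0 : 0 <= c by exact: Rint_ge0.
exists (fun w => c + L * Num.sqrt (h w)); split.
- by apply: L2D; [exact: L2_cst | exact: L2Z].
- by move=> w; rewrite addr_ge0// mulr_ge0// sqrtr_ge0.
apply: filterS (V_paths Vu) => w [L2w iw] s.
rewrite normrM; have i0 : `|\1_(`[0, T]%classic) s| <= 1 :> R.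
  by rewrite ind_itv; case: ifP; rewrite ?normr1 ?normr0.
apply: (le_trans (ler_wpM2r _ i0)) => //; rewrite mul1r.
have ip := itg_gp_path iw mu.
have ik : itg leb (fun t => kern delta t s * pr t (u (t, w))).
  apply: itg_le (itg_norm ip).
    apply: measurable_funM; last exact: itg_meas ip.
    by apply: measurable_kern => //; exact: measurable_cst.
  by move=> t; rewrite normrM ler_piMl// ger0_norm ?kern_ge0// kern_le1.
apply: (le_trans (Rint_norm ik)).
apply: (@le_trans _ _ (Rint leb (fun t => `|pr t 0| + L * `|u (t, w)|))).
  apply: le_Rint; first exact: itg_norm.
    by apply: itgD; [exact: itg_norm | apply: itgZ; exact: itg_norm].
  move=> t; rewrite normrM (le_trans _ (gp_bound u (t, w)))// ler_piMl//.
  by rewrite ger0_norm ?kern_ge0// kern_le1.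
rewrite RintD; [|exact: itg_norm|by apply: itgZ; exact: itg_norm].
rewrite RintZ; last exact: itg_norm.
rewrite lerD2l ler_wpM2l// -ler_sqr ?nnegrE ?sqrtr_ge0 ?Rint_ge0// sqr_sqrtr//.
exact: Rint_path_norm.
Qed.

Lemma L2_GP u : V u -> L2 m (GP u).
Proof.
move=> Vu; have [su pu Lu] := Vu; apply: dominated_L2.
- exact: supp_ind_mul.
- by apply: measurable_GP; exact: (prog_meas T0 fil pu su).
- exact: dominated_GP.
Qed.

(** This is [kernel_fubini] on almost every path, integrated over [Omega]; outside [[0, T]] the
    control and the price vanish. *)
Lemma duality u g : V u -> V g ->
  dot m (GP u) g = Rint m (fun z => gp u z * KP T delta g z).
Proof.
move=> Vu Vg; have [su pu Lu] := Vu; have [sg pg Lg] := Vg.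
have mu : measurable_fun setT (u : TR * Omega -> R) := prog_meas T0 fil pu su.
have [sK pK _ dK] := S2_KP T0 delta0 Vg.
have iK := itg_dominated_gp Vu sK (prog_meas T0 fil pK sK) dK.
rewrite /dot; have [_ [i1 ->]] := itg_fubini2 (itg_dot (L2_GP Vu) Lg).
have [_ [i2 ->]] := itg_fubini2 iK.
apply: Rint_ae; [exact: itg_meas i1 | exact: itg_meas i2 |].
apply: filterS2 (V_paths Vu) (V_paths Vg) => w [_ iu] [_ ig].
have ip := itg_gp_path iu mu.
transitivity (Rint leb (fun s => g (s, w) *
    Rint leb (fun t => kern delta t s * pr t (u (t, w))))).
  apply: eq_Rint => s; rewrite /GP/= ind_itv; case: ifPn => [_|/negP ns].
    by rewrite mul1r mulrC.
  by rewrite mul0r (sg (s, w))// !mul0r.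
rewrite -kernel_fubini//; apply: eq_Rint => t; rewrite /KP/gp/= ind_itv.
case: ifPn => [_|/negP nt]; first by rewrite mul1r.
by rewrite mul0r mulr0 pr_supp// mul0r.
Qed.

Lemma L2_indT : L2 m (fun z : R * Omega => \1_(`[0, T]%classic) z.1).
Proof. exact: L2_ind. Qed.

Lemma KP_norm g : V g -> dot m (KP T delta g) (KP T delta g) <= T ^+ 2 * dot m g g.
Proof.
move=> Vg; have [sg pg Lg] := Vg.
have VK := S2_V T0 fil (S2_KP T0 delta0 Vg); have [_ _ LK] := VK.
rewrite !dot_sqr; have [_ [iK ->]] := itg_fubini2 LK.2.
have [_ [ig ->]] := itg_fubini2 Lg.2.
rewrite -RintZ//; apply: le_Rint_ae => //; first exact: itgZ.
apply: filterS2 (V_paths Vg) (V_paths VK) => w [L2g _] [L2K _].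
have -> : T ^+ 2 * Rint leb (fun t => g (t, w) ^+ 2) =
    Rint leb (fun t => T * Rint leb (fun t => g (t, w) ^+ 2) * \1_(`[0, T]%classic) t).
  by rewrite RintZ ?Rint_itv ?ltW//; [ring | exact: itg_itv].
apply: le_Rint; [exact: L2K.2 | by apply: itgZ; exact: itg_itv |].
move=> t; rewrite /KP ind_itv/=; case: ifP => [tT|_].
  by rewrite mul1r mulr1; exact: sqr_Kp_le.
by rewrite mul0r expr0n/= mulr0.
Qed.

Lemma L2_gpB u1 u2 : V u1 -> V u2 -> L2 m (fun z => gp u1 z - gp u2 z).
Proof.
move=> [s1 p1 L1] [s2 p2 L2']; have m1 := prog_meas T0 fil p1 s1.
have m2 := prog_meas T0 fil p2 s2.
apply: (L2_le (g := fun z : TR * Omega => L * `|u1 z - u2 z|)).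
- by apply: measurable_funB; exact: measurable_gp.
- by move=> z; exact: pr_lip.
- by apply: L2Z; apply: L2_norm; exact: L2B.
Qed.

Lemma gpB_norm u1 u2 : V u1 -> V u2 ->
  dot m (fun z => gp u1 z - gp u2 z) (fun z => gp u1 z - gp u2 z) <=
  L ^+ 2 * dot m (fun z => u1 z - u2 z) (fun z => u1 z - u2 z).
Proof.
move=> V1 V2; have [_ _ L1] := V1; have [_ _ L2'] := V2.
have Lg := L2_gpB V1 V2; have Lu := L2B L1 L2'.
rewrite !dot_sqr -RintZ; last exact: Lu.2.
apply: le_Rint; [exact: Lg.2 | by apply: itgZ; exact: Lu.2|].
move=> z; rewrite -exprMn -[X in X <= _]real_normK ?num_real//.
rewrite -[X in _ <= X]real_normK ?num_real// lerXn2r ?nnegrE//.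
by rewrite normrM (ger0_norm L0); exact: pr_lip.
Qed.

Lemma gpB_mono u1 u2 : V u1 -> V u2 ->
  dot m (fun z => gp u1 z - gp u2 z) (fun z => u1 z - u2 z) <= 0.
Proof.
move=> V1 V2; have [_ _ L1] := V1; have [_ _ L2'] := V2.
rewrite -oppr_ge0 -RintN; last exact: itg_dot (L2_gpB V1 V2) (L2B L1 L2').
apply: Rint_ge0 => z; rewrite -mulNr opprB /gp.
have [u12|u12] := leP (u1 z) (u2 z).
  by apply: mulr_le0; rewrite subr_le0 ?pr_decr.
by apply: mulr_ge0; rewrite subr_ge0 ?pr_decr// ltW.
Qed.

(** In a difference of prices the part at 0 cancels, so here both factors on the right are in L2. *)
Lemma duality_diff u1 u2 g : V u1 -> V u2 -> V g ->
  dot m (GP u1) g - dot m (GP u2) g =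
  dot m (fun z => gp u1 z - gp u2 z) (KP T delta g).
Proof.
move=> V1 V2 Vg; have [sK pK _ dK] := S2_KP T0 delta0 Vg.
have mK := prog_meas T0 fil pK sK.
rewrite !duality// -RintB; [|exact: itg_dominated_gp..].
by apply: eq_Rint => z; rewrite mulrBl.
Qed.

Variables (ci ca : R) (x0 : R * Omega -> R).
Hypotheses (ca0 : 0 < ca) (Vx0 : V x0).

Definition state a (z : R * Omega) : R := x0 z + KP T delta a z.

(* The gradient of the profit at the control a, the price being driven by the
   state that a itself controls. *)
Definition foc a (z : R * Omega) : R :=
  GP (state a) z - ci * \1_(`[0, T]%classic) z.1 - 2 * ca * a z.

Lemma V_KP a : V a -> V (KP T delta a).
Proof. by move=> Va; apply: (S2_V T0 fil); exact: S2_KP. Qed.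

Lemma V_D a b : V a -> V b -> V (fun z => a z + b z).
Proof. by have [_ _ + _] := V_subspace P T F; apply. Qed.

Lemma V_Z c a : V a -> V (fun z => c * a z).
Proof. by have [_ _ _] := V_subspace P T F; apply. Qed.

Lemma V_B a b : V a -> V b -> V (fun z => a z - b z).
Proof.
move=> Va Vb; have := V_D Va (V_Z (-1) Vb).
by under eq_fun do rewrite mulN1r.
Qed.

Lemma V_state a : V a -> V (state a).
Proof. by move=> Va; apply: V_D => //; exact: V_KP. Qed.

Lemma L2_foc a : V a -> L2 m (foc a).
Proof.
move=> Va; have [_ _ La] := Va; apply: L2B; last exact: L2Z.
by apply: L2B; [apply: L2_GP; exact: V_state | apply: L2Z; exact: L2_indT].
Qed.

Lemma KP_B_paths a b : V a -> V b ->
  {ae P, forall w t, KP T delta (fun z => a z - b z) (t, w) =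
    KP T delta a (t, w) - KP T delta b (t, w)}.
Proof.
move=> Va Vb; apply: filterS2 (V_paths Va) (V_paths Vb) => w [_ ia] [_ ib] t.
rewrite /KP -mulrBr; congr (_ * _).
have -> : Kp delta (fun s => b (s, w)) t = - Kp delta (fun s => -1 * b (s, w)) t.
  by rewrite KpZ// mulN1r opprK.
rewrite opprK -KpD//; last exact: itgZ.
by congr Kp; apply/funext => s; rewrite mulN1r.
Qed.

Lemma KP_B a b : V a -> V b ->
  {ae m, forall z, KP T delta (fun z => a z - b z) z = KP T delta a z - KP T delta b z}.
Proof.
move=> Va Vb; have h := KP_B_paths Va Vb.
by apply: (filterS (F := almost_everywhere m) _ (ae_prodI h)) => -[t w].
Qed.

Lemma dot_foc a v : V a -> V v -> dot m (foc a) v =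
  dot m (GP (state a)) v - ci * dot m (fun z => \1_(`[0, T]%classic) z.1) v
  - 2 * ca * dot m a v.
Proof.
move=> Va [_ _ Lv]; have [_ _ La] := Va.
have LG := L2_GP (V_state Va). have LI := L2_indT.
rewrite dotBl//; [|by apply: L2B => //; exact: L2Z|exact: L2Z].
rewrite dotBl//; last exact: L2Z.
by rewrite !dotZl.
Qed.

Let foc_algebra (g1 g2 c k a b : R) :
  (g1 - c - k * a) - (g2 - c - k * b) = (g1 - g2) - k * (a - b).
Proof. by ring. Qed.

Lemma dot_focB a b v : V a -> V b -> V v ->
  dot m (fun z => foc a z - foc b z) v =
  dot m (fun z => gp (state a) z - gp (state b) z) (KP T delta v)
  - 2 * ca * dot m (fun z => a z - b z) v.
Proof.
move=> Va Vb Vv; have [_ _ Lv] := Vv; have [_ _ La] := Va; have [_ _ Lb] := Vb.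
rewrite dotBl//; [|exact: L2_foc..].
rewrite !dot_foc// -duality_diff//; [|exact: V_state..].
rewrite dotBl//; exact: foc_algebra.
Qed.

(** By duality the price part of the gradient difference, tested with [a - b], equals the price
    difference tested with the difference of states, which is at most 0. The quadratic cost leaves
    the monotonicity constant [2 * ca]. *)
Lemma critical_point : exists2 a, V a & forall v, V v -> dot m (foc a) v = 0.
Proof.
have VE := V_subspace P T F.
have Vc : @complete_set R (R * Omega -> R^o) (dot m) V by exact: V_complete.
(* The outer factors 2 come from squaring a sum of two terms. The price difference has squared norm
   at most [L^2 T^2] times that of [a - b] and is paired with [KP v], which costs another [T^2]; the
   cost term contributes [(2 ca)^2]. *)
pose K := 2 * (L ^+ 2 * T ^+ 2 * T ^+ 2) + 2 * (2 * ca) ^+ 2.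
have K0 : 0 <= K.
  by rewrite /K -!exprMn addr_ge0// mulr_ge0// sqr_ge0.
have stB a b : V a -> V b -> forall f, L2 m f ->
   dot m f (fun z => state a z - state b z) = dot m f (KP T delta (fun z => a z - b z)).
  move=> Va Vb f Lf; rewrite dotC [RHS]dotC; apply: dot_ae.
  - by apply: measurable_funB; [case: (V_state Va) | case: (V_state Vb)] => _ _ [].
  - by case: (V_KP (V_B Va Vb)) => _ _ [].
  - by case: Lf.
  - apply: (filterS (F := almost_everywhere m) _ (KP_B Va Vb)) => z ->.
    by rewrite /state; ring.
apply: (strongly_monotone_zero (semi_inner_L2 m) VE Vc L2_foc (m := 2 * ca) (L := K)).
- by rewrite mulr_gt0.
- exact: K0.
- move=> a b Va Vb; rewrite [X in X <= _](dot_focB Va Vb (V_B Va Vb)).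
  rewrite -stB//; last by apply: L2_gpB; exact: V_state.
  have := gpB_mono (V_state Va) (V_state Vb).
  by move=> h; apply: (le_trans (lerD h (lexx _))); rewrite add0r.
- move=> a b v Va Vb Vv; rewrite [X in X ^+ 2 <= _](dot_focB Va Vb Vv).
  have Vab := V_B Va Vb.
  have [_ _ Lv] := Vv; have [_ _ Lab] := Vab; have [_ _ LKv] := V_KP Vv.
  have Lq := L2_gpB (V_state Va) (V_state Vb).
  have [_ _ La'] := V_state Va; have [_ _ Lb'] := V_state Vb.
  have Lst := L2B La' Lb'.
  set q := dot m _ (KP T delta v).
  have h1 : q ^+ 2 <= (L ^+ 2 * T ^+ 2 * T ^+ 2) *
      dot m (fun z => a z - b z) (fun z => a z - b z) * dot m v v.
    apply: (le_trans (dot_cauchy_schwarz Lq LKv)).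
    have e1 := gpB_norm (V_state Va) (V_state Vb).
    rewrite stB// dotC stB// in e1; last by case: (V_KP Vab).
    have e2 := le_trans e1 (ler_wpM2l (sqr_ge0 L) (KP_norm Vab)).
    apply: (le_trans (ler_pM (dot_ge0 _ _) (dot_ge0 _ _) e2 (KP_norm Vv))).
    rewrite le_eqVlt; apply/orP; left; apply/eqP.
    move: (dot m (fun z => a z - b z) _) (dot m v v) => N M; ring.
  have h2 := dot_cauchy_schwarz Lab Lv.
  have h3 : (2 * ca * dot m (fun z => a z - b z) v) ^+ 2 <= (2 * ca) ^+ 2 *
     (dot m (fun z => a z - b z) (fun z => a z - b z) * dot m v v).
    by rewrite exprMn ler_wpM2l// sqr_ge0.
  apply: (le_trans (sqrD_le _ _)); rewrite sqrrN /K.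
  set N := dot m (fun z => a z - b z) (fun z => a z - b z) in h1 h3 *.
  set M := dot m v v in h1 h3 *.
  have -> : (2 * (L ^+ 2 * T ^+ 2 * T ^+ 2) + 2 * (2 * ca) ^+ 2) * N * M =
    2 * ((L ^+ 2 * T ^+ 2 * T ^+ 2) * N * M) + 2 * ((2 * ca) ^+ 2 * (N * M)) by ring.
  by apply: lerD; rewrite ler_pM2l.
Qed.

End price.

(** * Filtrations and immersion *)

Lemma g_sigma_mono T (G H : set (set T)) : G `<=` H -> <<s G >> `<=` <<s H >>.
Proof.
move=> GH; apply: smallest_sub; first exact: smallest_sigma_algebra.
by apply: (subset_trans GH); exact: sub_sigma_algebra.
Qed.

Section filtration_facts.
Context d (Omega : measurableType d) (R : realType) (P : probability Omega R).
Variables (W W0 : R -> {RV P >-> R}) (xi0 : {RV P >-> R}).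
Hypothesis P_complete : measure_is_complete P.

Let F := full_filtration P xi0 W W0.
Let F0 := common_filtration P W0.

(** The filtrations are generated sigma-algebras already, and [g_sigma_algebraType] generates once
    more; this removes the extra layer. *)
Lemma g_sigmaK (G : set (set Omega)) : <<s <<s G >> >> = <<s G >>.
Proof.
apply/seteqP; split; last exact: sub_sigma_algebra.
by apply: smallest_sub => //; exact: smallest_sigma_algebra.
Qed.

Lemma history_mono (X : R -> Omega -> R) s t : s <= t -> history X s `<=` history X t.
Proof.
move=> st A /historyP[r [B [/andP[r0 rs] mB ->]]]; apply/historyP.
by exists r, B; rewrite r0 (le_trans rs st).
Qed.

Lemma full_filtration_complete : complete_filtration P F.
Proof.
split.
- move=> t; rewrite /F /full_filtration g_sigmaK; apply: g_sigma_measurable.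
  rewrite !subUset; split; last by move=> A; exact: P_complete.
  split; last exact: history_measurable.
  by split; [exact: generators_measurable | exact: history_measurable].
- move=> s t st; rewrite /F /full_filtration !g_sigmaK; apply: g_sigma_mono.
  by apply: setSU; apply: setUSS; [apply: setUS|]; exact: history_mono.
- move=> t A nA; rewrite /F /full_filtration g_sigmaK.
  by apply: sub_sigma_algebra; right.
Qed.

Lemma common_filtration_complete : complete_filtration P F0.
Proof.
split.
- move=> t; rewrite /F0 /common_filtration g_sigmaK; apply: g_sigma_measurable.
  rewrite subUset; split; last by move=> A; exact: P_complete.
  exact: history_measurable.
- move=> s t st; rewrite /F0 /common_filtration !g_sigmaK; apply: g_sigma_mono.
  by apply: setSU; exact: history_mono.
- move=> t A nA; rewrite /F0 /common_filtration g_sigmaK.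
  by apply: sub_sigma_algebra; right.
Qed.

Lemma common_sub_full t : <<s F0 t >> `<=` <<s F t >>.
Proof.
rewrite /F /F0 /full_filtration /common_filtration !g_sigmaK; apply: g_sigma_mono.
by apply: setSU; exact: subsetUr.
Qed.

Lemma full_adapted_W s t : 0 <= s <= t ->
  measurable_fun setT (W s : g_sigma_algebraType (F t) -> R).
Proof.
move=> st; apply: meas_g_mono (meas_history (X := W) st).
rewrite /F /full_filtration g_sigmaK; apply: g_sigma_mono.
by move=> A hA; left; left; right.
Qed.

Lemma common_adapted_W0 s t : 0 <= s <= t ->
  measurable_fun setT (W0 s : g_sigma_algebraType (F0 t) -> R).
Proof.
move=> st; apply: meas_g_mono (meas_history (X := W0) st).
rewrite /F0 /common_filtration g_sigmaK; apply: g_sigma_mono.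
by move=> A hA; left.
Qed.

Lemma full_adapted_xi t : measurable_fun setT (xi0 : g_sigma_algebraType (F t) -> R).
Proof.
apply: meas_g_mono (@meas_generators _ _ _ xi0).
rewrite /F /full_filtration g_sigmaK; apply: g_sigma_mono.
by move=> A hA; left; left; left.
Qed.

(** Independence of [A] and [C] says that the centred indicator of [C] integrates to 0 over [A], so
    [Rint_pi_lambda] applies. *)
Lemma indep_pi (G : set (set Omega)) (C : set Omega) :
  setI_closed G -> G `<=` measurable -> measurable C ->
  (forall A, G A -> P (A `&` C) = (P A * P C)%E) ->
  forall A, <<s G >> A -> P (A `&` C) = (P A * P C)%E.
Proof.
move=> GI Gm mC GC A sA.
have sm := g_sigma_measurable Gm.
have iC : itg P (fun w => \1_C w - fine (P C)).
  by apply: itgB; [exact: itg_indic | exact: itg_cst].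
have key B : measurable B -> Rint P (fun w => \1_B w * (\1_C w - fine (P C))) =
    fine (P (B `&` C)) - fine (P C) * fine (P B).
  move=> mB; rewrite -(Rint_indic P mB) -(Rint_indic P (measurableI _ _ mB mC)).
  rewrite -RintZ; last exact: itg_indic.
  rewrite -RintB; [|by apply: itg_indic; exact: measurableI
                   |by apply: itgZ; exact: itg_indic].
  by apply: eq_Rint => w; rewrite indicI/=; ring.
have h : Rint P (fun w => \1_A w * (\1_C w - fine (P C))) = 0.
  apply: (Rint_pi_lambda GI Gm iC) => //.
    by rewrite RintB ?itg_indic ?itg_cst// Rint_indic// Rint_cst subrr.
  move=> B GB; rewrite key; last exact: Gm.
  by rewrite GC// fineM ?fin_num_measure//; [rewrite mulrC subrr | exact: Gm].
have mA := sm _ sA.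
rewrite key// in h; move/eqP : h; rewrite subr_eq0 => /eqP h.
rewrite -(fineK (fin_num_measure P _ (measurableI _ _ mA mC))) h.
by rewrite EFinM !fineK ?fin_num_measure// muleC.
Qed.

Lemma sigma_setI (G : set (set Omega)) : setI_closed <<s G >>.
Proof.
move=> A B sA sB.
by have := @measurableI _ (g_sigma_algebraType G) A B sA sB.
Qed.

Lemma sigma_setT (G : set (set Omega)) : <<s G >> setT.
Proof. by have := @measurableT _ (g_sigma_algebraType G). Qed.

Variable T : R.
Hypothesis W_indep_W0 : independent P <<s history W T >> <<s history W0 T >>.
Hypothesis xi0_indep : independent P <<s generators xi0 >>
  <<s history W T `|` history W0 T >>.

(** Intersections of an event of [xi0] with an event of [W] form a pi-system, on which the two
    independence hypotheses factor the probability in turn. Null sets are added last, on the side of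
    [W0]. *)
Lemma indep_common :
  independent P <<s generators xi0 `|` history W T >> <<s F0 T >>.
Proof.
have mhW : <<s history W T >> `<=` measurable.
  by apply: g_sigma_measurable; exact: history_measurable.
have mhW0 : <<s history W0 T >> `<=` measurable.
  by apply: g_sigma_measurable; exact: history_measurable.
have mgx : <<s generators xi0 >> `<=` measurable.
  by apply: g_sigma_measurable; exact: generators_measurable.
have subW : <<s history W T >> `<=` <<s history W T `|` history W0 T >>.
  by apply: g_sigma_mono; exact: subsetUl.
have subW0 : <<s history W0 T >> `<=` <<s history W T `|` history W0 T >>.
  by apply: g_sigma_mono; exact: subsetUr.
pose G := [set A | exists a b, [/\ <<s generators xi0 >> a, <<s history W T >> b &
  A = a `&` b]].
have GI : setI_closed G.
  move=> _ _ [a [b [sa sb ->]]] [a' [b' [sa' sb' ->]]].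
  exists (a `&` a'), (b `&` b'); split; [exact: sigma_setI|exact: sigma_setI|].
  by rewrite setIACA.
have Gm : G `<=` measurable.
  by move=> _ [a [b [sa sb ->]]]; apply: measurableI; [exact: mgx | exact: mhW].
have GsubA : <<s generators xi0 `|` history W T >> `<=` <<s G >>.
  apply: g_sigma_sub => A [gA|hA]; apply: sub_sigma_algebra.
    exists A, setT; split; [exact: sub_sigma_algebra|exact: sigma_setT|].
    by rewrite setIT.
  exists setT, A; split; [exact: sigma_setT|exact: sub_sigma_algebra|].
  by rewrite setTI.
have step1 A C : <<s generators xi0 `|` history W T >> A -> <<s history W0 T >> C ->
    P (A `&` C) = (P A * P C)%E.
  move=> /GsubA sA sC; apply: (indep_pi GI Gm _ _ sA); first exact: mhW0.
  move=> _ [a [b [sa sb ->]]].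
  rewrite -setIA xi0_indep//; last by apply: sigma_setI; [exact: subW|exact: subW0].
  by rewrite W_indep_W0// muleA xi0_indep//; exact: subW.
move=> A C sA sC.
pose H := <<s history W0 T >> `|` P.-negligible.
have HI : setI_closed H.
  move=> B B' [sB|nB] [sB'|nB'].
  - by left; exact: sigma_setI.
  - by right; apply: negligibleS nB'; exact: subIsetr.
  - by right; apply: negligibleS nB; exact: subIsetl.
  - by right; apply: negligibleS nB; exact: subIsetl.
have Hm : H `<=` measurable.
  by rewrite subUset; split=> //; move=> B; exact: P_complete.
have mA : measurable A.
  apply: g_sigma_measurable sA; rewrite subUset.
  by split; [exact: generators_measurable | exact: history_measurable].
have sH : <<s H >> C.
  move: sC; rewrite /F0 /common_filtration g_sigmaK; apply: g_sigma_mono.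
  by apply: setSU; exact: sub_sigma_algebra.
rewrite setIC muleC; apply: (indep_pi HI Hm mA _ sH) => B [sB|nB].
  by rewrite setIC muleC; exact: step1.
have PB0 : P B = 0%E by apply/negligibleP => //; exact: P_complete.
rewrite PB0 mul0e; apply/negligibleP.
  by apply: measurableI => //; exact: P_complete.
by apply: negligibleS nB; exact: subIsetl.
Qed.

(** On an intersection of [C], an event of [xi0] and the path of [W], with [B] in F0_s, the integral
    factors as [P C] times the integral of [D] over [B], which is 0. Such sets form a pi-system
    whose sigma-algebra contains F_s. *)
Lemma immersion (D : Omega -> R) s : 0 <= s <= T -> L2 P D ->
  measurable_fun setT (D : g_sigma_algebraType (F0 T) -> R) ->
  (forall A, <<s F0 s >> A -> Rint P (fun w => \1_A w * D w) = 0) ->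
  forall A, <<s F s >> A -> Rint P (fun w => \1_A w * D w) = 0.
Proof.
move=> /andP[s0 sT] LD mD D0 A sA.
have fc := common_filtration_complete.
have mB B : <<s F0 s >> B -> measurable B by move=> sB; exact: (fil_meas fc sB).
have mfull : <<s generators xi0 `|` history W T >> `<=` measurable.
  apply: g_sigma_measurable; rewrite subUset.
  by split; [exact: generators_measurable | exact: history_measurable].
pose G := [set A | exists B C, [/\ <<s F0 s >> B,
  <<s generators xi0 `|` history W T >> C & A = C `&` B]].
have GI : setI_closed G.
  move=> _ _ [a [b [sa sb ->]]] [a' [b' [sa' sb' ->]]].
  exists (a `&` a'), (b `&` b'); split; [exact: sigma_setI|exact: sigma_setI|].
  by rewrite setIACA.
have Gm : G `<=` measurable.
  by move=> _ [B [C [sB sC ->]]]; apply: measurableI; [exact: mfull | exact: mB].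
have iD := L2_itg LD.
have RD0 : Rint P D = 0.
  rewrite -(D0 setT (@sigma_setT _)); apply: eq_Rint => w.
  by rewrite indicE in_setT mul1r.
apply: (Rint_pi_lambda GI Gm iD RD0); last first.
  move: A sA; rewrite /F /full_filtration g_sigmaK.
  apply: g_sigma_sub => A sA; apply: sub_sigma_algebra.
  case: sA => [[[gA|hA]|hA]|nA].
  - exists setT, A; rewrite setIT; split=> //; first exact: sigma_setT.
    by apply: sub_sigma_algebra; left.
  - exists setT, A; rewrite setIT; split=> //; first exact: sigma_setT.
    by apply: sub_sigma_algebra; right; exact: history_mono hA.
  - exists A, setT; rewrite setTI; split=> //; last exact: sigma_setT.
    rewrite /F0 /common_filtration g_sigmaK.
    by apply: sub_sigma_algebra; left.
  - exists A, setT; rewrite setTI; split=> //; last exact: sigma_setT.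
    exact: (fil_null fc).
move=> _ [B [C [sB sC ->]]].
have LBD : L2 P (fun w => \1_B w * D w) by apply: L2_indic_mul => //; exact: mB.
rewrite (_ : (fun w => _) = fun w => \1_C w * (\1_B w * D w)); last first.
  by apply/funext => w; rewrite indicI/= mulrA.
have mC : measurable_fun setT
    (\1_C : g_sigma_algebraType (generators xi0 `|` history W T) -> R).
  exact: measurable_indic.
have mBD : measurable_fun setT
    ((fun w => \1_B w * D w) : g_sigma_algebraType (F0 T) -> R).
  apply: measurable_funM => //; apply: measurable_indic.
  exact: (fil_mono fc sT).
have LC : L2 P (\1_C : Omega -> R).
  by apply: L2_indic; [exact: mfull | apply: itg_indic; exact: mfull].
rewrite (indep_Rint mfull (fil_meas fc (t := T)) indep_common mC mBD LC LBD).
by rewrite D0// mulr0.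
Qed.

End filtration_facts.

(** * Primitives, their increments, and martingales of finite energy *)

Section increments.
Context (R : realType).
Local Notation leb := (@lebesgue_measure R).
Local Notation TR := (measurableTypeR R).
Implicit Types y : R -> R.

Lemma ind_oc (s t r : R) : \1_(`]s, t]%classic) r = (if s < r <= t then 1 else 0) :> R.
Proof.
rewrite indicE; case: ifPn => h; first by rewrite mem_set//= in_itv.
by rewrite memNset//= in_itv/=; exact/negP.
Qed.

Lemma itg_oc (s t : R) : itg leb (\1_(`]s, t]%classic) : R -> R).
Proof. by have := @integrable_indic_itv R s t false false. Qed.

Lemma Rint_oc (s t : R) : s <= t -> Rint leb (\1_(`]s, t]%classic) : R -> R) = t - s.
Proof.
move=> st; apply: EFin_inj; rewrite RintE; last exact: itg_oc.
rewrite integral_indic// setIT; apply: (etrans (@lebesgue_measure_itv R `]s, t])).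
by rewrite /= lte_fin; case: ltgtP st => // -> _; rewrite subrr.
Qed.

Lemma itg_oc_mul (s t : R) y : itg leb y -> itg leb (fun r => \1_(`]s, t]%classic) r * y r).
Proof. by apply: itg_indic_mul; exact: measurable_itv. Qed.

Lemma Kp0_increment (s t : R) y : 0 <= s <= t -> itg leb y ->
  Kp 0 y t = Kp 0 y s + Rint leb (fun r => \1_(`]s, t]%classic) r * y r).
Proof.
move=> /andP[s0 st] iy; rewrite /Kp -RintD; [|exact: itg_kern|exact: itg_oc_mul].
apply: eq_Rint => r; rewrite !kern0E ind_oc !ind_itv.
have [r0|r0]/= := leP 0 r; last first.
  by rewrite ltNge (le_trans (ltW r0) s0)/= !mul0r addr0.
have [rs|rs]/= := leP r s; first by rewrite (le_trans rs st) mul0r addr0.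
by rewrite mul0r add0r.
Qed.

Lemma Kp0_0 y : Kp 0 y 0 = 0.
Proof. by rewrite Kp0E set_itv1 Rintegral_set1. Qed.

Lemma L2_oc (s t : R) : L2 leb (\1_(`]s, t]%classic) : R -> R).
Proof. by apply: L2_indic; [exact: measurable_itv | exact: itg_oc]. Qed.

Lemma sqr_increment_le (s t : R) y : s <= t -> L2 leb y ->
  Rint leb (fun r => \1_(`]s, t]%classic) r * y r) ^+ 2 <=
  (t - s) * Rint leb (fun r => \1_(`]s, t]%classic) r * y r ^+ 2).
Proof.
move=> st Ly; pose h : R -> R := \1_(`]s, t]%classic).
have hh r : h r * h r = h r by rewrite /h ind_oc; case: ifP; rewrite ?mulr1 ?mulr0.
have Lh : L2 leb h by exact: L2_oc.
have Lhy : L2 leb (fun r => h r * y r) by apply: L2_indic_mul => //; exact: measurable_itv.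
have := dot_cauchy_schwarz Lh Lhy.
have -> : dot leb h (fun r => h r * y r) = Rint leb (fun r => h r * y r).
  by apply: eq_Rint => r; rewrite mulrA hh.
have -> : dot leb h h = t - s by rewrite -(Rint_oc st); apply: eq_Rint => r; rewrite hh.
suff -> : dot leb (fun r => h r * y r) (fun r => h r * y r) =
    Rint leb (fun r => h r * y r ^+ 2) by [].
by apply: eq_Rint => r; rewrite mulrACA hh expr2.
Qed.

(** A vanishing primitive makes [y] integrate to 0 over every ray, hence over every Borel set; then
    [Rint_vanish] tests [y] against itself. *)
Lemma Kp0_eq0 (T : R) y : itg leb y -> L2 leb y ->
  (forall s, ~ (0 <= s <= T) -> y s = 0) ->
  0 <= T -> (forall t, 0 <= t <= T -> Kp 0 y t = 0) ->
  Rint leb (fun s => y s ^+ 2) = 0.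
Proof.
move=> iy Ly ys T0 Ky; have [my iy2] := Ly.
have tot : Rint leb y = 0.
  rewrite -(Ky T) ?lexx ?T0//; apply: eq_Rint => s; rewrite kern0E ind_itv.
  by case: ifPn => [_|/negP/ys ->]; rewrite ?mul1r ?mulr0.
have GE : @measurable _ TR = <<s @RGenOInfty.G R >>.
  exact: (@RGenOInfty.measurableE R).
have Gm : (@RGenOInfty.G R) `<=` @measurable _ TR.
  by rewrite GE; exact: sub_sigma_algebra.
have GI : setI_closed (@RGenOInfty.G R).
  move=> _ _ [a ->] [b ->]; exists (Num.max a b).
  by apply/seteqP; split => x /=; rewrite !in_itv/= !andbT gt_max => /andP.
have key (A : set R) : <<s @RGenOInfty.G R >> A -> Rint leb (fun s => \1_A s * y s) = 0.
  move=> sA; apply: (Rint_pi_lambda (mu := leb) GI Gm iy tot _ sA) => {A sA} _ [x ->].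
  have indE s : \1_(`]x, +oo[%classic) s = (if x < s then 1 else 0) :> R.
    rewrite indicE; case: ifPn => h; first by rewrite mem_set//= in_itv/= andbT.
    by rewrite memNset//= in_itv/= andbT; exact/negP.
  have [x0|x0] := ltP x 0.
    rewrite -[RHS]tot; apply: eq_Rint => s; rewrite indE; case: ifPn; first by rewrite mul1r.
    rewrite -leNgt => sx; rewrite mul0r ys// => /andP[s0 _].
    by have := le_lt_trans (le_trans s0 sx) x0; rewrite ltxx.
  have [xT|xT] := leP x T; last first.
    rewrite -[RHS](Rint0 leb); apply: eq_Rint => s; rewrite indE; case: ifPn; last by rewrite mul0r.
    move=> xs; rewrite mul1r ys// => /andP[_ sT].
    by have := lt_trans xT (lt_le_trans xs sT); rewrite ltxx.
  rewrite -[RHS]tot -[RHS]subr0 -(Ky x) ?x0// /Kp -RintB//; last exact: itg_kern.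
  apply: eq_Rint => s; rewrite indE kern0E ind_itv.
  have [s0|s0] := ltP s 0.
    by rewrite ys ?mulr0 ?subr0// => /andP[/le_lt_trans/(_ s0)]; rewrite ltxx.
  by rewrite leNgt; case: ifP => _ /=; rewrite ?mul0r ?mul1r ?subr0 ?subrr.
have mY : measurable_fun setT (y : g_sigma_algebraType (@RGenOInfty.G R) -> R).
  move=> _ B mB; rewrite setTI.
  have := my measurableT B mB; rewrite setTI => h.
  suff : <<s @RGenOInfty.G R >> (y @^-1` B) by [].
  by rewrite -GE.
have := @Rint_vanish _ TR _ leb (@RGenOInfty.G R) y y.
rewrite -GE => /(_ (fun A h => h) iy) h.
by rewrite -(dot_sqr leb y); apply: h; [rewrite GE; exact: key | exact: mY | exact: itg_dot].
Qed.

End increments.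

Section martingale.
Context d (Omega : measurableType d) (R : realType) (P : probability Omega R).
Variables (T : R) (F : R -> set (set Omega)).
Hypothesis T0 : 0 < T.
Hypothesis fil : complete_filtration P F.
Local Notation leb := (@lebesgue_measure R).
Local Notation TR := (measurableTypeR R).
Local Notation m := (leb \x P)%E.
Local Notation V := (V P T F).

(** Progressive when [A] is known at time [s]. Orthogonality to all such indicators says that the
    primitive is a martingale. *)
Definition rect (s t : R) (A : set Omega) (z : R * Omega) : R :=
  \1_(`]s, t]%classic) z.1 * \1_A z.2.

Definition increment (f : R * Omega -> R) (s t : R) (w : Omega) : R :=
  Rint leb (fun r => \1_(`]s, t]%classic) r * f (r, w)).

Lemma measurable_increment d' (Omega' : measurableType d') (f : R * Omega' -> R) s t :
  measurable_fun setT (f : TR * Omega' -> R) ->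
  measurable_fun setT (fun w => Rint leb (fun r => \1_(`]s, t]%classic) r * f (r, w))).
Proof.
move=> mf; apply: (measurable_Rint_time (f := fun z => \1_(`]s, t]%classic) z.1 * f z)).
by apply: measurable_funM => //; exact: measurable_fst_itv.
Qed.

Lemma measurable_rect s t A : measurable A ->
  measurable_fun setT (rect s t A : TR * Omega -> R).
Proof.
move=> mA; apply: measurable_funM.
  exact: measurable_fst_itv.
have mA' : measurable_fun setT (\1_A : Omega -> R) by exact: measurable_indic.
by apply: (measurableT_comp mA'); exact: measurable_snd.
Qed.

Lemma rect01 s t A z : 0 <= rect s t A z <= \1_(`]s, t]%classic) z.1.
Proof.
rewrite /rect ind_oc [\1_A _]indicE.
by case: ifP => _; case: (_ \in A); rewrite ?mulr1 ?mulr0 ?ler01 ?lexx.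
Qed.

Lemma V_rect s t A : 0 <= s <= t -> t <= T -> <<s F s >> A -> V (rect s t A).
Proof.
move=> /andP[s0 st] tT sA; have mA := fil_meas fil sA; split.
- move=> [r w]/= nr; rewrite /rect ind_oc; case: ifP => [/andP[sr rt]|]; last by rewrite mul0r.
  by case: nr; rewrite (le_trans s0 (ltW sr)) (le_trans rt tT).
- move=> r /andP[r0 rT]; have [rs|sr] := leP r s.
    rewrite (_ : (fun z : TR * g_sigma_algebraType (F r) => _) = fun=> 0); first by [].
    apply/funext => -[q w]; rewrite /rect ind_itv ind_oc/=.
    case: ifP => [/andP[_ qr]|_]; last by rewrite mul0r.
    by rewrite ltNge (le_trans qr rs)/= mul0r mulr0.
  apply: measurable_funM.
    exact: measurable_fst_itv.
  apply: measurable_funM.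
    exact: measurable_fst_itv.
  have mA' : measurable_fun setT (\1_A : g_sigma_algebraType (F r) -> R).
    by apply: measurable_indic; exact: (fil_mono fil (ltW sr)).
  by apply: (measurableT_comp mA'); exact: measurable_snd.
- apply: (L2_le (g := fun z : TR * Omega => \1_(`[0, T]%classic) z.1)).
  + exact: measurable_rect.
  + move=> z; have /andP[h0 h1] := rect01 s t A z.
    rewrite ger0_norm// (le_trans h1)// ind_oc ind_itv.
    case: ifP => [/andP[sr rt]|_]; last by case: ifP.
    by rewrite (le_trans s0 (ltW sr)) (le_trans rt tT).
  + exact: L2_ind.
Qed.

Lemma itg_rect f s t A : L2 m f -> measurable A -> itg m f ->
  itg m (fun z => f z * rect s t A z).
Proof.
move=> [mf _] mA fi; apply: itg_le (itg_norm fi).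
  by apply: measurable_funM => //; exact: measurable_rect.
move=> z; rewrite normrM ler_piMr//; have /andP[h0 h1] := rect01 s t A z.
by rewrite ger0_norm// (le_trans h1)// ind_oc; case: ifP.
Qed.

Lemma dot_rect f s t A : L2 m f -> itg m f -> measurable A ->
  dot m f (rect s t A) = Rint P (fun w => \1_A w * increment f s t w).
Proof.
move=> Lf fi mA; have [mf _] := Lf.
have [_ [h e]] := itg_fubini2 (itg_rect s t Lf mA fi).
rewrite /dot [LHS]e.
have [ae_f _] := itg_fubini2 fi.
have minc : measurable_fun setT (increment f s t) by exact: measurable_increment.
apply: Rint_ae; first exact: itg_meas h.
  by apply: measurable_funM => //; exact: measurable_indic.
apply: filterS ae_f => w iw; rewrite -RintZ; last exact: itg_oc_mul.
by apply: eq_Rint => r; rewrite /rect/=; ring.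
Qed.

Definition energy (f : R * Omega -> R) (s t : R) : R :=
  Rint m (fun z => \1_(`]s, t]%classic) z.1 * f z ^+ 2).

Lemma itg_energy f s t : L2 m f -> itg m (fun z => \1_(`]s, t]%classic) z.1 * f z ^+ 2).
Proof.
move=> [mf if2]; apply: itg_le if2.
  apply: measurable_funM; last exact: measurable_funX.
  exact: measurable_fst_itv.
move=> z; rewrite normrM (ger0_norm (sqr_ge0 _)) ler_piMl ?sqr_ge0//.
by rewrite ind_oc; case: ifP; rewrite ?normr1 ?normr0.
Qed.

(** Cauchy-Schwarz in time. The factor [t - s] is what makes the sum of squared increments small
    along a fine partition. *)
Lemma L2_increment f s t : L2 m f -> itg m f -> s <= t ->
  measurable_fun setT (increment f s t) ->
  L2 P (increment f s t) /\
  Rint P (fun w => increment f s t w ^+ 2) <= (t - s) * energy f s t.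
Proof.
move=> Lf fi st minc; have [mf if2] := Lf.
have [a1 _] := itg_fubini2 fi; have [a2 _] := itg_fubini2 if2.
have [_ [ie eE]] := itg_fubini2 (itg_energy s t Lf).
have le_inc : {ae P, forall w, `|increment f s t w ^+ 2| <=
    (t - s) * Rint leb (fun r => \1_(`]s, t]%classic) r * f (r, w) ^+ 2)}.
  apply: filterS2 a1 a2 => w i1 i2; rewrite ger0_norm ?sqr_ge0//.
  apply: sqr_increment_le => //; split=> //; exact: itg_meas i1.
have ie' := itgZ (t - s) ie.
have i2 : itg P (fun w => increment f s t w ^+ 2).
  by apply: itg_le_ae le_inc ie'; exact: measurable_funX.
split=> //; rewrite /energy eE -(RintZ (t - s) ie).
apply: le_Rint_ae i2 ie' _; apply: filterS le_inc => w; apply: le_trans.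
exact: ler_norm.
Qed.

(* The primitive of g is a martingale with paths of finite energy, hence
   constant: its second moment at time t is at most (t / n) times the energy
   of g, by orthogonality of its increments over n equal steps. *)
Lemma martingale_eq0 g : V g ->
  (forall s t A, 0 <= s <= t -> t <= T -> <<s F s>> A -> dot m g (rect s t A) = 0) ->
  {ae m, forall z, g z = 0}.
Proof.
move=> Vg dg0; have [sg pg Lg] := Vg; have gi := V_itg Vg; have [mg ig2] := Lg.
have S2K := S2_KP T0 (lexx 0) Vg; have [_ pK cK _] := S2K.
pose G t w := KP T 0 g (t, w).
have GE t w : 0 <= t <= T -> G t w = Kp 0 (fun s => g (s, w)) t.
  by move=> tT; rewrite /G /KP ind_itv/= tT mul1r.
have aeg := V_paths Vg.
have Gstep s t : 0 <= s <= t -> t <= T ->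
    {ae P, forall w, G t w = G s w + increment g s t w}.
  move=> st tT; have /andP[s0 st'] := st.
  apply: filterS aeg => w [_ iw]; rewrite !GE ?s0 ?(le_trans s0 st') ?(le_trans st')//.
  exact: Kp0_increment.
have mginc s t : measurable_fun setT (increment g s t).
  exact: (measurable_increment s t (prog_meas T0 fil pg sg)).
have LG t : 0 <= t <= T -> L2 P (G t) by exact: (S2_section fil).
(* The cross term vanishes because [G s] is F_s-measurable and the increment integrates to 0 over
   the sets of F_s. *)
have phiS s t : 0 <= s <= t -> t <= T ->
    Rint P (fun w => G t w ^+ 2) <= Rint P (fun w => G s w ^+ 2) + (t - s) * energy g s t.
  move=> st tT; have /andP[s0 st'] := st.
  have sT : 0 <= s <= T by rewrite s0 (le_trans st').
  have tT' : 0 <= t <= T by rewrite tT (le_trans s0).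
  have [Li le_i] := L2_increment Lg gi st' (mginc s t).
  have [mGs Gs2] := LG _ sT; have [mGt Gt2] := LG _ tT'.
  have iGi := itg_dot (LG _ sT) Li.
  have orth : Rint P (fun w => G s w * increment g s t w) = 0.
    apply: (@Rint_vanish _ _ _ P (F s)) => //.
    - exact: (fil_meas fil).
    - exact: L2_itg.
    - move=> A sA; rewrite -dot_rect//; first exact: dg0.
      exact: (fil_meas fil sA).
    - exact: (prog_adapted pK sT).
  have -> : Rint P (fun w => G t w ^+ 2) = Rint P (fun w => G s w ^+ 2 +
      (2 * (G s w * increment g s t w) + increment g s t w ^+ 2)).
    have iR : itg P (fun w => G s w ^+ 2 +
      (2 * (G s w * increment g s t w) + increment g s t w ^+ 2)).
      by apply: itgD => //; apply: itgD; [exact: itgZ | case: Li].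
    apply: Rint_ae; [exact: measurable_funX | exact: itg_meas iR |].
    by apply: filterS (Gstep _ _ st tT) => w ->; ring.
  have i2 : itg P (fun w => increment g s t w ^+ 2) by case: Li.
  rewrite RintD//; last by apply: itgD => //; exact: itgZ.
  rewrite RintD//; last exact: itgZ.
  by rewrite RintZ// orth mulr0 add0r lerD2l.
have eng_add s t u : s <= t -> t <= u ->
    energy g s t + energy g t u = energy g s u.
  move=> st tu; rewrite /energy -RintD; [|exact: itg_energy..].
  apply: eq_Rint => z; rewrite -mulrDl; congr (_ * _); rewrite !ind_oc.
  have [zt|tz] := leP z.1 t; first by rewrite (le_trans zt tu) !andbT addr0.
  by rewrite (le_lt_trans st tz)/= add0r.
have phi0 t : 0 <= t <= T -> Rint P (fun w => G t w ^+ 2) = 0.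
  move=> /andP[t0 tT].
  have eng0 s u : 0 <= energy g s u.
    by apply: Rint_ge0 => z; apply: mulr_ge0; [rewrite indicE ler0n | exact: sqr_ge0].
  have main n : Rint P (fun w => G t w ^+ 2) <= t / n.+1%:R * energy g 0 t.
    pose u k : R := t / n.+1%:R * k%:R.
    have h0 : 0 <= t / n.+1%:R by rewrite divr_ge0.
    have u0 k : 0 <= u k by rewrite mulr_ge0.
    have uS k : u k.+1 = u k + t / n.+1%:R by rewrite /u -[k.+1%:R]natr1 mulrDr mulr1.
    have un : u n.+1 = t by rewrite /u divfK// pnatr_eq0.
    have ule k : (k <= n.+1)%N -> u k <= t.
      by move=> kn; rewrite -un ler_wpM2l// ler_nat.
    suff : forall k, (k <= n.+1)%N ->
        Rint P (fun w => G (u k) w ^+ 2) <= t / n.+1%:R * energy g 0 (u k).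
      by move=> /(_ n.+1 (leqnn _)); rewrite un.
    elim=> [|k IH] kn.
      rewrite /u mulr0; under eq_Rint do rewrite GE ?lexx ?ltW// Kp0_0 expr0n/=.
      by rewrite Rint0 mulr_ge0.
    have uk : 0 <= u k <= u k.+1 by rewrite u0 uS lerDl.
    apply: (le_trans (phiS _ _ uk (le_trans (ule _ kn) tT))).
    have /andP[_ uk'] := uk.
    rewrite -(eng_add _ _ _ (u0 k) uk') mulrDr [u k.+1 - _](_ : _ = t / n.+1%:R).
      by rewrite lerD2r IH// ltnW.
    by rewrite uS addrC addKr.
  apply/eqP; rewrite eq_le Rint_ge0 ?andbT; last by move=> w; exact: sqr_ge0.
  apply/ler_addgt0Pl => e e0; rewrite addr0.
  have [c0|c0] := leP (t * energy g 0 t) 0.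
    apply: (le_trans (main 0%N)); rewrite divr1 (le_trans c0)// ltW//.
  have ec : 0 < e / (t * energy g 0 t) by rewrite divr_gt0.
  have [n _ /(_ n (leqnn _)) hn] := near_infty_natSinv_lt (PosNum ec).
  apply: (le_trans (main n)); rewrite mulrAC -ler_pdivlMl//.
  by rewrite mulrC ltW.
(* The grid times are countable, so one null set serves them all; path continuity later extends
   [G = 0] to every time. *)
have aeG : {ae P, forall w, forall n k,
    0 <= T * k%:R / n.+1%:R <= T -> G (T * k%:R / n.+1%:R) w = 0}.
  apply/ae_foralln => n; apply/ae_foralln => k.
  have [tT|nt] := pselect (0 <= T * k%:R / n.+1%:R <= T); last by apply: aeW => w /nt.
  have [_ Gt2] := LG _ tT.
  apply: filterS (Rint_eq0_ae Gt2 (fun w => sqr_ge0 _) (phi0 _ tT)) => w.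
  by move=> /eqP; rewrite sqrf_eq0 => /eqP.
have : Rint m (fun z => g z ^+ 2) = 0.
  have [_ [_ ->]] := itg_fubini2 ig2.
  rewrite -(Rint0 P); apply: Rint_ae.
  - by have [_ [h _]] := itg_fubini2 ig2; exact: itg_meas h.
  - exact: measurable_cst.
  - apply: filterS3 aeg aeG cK => w [Lw iw] Gw cw.
    apply: (Kp0_eq0 (T := T)) => //; [by move=> s ns; exact: sg|exact: ltW|].
    move=> t tT; have /andP[t0 tT'] := tT; rewrite -GE//.
    have gT n : 0 <= grid T n t <= T.
      by have /andP[g0 g1] := grid_itv n T0 t0; rewrite g0 (le_trans g1).
    have c1 := within_cvg_seq cw tT gT (grid_cvg T0 t0).
    have c0 : (fun n => G (grid T n t) w) = fun=> 0.
      by apply/funext => n; exact: (Gw n (Num.trunc (n.+1%:R * t / T)) (gT n)).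
    have {}c1 : (fun n => G (grid T n t) w) @ \oo --> G t w by exact: c1.
    rewrite c0 in c1; exact: (cvg_unique (@Rhausdorff R) c1 (cvg_cst _)).
rewrite -(dot_sqr m g); exact: dot_eq0_ae.
Qed.

End martingale.

(** * From the common filtration to the full one *)

Section full_orthogonality.
Context d (Omega : measurableType d) (R : realType) (P : probability Omega R).
Variables (W W0 : R -> {RV P >-> R}) (xi0 : {RV P >-> R}) (T : R).
Hypothesis P_complete : measure_is_complete P.
Hypothesis T0 : 0 < T.
Hypothesis W_indep_W0 : independent P <<s history W T >> <<s history W0 T >>.
Hypothesis xi0_indep : independent P <<s generators xi0 >>
  <<s history W T `|` history W0 T >>.
Local Notation leb := (@lebesgue_measure R).
Local Notation TR := (measurableTypeR R).
Local Notation m := (leb \x P)%E.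

Let F := full_filtration P xi0 W W0.
Let F0 := common_filtration P W0.
Let filF : complete_filtration P F.
Proof. exact: full_filtration_complete. Qed.
Let filF0 : complete_filtration P F0.
Proof. exact: common_filtration_complete. Qed.

Lemma prog_common_full f : prog T F0 f -> prog T F f.
Proof.
by move=> pf t tT; apply: meas_prod_mono (pf t tT); exact: common_sub_full.
Qed.

Lemma V_common_full f : V P T F0 f -> V P T F f.
Proof. by move=> [sf pf Lf]; split=> //; exact: prog_common_full. Qed.

Lemma S2_common_full f : S2 P T F0 f -> S2 P T F f.
Proof. by move=> [sf pf cf df]; split=> //; exact: prog_common_full. Qed.

(** Only F0_T-measurability is asked of [k], because the gradient anticipates. [martingale_eq0] is
    applied to the projection of [k], as it concerns progressive processes; on each [rect s t A] the
    projection can be exchanged for [k], to which [immersion] applies. *)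
Lemma full_orthogonal k : supp T k -> L2 m k ->
  measurable_fun setT (k : TR * g_sigma_algebraType (F0 T) -> R) ->
  (forall b, V P T F0 b -> dot m k b = 0) ->
  forall v, V P T F v -> dot m k v = 0.
Proof.
move=> sk Lk mk dk0; have [mk' _] := Lk.
have ik : itg m k.
  apply: (eq_itg (f := fun z : TR * Omega => \1_(`[0, T]%classic) z.1 * k z)).
    by move=> z; rewrite supp_ind.
  exact: itg_dot (L2_ind P T) Lk.
have [g Vg dg] := projection (semi_inner_L2 m) (V_subspace P T F)
  (@V_complete _ _ _ P T F) Lk.
have [sg pg Lg] := Vg; have [mg _] := Lg.
have dkg v : V P T F v -> dot m k v = dot m g v.
  move=> Vv; have [_ _ Lv] := Vv; apply/eqP; rewrite -subr_eq0 -dotBl//.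
  by apply/eqP; exact: dg.
have g0 : {ae m, forall z, g z = 0}.
  apply: (martingale_eq0 T0 filF Vg) => s t A st tT sA.
  have /andP[s0 st'] := st.
  rewrite -dkg; last exact: V_rect.
  have mA := fil_meas filF sA.
  rewrite dot_rect//.
  have minc : measurable_fun setT
      (increment k s t : g_sigma_algebraType (F0 T) -> R).
    exact: (measurable_increment s t mk).
  have mincP : measurable_fun setT (increment k s t).
    exact: meas_g_sub (fil_meas filF0 (t := T)) minc.
  apply: (immersion P_complete W_indep_W0 xi0_indep _ _ minc _ sA).
  - by rewrite s0 (le_trans st').
  - by have [] := L2_increment Lk ik st' mincP.
  - move=> B sB; rewrite -dot_rect//; last exact: (fil_meas filF0 sB).
    by apply: dk0; exact: V_rect.
move=> v Vv; have [_ _ [mv _]] := Vv.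
rewrite dkg// (dot_ae (f' := fun=> 0) mg _ mv g0)//.
by rewrite /dot -[RHS](Rint0 m); apply: eq_Rint => z; rewrite mul0r.
Qed.

End full_orthogonality.

(** * State processes *)

Section linear_equation.
Context (R : realType).
Local Notation leb := (@lebesgue_measure R).
Local Notation TR := (measurableTypeR R).
Implicit Types y z a : R -> R.

Lemma ode_solution (delta t : R) z a : 0 <= delta -> itg leb z -> itg leb a ->
  let x := fun s => z s - delta * Kp delta z s + Kp delta a s in
  x t = z t + Kp 0 (fun s => - delta * x s + a s) t.
Proof.
move=> d0 iz ia x; pose q s := a s - delta * z s.
have iq : itg leb q by apply: itgB => //; exact: itgZ.
have qE s : Kp delta q s = Kp delta a s - delta * Kp delta z s.
  rewrite /q -KpZ// -mulN1r -KpZ//; last exact: itgZ.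
  rewrite -KpD//; last by apply: itgZ; exact: itgZ.
  by apply: eq_Rint => r; rewrite mulN1r.
have -> : (fun s => - delta * x s + a s) = fun s => q s - delta * Kp delta q s.
  by apply/funext => s; rewrite qE /x /q; ring.
by rewrite Kp0_resolvent// qE /x; ring.
Qed.

(** The difference from the explicit solution, cut to [[0, T]], solves the homogeneous equation of
    [linear_ode_unique]. *)
Lemma ode_unique (delta T : R) y z a : 0 <= delta -> itg leb z -> itg leb a ->
  itg leb (fun s => \1_(`[0, T]%classic) s * y s) ->
  (forall t, 0 <= t <= T -> y t = z t + Kp 0 (fun s => - delta * y s + a s) t) ->
  forall t, 0 <= t <= T -> y t = z t - delta * Kp delta z t + Kp delta a t.
Proof.
move=> d0 iz ia iy yE.
pose I : R -> R := \1_(`[0, T]%classic).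
pose x t := z t - delta * Kp delta z t + Kp delta a t.
have xE t : x t = z t + Kp 0 (fun s => - delta * x s + a s) t by exact: ode_solution.
have ix : itg leb (fun s => I s * x s).
  have mI : measurable (`[0, T]%classic : set TR) by exact: measurable_itv.
  have iK b : itg leb b -> itg leb (fun s => I s * Kp delta b s).
    move=> ib; apply: (itg_le (g := fun s : TR => Rint leb (fun r => `|b r|) * I s)).
    - by apply: measurable_funM; [exact: measurable_indic | apply: measurable_Kp_path; exact: itg_meas ib].
    - move=> s; rewrite normrM /I ind_itv; case: ifP => _.
        by rewrite normr1 mul1r mulr1; exact: Kp_norm.
      by rewrite normr0 mul0r mulr0.
    - by apply: itgZ; exact: itg_itv.
  apply: (eq_itg (f := fun s : TR => I s * z s - delta * (I s * Kp delta z s) + I s * Kp delta a s)).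
    by move=> s; rewrite /x; ring.
  apply: itgD; last exact: iK.
  by apply: itgB; [exact: itg_indic_mul | apply: itgZ; exact: iK].
pose D s := I s * y s - I s * x s.
have iD : itg leb D by exact: itgB.
have D0 : forall t, 0 <= t <= T -> D t = 0.
  apply: (linear_ode_unique d0 iD) => t tT; have /andP[t0 tT'] := tT.
  rewrite /D /I ind_itv tT !mul1r yE// [X in _ - X]xE opprD addrACA subrr add0r.
  have cutK b : itg leb (fun s => I s * b s) -> Kp 0 (fun s => - delta * b s + a s) t =
      - delta * Kp 0 (fun s => I s * b s) t + Kp 0 a t.
    move=> ib; rewrite -KpZ// -KpD//; last exact: itgZ.
    by apply: eq_Kp => s /andP[s0 st]; rewrite /I ind_itv s0 (le_trans st tT') mul1r.
  rewrite !cutK// /D.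
  have -> : Kp 0 (fun s => I s * y s - I s * x s) t =
      Kp 0 (fun s => I s * y s) t - Kp 0 (fun s => I s * x s) t.
    rewrite -[X in _ - X]mul1r -mulNr -KpZ// -KpD//; last exact: itgZ.
    by apply: eq_Rint => s; rewrite mulN1r.
  by ring.
move=> t tT; have := D0 t tT; rewrite /D /I ind_itv tT !mul1r => /eqP.
by rewrite subr_eq0 => /eqP.
Qed.

End linear_equation.

Section states.
Context d (Omega : measurableType d) (R : realType) (P : probability Omega R).
Variables (W W0 : R -> {RV P >-> R}) (xi0 : {RV P >-> R}) (T delta sigma sigma0 : R).
Hypothesis P_complete : measure_is_complete P.
Hypotheses (T0 : 0 < T) (delta0 : 0 <= delta).
Local Notation leb := (@lebesgue_measure R).
Local Notation TR := (measurableTypeR R).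
Local Notation m := (leb \x P)%E.

Let F := full_filtration P xi0 W W0.
Let filF : complete_filtration P F.
Proof. exact: full_filtration_complete. Qed.

(** The state under zero control. Controls enter additively through [KP], so differences of states
    depend on the controls alone. *)
Definition free_state (zeta : R * Omega -> R) (z : R * Omega) : R :=
  zeta z - delta * KP T delta zeta z.

Lemma S2_free_state G zeta : complete_filtration P G -> S2 P T G zeta ->
  S2 P T G (free_state zeta).
Proof.
move=> filG Sz; apply: S2B => //; apply: S2Z; apply: S2_KP => //.
exact: (S2_V T0 filG).
Qed.

Variable zeta : R * Omega -> R.
Hypothesis S2_zeta : S2 P T F zeta.
Hypothesis zetaE : {ae P, forall w t, 0 <= t <= T ->
  zeta (t, w) = xi0 w + sigma * W t w + sigma0 * W0 t w}.

Local Notation st := (state T delta (free_state zeta)).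

Let S2_st a : V P T F a -> S2 P T F (st a).
Proof.
by move=> Va; apply: S2D; [exact: S2_free_state | exact: S2_KP].
Qed.

Lemma stE a t w : 0 <= t <= T -> st a (t, w) =
  zeta (t, w) - delta * Kp delta (fun s => zeta (s, w)) t + Kp delta (fun s => a (s, w)) t.
Proof. by move=> tT; rewrite /state /free_state /KP ind_itv/= tT !mul1r. Qed.

Lemma state_exists a : V P T F a ->
  is_state P T W W0 xi0 delta sigma sigma0 (fun t w => a (t, w)) (fun t w => st a (t, w)).
Proof.
move=> Va; have [_ pst cst _] := S2_st Va; split=> //.
  exact/progressiveP.
have aez := V_paths (S2_V T0 filF S2_zeta); have aea := V_paths Va.
apply: filterS3 zetaE aez aea => w zE [_ iz] [_ ia] t; rewrite in_itv/= => tT.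
rewrite stE// -Kp0E.
have -> : Kp 0 (fun s => - delta * st a (s, w) + a (s, w)) t =
    Kp 0 (fun s => - delta * (zeta (s, w) - delta * Kp delta (fun s => zeta (s, w)) s
      + Kp delta (fun s => a (s, w)) s) + a (s, w)) t.
  apply: eq_Kp => s /andP[s0 st']; rewrite stE// s0 (le_trans st')//.
  by case/andP: tT.
have /= -> := ode_solution t delta0 iz ia.
by rewrite zE// addrAC; congr (_ + _); rewrite addrAC.
Qed.

Lemma state_unique b Y : V P T F (cut T b) ->
  is_state P T W W0 xi0 delta sigma sigma0 b Y ->
  {ae P, forall w t, 0 <= t <= T -> Y t w = st (cut T b) (t, w)}.
Proof.
move=> Vb [pY cY eY].
have aez := V_paths (S2_V T0 filF S2_zeta); have aeb := V_paths Vb.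
have mY : measurable_fun setT (cut T Y : TR * Omega -> R).
  have pc := prog_cut pY.
  apply: (prog_meas T0 filF pc); exact: supp_cut.
(* Path continuity enters here: a continuous path is integrable on [[0, T]], so the integral in the
   state equation is a genuine one. *)
have aeY : {ae P, forall w, itg leb (fun s => \1_(`[0, T]%classic) s * Y s w)}.
  apply: filterS cY => w cw.
  have := continuous_compact_integrable (@segment_compact R 0 T) cw.
  move=> /integrable_mkcond => /(_ (measurable_itv _)).
  rewrite /itg; congr (integrable _ _ _); apply/funext => s.
  by rewrite /patch indicE; case: (s \in _); rewrite ?mul1r ?mul0r.
have ae2 : {ae P, forall w, (L2 leb (fun t => zeta (t, w)) /\ itg leb (fun t => zeta (t, w))) /\
   (L2 leb (fun t => cut T b (t, w)) /\ itg leb (fun t => cut T b (t, w)))}.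
  by apply: filterS2 aez aeb.
have ae3 : {ae P, forall w, itg leb (fun s => \1_(`[0, T]%classic) s * Y s w) /\
   forall t, 0 <= t <= T ->
     zeta (t, w) = xi0 w + sigma * W t w + sigma0 * W0 t w}.
  by apply: filterS2 aeY zetaE.
apply: filterS3 eY ae2 ae3 => w Yw [[_ iz] [_ ib]] [iY zE] t tT.
rewrite stE//; apply: (ode_unique delta0 iz ib iY _ tT) => {tT} s sT.
rewrite Yw; last by rewrite in_itv.
rewrite -Kp0E zE//.
have -> : Kp 0 (fun s => - delta * Y s w + b s w) s =
    Kp 0 (fun s => - delta * Y s w + cut T b (s, w)) s.
  apply: eq_Kp => r /andP[r0 rs]; rewrite cutE// r0 (le_trans rs)//.
  by case/andP: sT.
by apply/esym; rewrite addrAC; congr (_ + _); rewrite addrAC.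
Qed.

End states.

(** * The driving noise and its conditional mean *)

Section forcing.
Context d (Omega : measurableType d) (R : realType) (P : probability Omega R).
Variables (W W0 : R -> {RV P >-> R}) (xi0 : {RV P >-> R}) (T delta sigma sigma0 : R).
Hypothesis P_complete : measure_is_complete P.
Hypotheses (T0 : 0 < T) (delta0 : 0 <= delta).
Hypotheses (BW : brownian_motion T W) (BW0 : brownian_motion T W0).
Hypothesis W_indep_W0 : independent P <<s history W T >> <<s history W0 T >>.
Hypothesis xi0_indep : independent P <<s generators xi0 >>
  <<s history W T `|` history W0 T >>.
Hypothesis Lxi : L2 P xi0.
Local Notation leb := (@lebesgue_measure R).
Local Notation TR := (measurableTypeR R).
Local Notation m := (leb \x P)%E.

Let F := full_filtration P xi0 W W0.
Let F0 := common_filtration P W0.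
Let filF : complete_filtration P F.
Proof. exact: full_filtration_complete. Qed.
Let filF0 : complete_filtration P F0.
Proof. exact: common_filtration_complete. Qed.

(** [zeta0] is [zeta] with [xi0] and [W] replaced by their means. Both are built from corrected
    Brownian paths, hence the identities hold almost surely, at all times at once. *)
Lemma forcing : exists zeta zeta0, [/\ S2 P T F zeta, S2 P T F0 zeta0,
  {ae P, forall w t, 0 <= t <= T -> zeta (t, w) = xi0 w + sigma * W t w + sigma0 * W0 t w} &
  {ae P, forall w t, 0 <= t <= T ->
    zeta (t, w) - zeta0 (t, w) = xi0 w - Rint P xi0 + sigma * W t w}].
Proof.
have [f Sf fE] : exists2 f, S2 P T F f &
    {ae P, forall w t, 0 <= t <= T -> f (t, w) = W t w}.
  apply: (S2_brownian T0 filF BW) => s /andP[s0 _].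
  by apply: full_adapted_W; rewrite s0 lexx.
have [f0 Sf0 f0E] : exists2 f, S2 P T F0 f &
    {ae P, forall w t, 0 <= t <= T -> f (t, w) = W0 t w}.
  apply: (S2_brownian T0 filF0 BW0) => s /andP[s0 _].
  by apply: common_adapted_W0; rewrite s0 lexx.
have Sx : S2 P T F (fun z => \1_(`[0, T]%classic) z.1 * xi0 z.2).
  by apply: S2_state Lxi _ => t _; exact: full_adapted_xi.
have Sc : S2 P T F0 (fun z => \1_(`[0, T]%classic) z.1 * Rint P xi0).
  have := @S2_state _ _ _ P T F0 (fun=> Rint P xi0) (L2_cst P _).
  by apply=> t _; exact: measurable_cst.
exists (fun z => \1_(`[0, T]%classic) z.1 * xi0 z.2 + sigma * f z + sigma0 * f0 z).
exists (fun z => \1_(`[0, T]%classic) z.1 * Rint P xi0 + sigma0 * f0 z).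
split.
- apply: S2D; first by apply: S2D => //; exact: S2Z.
  by apply: S2Z; exact: S2_common_full.
- by apply: S2D => //; exact: S2Z.
- by apply: filterS2 fE f0E => w fw f0w t tT; rewrite fw// f0w// ind_itv/= tT mul1r.
- by apply: filterS fE => w fw t tT; rewrite fw// ind_itv/= tT !mul1r; ring.
Qed.

Variables zeta zeta0 : R * Omega -> R.
Hypotheses (Sz : S2 P T F zeta) (Sz0 : S2 P T F0 zeta0).
Hypothesis dzE : {ae P, forall w t, 0 <= t <= T ->
    zeta (t, w) - zeta0 (t, w) = xi0 w - Rint P xi0 + sigma * W t w}.

(** The difference is a centred function of [xi0] and [W], hence independent of F0_T. Sets of F0_T
    are allowed because the next lemma tests at earlier times with a set known only later. *)
Lemma mean_forcing t A : 0 <= t <= T -> <<s F0 T >> A ->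
  Rint P (fun w => \1_A w * (zeta (t, w) - zeta0 (t, w))) = 0.
Proof.
move=> tT sA; have mA := fil_meas filF0 sA.
pose N w := xi0 w - Rint P xi0 + sigma * W t w.
have Lc := L2_cst P (Rint P xi0).
have LW := brownian_L2 BW tT.
have LN : L2 P N by apply: L2D; [exact: L2B | exact: L2Z].
have mfull : <<s generators xi0 `|` history W T >> `<=` measurable.
  apply: g_sigma_measurable; rewrite subUset.
  by split; [apply: generators_measurable | apply: history_measurable] => // *; exact: measurable_funPT.
have mN : measurable_fun setT (N : g_sigma_algebraType (generators xi0 `|` history W T) -> R).
  apply: measurable_funD.
    apply: measurable_funB; last exact: measurable_cst.
    by apply: meas_g_mono (@meas_generators _ _ _ xi0); apply: g_sigma_mono; exact: subsetUl.
  apply: measurable_funM; first exact: measurable_cst.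
  by apply: meas_g_mono (meas_history (X := W) tT); apply: g_sigma_mono; exact: subsetUr.
have mI : measurable_fun setT (\1_A : g_sigma_algebraType (F0 T) -> R).
  exact: measurable_indic.
have LI : L2 P (\1_A : Omega -> R) by apply: L2_indic => //; exact: itg_indic.
have -> : Rint P (fun w => \1_A w * (zeta (t, w) - zeta0 (t, w))) =
    Rint P (fun w => N w * \1_A w).
  have [mz _] := S2_section filF Sz tT; have [mz0 _] := S2_section filF0 Sz0 tT.
  apply: Rint_ae.
  - by apply: measurable_funM; [exact: measurable_indic | exact: measurable_funB].
  - by apply: measurable_funM; [case: LN | exact: measurable_indic].
  - by apply: filterS dzE => w ->//; rewrite mulrC.
rewrite (indep_Rint mfull (fil_meas filF0 (t := T))
  (indep_common P_complete W_indep_W0 xi0_indep) mN mI LN LI).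
rewrite RintD; [|by apply: itgB; exact: L2_itg|by apply: itgZ; exact: L2_itg].
rewrite RintB; [|exact: L2_itg|exact: L2_itg].
rewrite Rint_cst subrr RintZ; last exact: L2_itg.
by rewrite (brownian_mean BW tT) mulr0 add0r mul0r.
Qed.

(** [Kp] integrates over earlier times, at each of which [mean_forcing] applies with the same [A];
    Fubini exchanges this integral with the mean. *)
Lemma mean_free_state t A : 0 <= t <= T -> <<s F0 T >> A ->
  Rint P (fun w => \1_A w *
    (free_state T delta zeta (t, w) - free_state T delta zeta0 (t, w))) = 0.
Proof.
move=> tT sA; have mA := fil_meas filF0 sA.
have Vz := S2_V T0 filF Sz; have Vz0 := S2_V T0 filF0 Sz0.
pose h z := zeta z - zeta0 z.
have [sz pz Lz] := Vz; have [sz0 pz0 Lz0] := Vz0.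
have Vh : V P T F h.
  by apply: V_B => //; exact: V_common_full.
have ih := V_itg Vh.
have Sh : S2 P T F h by apply: S2B => //; exact: S2_common_full.
have SK := S2_KP T0 delta0 Vh.
have iKt : itg P (fun w => KP T delta h (t, w)) by apply: L2_itg; exact: (S2_section filF SK tT).
have iht : itg P (fun w => h (t, w)) by apply: L2_itg; exact: (S2_section filF Sh tT).
have LX : forall G z, complete_filtration P G -> S2 P T G z ->
    L2 P (fun w => free_state T delta z (t, w)).
  move=> G z fG Sz'; apply: (S2_section fG _ tT); exact: S2_free_state.
have e1 : {ae P, forall w, free_state T delta zeta (t, w) - free_state T delta zeta0 (t, w) =
    h (t, w) - delta * KP T delta h (t, w)}.
  apply: filterS2 (V_paths Vz) (V_paths Vz0) => w [_ iz] [_ iz0].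
  rewrite /free_state /KP ind_itv/= tT !mul1r /h.
  have -> : Kp delta (fun s => zeta (s, w) - zeta0 (s, w)) t =
      Kp delta (fun s => zeta (s, w)) t - Kp delta (fun s => zeta0 (s, w)) t.
    rewrite -[X in _ - X]mul1r -mulNr -KpZ// -KpD//; last exact: itgZ.
    by apply: eq_Rint => s; rewrite mulN1r.
  by move: (Kp _ _ _) (Kp _ _ _) => x y; ring.
have -> : Rint P (fun w => \1_A w *
    (free_state T delta zeta (t, w) - free_state T delta zeta0 (t, w))) =
  Rint P (fun w => \1_A w * h (t, w) - delta * (\1_A w * KP T delta h (t, w))).
  have [mx _] := LX _ _ filF Sz; have [mx0 _] := LX _ _ filF0 Sz0.
  have i3 : itg P (fun w => \1_A w * h (t, w) - delta * (\1_A w * KP T delta h (t, w))).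
    by apply: itgB; [exact: itg_indic_mul | apply: itgZ; exact: itg_indic_mul].
  apply: Rint_ae; [|exact: itg_meas i3|].
    by apply: measurable_funM; [exact: measurable_indic | exact: measurable_funB].
  by apply: filterS e1 => w ->; ring.
rewrite RintB; [|exact: itg_indic_mul|by apply: itgZ; exact: itg_indic_mul].
rewrite mean_forcing// RintZ; last exact: itg_indic_mul.
suff -> : Rint P (fun w => \1_A w * KP T delta h (t, w)) = 0 by rewrite mulr0 subrr.
pose f (z : R * Omega) := \1_A z.2 * (kern delta t z.1 * h z).
have fi : itg m f.
  apply: itg_le (itg_norm ih).
    have [mh _] : L2 m h by case: Vh.
    apply: measurable_funM.
      have mI : measurable_fun setT (\1_A : Omega -> R) by exact: measurable_indic.
      by apply: (measurableT_comp mI); exact: measurable_snd.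
    apply: measurable_funM => //; apply: measurable_kern; first exact: measurable_cst.
    exact: measurable_fst.
  move=> z; rewrite !normrM mulrA ler_piMl// mulr_ile1//.
    by rewrite indicE; case: (_ \in _); rewrite ?normr1 ?normr0.
  by rewrite ger0_norm ?kern_ge0// kern_le1.
have [_ [_ e2]] := itg_fubini2 fi; have [_ [_ e3]] := itg_fubini1 fi.
transitivity (Rint m f).
  rewrite e2; have [_ [hm _]] := itg_fubini2 fi.
  apply: Rint_ae; [exact: itg_meas (itg_indic_mul mA iKt)|exact: itg_meas hm|].
  apply: filterS (V_paths Vh) => w [_ iw]; rewrite /KP ind_itv/= tT mul1r /Kp.
  by rewrite -RintZ//; exact: itg_kern.
rewrite e3 -[RHS](Rint0 leb); apply: eq_Rint => s; rewrite /f/=.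
have [sT|nsT] := pselect (0 <= s <= T); last first.
  rewrite -[RHS](Rint0 P); apply: eq_Rint => w; rewrite /h sz// sz0// subrr !mulr0//.
have ihs : itg P (fun w => h (s, w)) by apply: L2_itg; exact: (S2_section filF Sh sT).
rewrite -[RHS](mulr0 (kern delta t s)) -(mean_forcing sT sA) -RintZ; last exact: itg_indic_mul.
by apply: eq_Rint => w; rewrite mulrCA.
Qed.

End forcing.

(** * Profits *)

Section profit_form.
Context d (Omega : measurableType d) (R : realType) (P : probability Omega R).
Variables (T : R) (F : R -> set (set Omega)).
Hypothesis T0 : 0 < T.
Hypothesis fil : complete_filtration P F.
Local Notation leb := (@lebesgue_measure R).
Local Notation TR := (measurableTypeR R).
Local Notation m := (leb \x P)%E.
Local Notation V := (V P T F).
Variables (pr : R -> R -> R) (L delta : R).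
Hypotheses (L0 : 0 <= L) (delta0 : 0 <= delta).
Hypothesis pr_meas : forall x, measurable_fun setT (pr ^~ x : TR -> R).
Hypothesis pr_lip : forall t x y, `|pr t x - pr t y| <= L * `|x - y|.
Hypothesis pr_itg : itg leb (fun t => pr t 0).
Hypothesis pr_supp : forall t x, ~ (0 <= t <= T) -> pr t x = 0.
Variables (ci ca : R) (x1 : R * Omega -> R).
Hypotheses (ca0 : 0 < ca) (Sx1 : S2 P T F x1).

Implicit Types u a b v : R * Omega -> R.
Local Notation GP := (GP T pr delta).
Local Notation gp := (gp pr).
Local Notation I := (fun z : R * Omega => \1_(`[0, T]%classic) z.1 : R).

(** The profit with the state eliminated: duality moves [KP] from the control to the price. The
    first summand pairs the price with a dominated process and need not be a product of L2
    functions. *)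
Definition profit_form u b : R :=
  Rint m (fun z => gp u z * x1 z) + dot m (GP u) b - ci * dot m I b - ca * dot m b b.

Definition gradient u b (z : R * Omega) : R :=
  GP u z - ci * \1_(`[0, T]%classic) z.1 - 2 * ca * b z.

Let L2_V b : V b -> L2 m b. Proof. by case. Qed.
Let L2GP u : V u -> L2 m (GP u).
Proof. by move=> Vu; exact: (L2_GP T0 fil L0 delta0 pr_meas pr_lip pr_itg Vu). Qed.

Lemma L2_gradient u b : V u -> V b -> L2 m (gradient u b).
Proof.
move=> Vu Vb; apply: L2B; last by apply: L2Z; exact: L2_V.
by apply: L2B; [exact: L2GP | apply: L2Z; exact: L2_ind].
Qed.

Lemma dot_gradient u b v : V u -> V b -> V v -> dot m (gradient u b) v =
  dot m (GP u) v - ci * dot m I v - 2 * ca * dot m b v.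
Proof.
move=> Vu Vb Vv; have Lv := L2_V Vv; have Lb := L2_V Vb; have LG := L2GP Vu.
have LI := L2_ind P T.
rewrite dotBl//; [|by apply: L2B => //; exact: L2Z|exact: L2Z].
rewrite dotBl//; last exact: L2Z.
by rewrite !dotZl.
Qed.

Let expansion (r g g' i i' bb bv vv : R) :
  (r + (g + g') - ci * (i + i') - ca * (bb + 2 * bv + vv)) =
  (r + g - ci * i - ca * bb) + (g' - ci * i' - 2 * ca * bv) - ca * vv.
Proof. by ring. Qed.

(** The exact second order expansion; its negative quadratic term gives both directions of the first
    order condition. *)
Lemma profit_formD u b v : V u -> V b -> V v ->
  profit_form u (fun z => b z + v z) =
  profit_form u b + dot m (gradient u b) v - ca * dot m v v.
Proof.
move=> Vu Vb Vv; have Lv := L2_V Vv; have Lb := L2_V Vb; have LG := L2GP Vu.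
have LI := L2_ind P T; have Lbv := L2D Lb Lv.
rewrite dot_gradient// /profit_form.
rewrite dotDr// [dot m I _]dotDr// [dot m (fun z => b z + v z) _]dotDr// !dotDl//.
rewrite [dot m v b]dotC [X in ca * X](_ : _ = dot m b b + 2 * dot m b v + dot m v v).
  exact: expansion.
by move: (dot m b b) (dot m b v) (dot m v v) => x y z; ring.
Qed.

Lemma profit_form_max u b : V u -> V b ->
  (forall v, V v -> dot m (gradient u b) v = 0) ->
  forall c, V c -> profit_form u c <= profit_form u b.
Proof.
move=> Vu Vb k0 c Vc; have Vv := V_B Vc Vb.
have -> : c = (fun z => b z + (c z - b z)) by apply/funext => z; rewrite addrC subrK.
rewrite profit_formD// k0// addr0 gerBl.
by apply: mulr_ge0; [exact: ltW | exact: dot_ge0].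
Qed.

Lemma profit_form_critical u b : V u -> V b ->
  (forall c, V c -> profit_form u c <= profit_form u b) ->
  forall v, V v -> dot m (gradient u b) v = 0.
Proof.
move=> Vu Vb bmax v Vv; have Lv := L2_V Vv.
have Lk := L2_gradient Vu Vb.
(* Comparison of [b] with [b + t v] for every real [t]: a linear term bounded by a quadratic one
   must vanish. *)
have h t : 2 * t * dot m (gradient u b) v <= 0 + t ^+ 2 * (2 * ca * dot m v v).
  have Vt := V_Z t Vv.
  have := bmax _ (V_D Vb Vt).
  rewrite profit_formD// dotZr// [dot m (fun z => t * v z) _]dotZl//; last exact: L2Z.
  rewrite dotZr//; move: (dot m _ v) (dot m v v) (profit_form u b) => x y p; nra.
have b0 : 0 <= 2 * ca * dot m v v.
  by apply: mulr_ge0; [rewrite mulr_ge0// ltW | exact: dot_ge0].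
have := discriminant b0 h; rewrite mul0r => h2.
by apply/eqP; rewrite -sqrf_eq0 eq_le h2 sqr_ge0.
Qed.

Variables (price : R -> R -> R) (cp : R).
Hypothesis prE : forall t x, 0 <= t <= T -> pr t x = price t x - cp.

(** Any state of [b] may be used, as it agrees with the explicit one on almost every path at all
    times. *)
Lemma profitE (mu b Y : R -> Omega -> R) : progressive T F Y -> V (cut T mu) -> V (cut T b) ->
  {ae P, forall w t, 0 <= t <= T -> Y t w = state T delta x1 (cut T b) (t, w)} ->
  profit P T cp ci ca price mu b Y = (profit_form (cut T mu) (cut T b))%:E.
Proof.
set u := cut T mu; set c := cut T b => pY Vu Vc YE.
have [su pu Lu] := Vu; have [sc pc Lc] := Vc.
have mu' : measurable_fun setT (u : TR * Omega -> R) by case: Lu.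
have mc : measurable_fun setT (c : TR * Omega -> R) by case: Lc.
have mgp := measurable_gp pr_meas pr_lip mu'.
pose H (z : R * Omega) := gp u z * cut T Y z - ci * c z - ca * (c z * c z).
pose h (z : R * Omega) := gp u z * x1 z + gp u z * KP T delta c z
  - ci * (\1_(`[0, T]%classic) z.1 * c z) - ca * (c z * c z).
have mY : measurable_fun setT (cut T Y : TR * Omega -> R).
  have pcY := prog_cut pY.
  by apply: (prog_meas T0 fil pcY); exact: supp_cut.
have mH : measurable_fun setT (H : TR * Omega -> R).
  apply: measurable_funB; last first.
    by apply: measurable_funM => //; exact: measurable_funM.
  apply: measurable_funB; last by apply: measurable_funM.
  exact: measurable_funM.
have iG y : S2 P T F y -> itg m (fun z => gp u z * y z).
  move=> [sy py _ dy]; apply: (itg_dominated_gp T0 fil pr_meas pr_lip pr_itg) => //.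
  exact: (prog_meas T0 fil py sy).
have SK := S2_KP T0 delta0 Vc.
have i1 := iG _ Sx1; have i2 := iG _ SK.
have i3 : itg m (fun z => \1_(`[0, T]%classic) z.1 * c z) := itg_dot (L2_ind P T) Lc.
have i4 : itg m (fun z => c z * c z) := itg_dot Lc Lc.
have i12 := itgD i1 i2; have i123 := itgB i12 (itgZ ci i3).
have ih : itg m h := itgB i123 (itgZ ca i4).
have -> : profit_form u c = Rint m h.
  rewrite /profit_form (duality T0 fil L0 delta0 pr_meas pr_lip pr_itg pr_supp Vu Vc).
  rewrite -(RintD i1 i2) -(RintZ ci i3) -(RintZ ca i4) -(RintB i12 (itgZ ci i3)).
  by rewrite -(RintB i123 (itgZ ca i4)).
have [_ [ihP ->]] := itg_fubini2 ih.
rewrite (RintE ihP) /profit unlock.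
transitivity (\int[P]_w (Rint leb (fun t => H (t, w)))%:E)%E.
  apply: eq_integral => w _; congr EFin.
  rewrite Rintegral_mkcond; apply: eq_Rint => t; rewrite /patch.
  have [tT|nt] := pselect (0 <= t <= T).
    rewrite mem_set ?in_itv//= /H /gp prE//= /u /c !cutE//.
    by rewrite [X in X - _ - _]mulrC expr2.
  rewrite memNset/= ?in_itv// /H sc// /gp pr_supp// !mul0r !mulr0 !subr0//.
apply: ae_eq_integral => //.
- by apply/measurable_EFinP; exact: measurable_Rint_time.
- by apply/measurable_EFinP; exact: itg_meas ihP.
- apply: filterS YE => w Yw _; congr EFin; apply: eq_Rint => t.
  have [tT|nt] := pselect (0 <= t <= T).
    rewrite /H /h [cut T Y _]cutE// Yw// ind_itv/= tT mul1r /state -/c.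
    by rewrite mulrDr.
  by rewrite /H /h sc// /gp pr_supp// !mul0r !mulr0 addr0.
Qed.

End profit_form.

(** * Conditional means *)

Section nonmeasurable_integrand.
Context d (T : measurableType d) (R : realType) (mu : {measure set T -> \bar R}).
Local Open Scope ereal_scope.

(** For nonnegative functions the integral is a supremum over simple functions below, hence monotone
    for arbitrary functions. The pathwise supremum in [calL2] is handled in this way. *)
Lemma le_integral_nonmeasurable (f g : T -> \bar R) :
  (forall x, 0 <= f x) -> (forall x, f x <= g x) ->
  \int[mu]_x f x <= \int[mu]_x g x.
Proof.
move=> f0 fg; rewrite !ge0_integralTE//; last by move=> x; exact: le_trans (f0 x) (fg x).
apply: le_ereal_sup => _ [h hf <-]; exists h => // x.
exact: le_trans (hf x) (fg x).
Qed.

End nonmeasurable_integrand.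

Section supremum_processes.
Context d (Omega : measurableType d) (R : realType) (P : probability Omega R).
Variables (T : R) (F : R -> set (set Omega)).
Hypothesis T0 : 0 < T.
Hypothesis fil : complete_filtration P F.
Local Notation leb := (@lebesgue_measure R).
Local Notation TR := (measurableTypeR R).
Local Notation m := (leb \x P)%E.

Lemma S2_calL2 f : S2 P T F f -> calL2 P T F (fun t w => f (t, w)).
Proof.
move=> [sf pf _ [B [[mB iB] B0 [N [mN N0 fN]]]]]; split; first exact/progressiveP.
have mB2 : measurable_fun setT (fun w => (B w ^+ 2)%:E).
  by apply/measurable_EFinP; exact: measurable_funX.
(* Comparison of nonmeasurable integrands uses bounds at every point, so the bound is made infinite
   on the null set where domination may fail. *)
pose g w := if w \in N then +oo%E else (B w ^+ 2)%:E.
have mg : measurable_fun setT g.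
  apply: measurable_fun_ifT => //; apply: (measurable_fun_bool true).
  rewrite setTI (_ : _ @^-1` _ = N)//.
  by apply/seteqP; split => w /=; [move=> /set_mem | move=> /mem_set].
apply: (@le_lt_trans _ _ (\int[P]_w g w)%E).
  apply: le_integral_nonmeasurable => w.
    apply: (@le_trans _ _ ((`|f (0, w)| ^+ 2)%:E)); first by rewrite lee_fin exprn_ge0.
    by apply: ereal_sup_ubound; exists 0 => //=; rewrite in_itv/= lexx ltW.
  rewrite /g; case: ifPn => [_|/negP wN]; first by rewrite leey.
  apply: ge_ereal_sup => _ [t _ <-]; rewrite lee_fin lerXn2r// ?nnegrE//.
  apply: contrapT => h; apply: wN; apply/mem_set/fN => hw; exact/h/hw.
rewrite (@ae_eq_integral _ _ _ P setT (fun w => (B w ^+ 2)%:E) g)//; last first.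
  exists N; split=> // w; rewrite /= => h; apply: contrapT => wN; apply: h => _.
  by rewrite /g memNset.
by rewrite -RintE// ltry.
Qed.

Lemma calL2_calH2 b : calL2 P T F b -> calH2 P T F b.
Proof.
move=> [pb hb]; split=> //.
have pc := prog_cut pb; have sc := @supp_cut _ _ _ T b.
have mc : measurable_fun setT (cut T b : TR * Omega -> R) by exact: (prog_meas T0 fil pc sc).
pose f (z : TR * Omega) := (cut T b z ^+ 2)%:E.
have mf : measurable_fun setT f by apply/measurable_EFinP; exact: measurable_funX.
have f0 z : (0 <= f z)%E by rewrite lee_fin sqr_ge0.
rewrite H2_integral// (fubini_tonelli2 f)//.
have mG : measurable_fun setT (fubini_G leb f) := measurable_fun_fubini_tonelli_G f mf f0.
have G0 w : (0 <= fubini_G leb f w)%E by apply: integral_ge0 => t _.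
have Ti : 0 <= T^-1 by rewrite invr_ge0 ltW.
(* The factor [T^-1] is put on the measurable inner integral, and not [T] on the supremum, so that
   it can be moved through the integral over [Omega]. *)
have : ((T^-1)%:E * \int[P]_w fubini_G leb f w < +oo)%E.
  rewrite -ge0_integralZl//.
  apply: le_lt_trans hb; apply: le_integral_nonmeasurable => w.
    by rewrite mule_ge0// lee_fin.
  set S := ereal_sup _.
  have S0 : (0 <= S)%E.
    apply: (@le_trans _ _ ((`|b 0 w| ^+ 2)%:E)); first by rewrite lee_fin exprn_ge0.
    by apply: ereal_sup_ubound; exists 0 => //=; rewrite in_itv/= lexx ltW.
  have fS t : (f (t, w) <= S * (\1_(`[0, T]%classic) t)%:E)%E.
    rewrite /f /cut ind_itv/=; case: ifPn => tT; last by rewrite mul0r expr0n/= mule0.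
    rewrite mul1r mule1; apply: ereal_sup_ubound; exists t; first by rewrite /= in_itv.
    by rewrite real_normK ?num_real.
  have : (fubini_G leb f w <= \int[leb]_t (S * (\1_(`[0, T]%classic) t)%:E))%E.
    by apply: le_integral_nonmeasurable => t //; exact: f0.
  rewrite ge0_integralZl//; last first.
    by apply/measurable_EFinP; apply: measurable_indic; exact: measurable_itv.
  rewrite integral_indic// setIT.
  set M := (X in (S * X)%E); have -> : M = T%:E.
    apply: (etrans (@lebesgue_measure_itv R `[0, T])).
    by rewrite /= lte_fin T0 oppr0 adde0.
  move=> h; apply: (le_trans (lee_wpmul2l _ h)); first by rewrite lee_fin.
  by rewrite muleCA -EFinM mulVf ?mule1// gt_eqF.
have I0 : (0 <= \int[P]_w fubini_G leb f w)%E by exact: integral_ge0.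
change ((T^-1)%:E * \int[P]_w fubini_G leb f w < +oo -> \int[P]_w fubini_G leb f w < +oo)%E.
case: (\int[P]_w fubini_G leb f w)%E I0 => [r _ _|_|//]; first by rewrite ltry.
by rewrite mulry gtr0_sg ?invr_gt0// mul1e.
Qed.

End supremum_processes.

(** * Versions of conditional expectations *)

Section conditional_expectation.
Context d (Omega : measurableType d) (R : realType) (P : probability Omega R).
Implicit Types X Z : Omega -> R.

Lemma integral_indic_mul A X : measurable A -> itg P X ->
  (\int[P]_(w in A) (X w)%:E = (Rint P (fun w => \1_A w * X w))%:E)%E.
Proof.
move=> mA iX; rewrite RintE; last exact: itg_indic_mul.
rewrite [LHS]integral_mkcond; apply: (@eq_integral _ _ _ P setT) => w _.
by rewrite /patch indicE; case: (w \in A); rewrite ?mul1r ?mul0r.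
Qed.

Lemma cond_exp_orthogonal (G : set (set Omega)) X Z A : <<s G >> `<=` measurable ->
  is_cond_exp P G X Z -> <<s G >> A -> Rint P (fun w => \1_A w * (X w - Z w)) = 0.
Proof.
move=> Gm [iX iZ _ XZ] sA; have mA := Gm _ sA.
have := XZ _ sA; rewrite !integral_indic_mul// => -[e].
rewrite (@eq_Rint _ _ _ P _ (fun w => \1_A w * X w - \1_A w * Z w)); last first.
  by move=> w; rewrite mulrBr.
by rewrite RintB ?e ?subrr//; exact: itg_indic_mul.
Qed.

Lemma orthogonal_cond_exp (G : set (set Omega)) X Z : <<s G >> `<=` measurable ->
  itg P X -> itg P Z -> measurable_fun setT (Z : g_sigma_algebraType G -> R) ->
  (forall A, <<s G >> A -> Rint P (fun w => \1_A w * (X w - Z w)) = 0) ->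
  is_cond_exp P G X Z.
Proof.
move=> Gm iX iZ mZ XZ; split=> // A sA; have mA := Gm _ sA.
rewrite !integral_indic_mul//; congr EFin; apply/esym/eqP; rewrite -subr_eq0.
rewrite -RintB; [|exact: itg_indic_mul..]; rewrite -(XZ _ sA); apply/eqP.
by apply: eq_Rint => w; rewrite mulrBr.
Qed.

(** The difference [D] of the versions integrates to 0 over the whole space and over the event [A]
    where it is nonnegative, hence so does [|D| = 2 * \1_A * D - D]. *)
Lemma cond_exp_unique (G : set (set Omega)) X X' Z Z' : <<s G >> `<=` measurable ->
  is_cond_exp P G X Z -> is_cond_exp P G X' Z' -> {ae P, forall w, X w = X' w} ->
  {ae P, forall w, Z w = Z' w}.
Proof.
move=> Gm cX cX' XX; have [iX iZ mZ _] := cX; have [iX' iZ' mZ' _] := cX'.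
pose D w := Z w - Z' w; have iD : itg P D by exact: itgB.
have mD : measurable_fun setT (D : g_sigma_algebraType G -> R) by exact: measurable_funB.
have D0 A : <<s G >> A -> Rint P (fun w => \1_A w * D w) = 0.
  move=> sA; have mA := Gm _ sA.
  have e1 := cond_exp_orthogonal Gm cX sA; have e2 := cond_exp_orthogonal Gm cX' sA.
  have i1 : itg P (fun w => \1_A w * (X w - Z w)) by apply: itg_indic_mul => //; exact: itgB.
  have i2 : itg P (fun w => \1_A w * (X' w - Z' w)) by apply: itg_indic_mul => //; exact: itgB.
  have : Rint P (fun w => \1_A w * (X' w - Z' w) - \1_A w * (X w - Z w)) = 0.
    by rewrite RintB// e1 e2 subrr.
  move=> <-; apply: Rint_ae; [exact: itg_meas (itg_indic_mul mA iD)|exact: itg_meas (itgB i2 i1)|].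
  by apply: filterS XX => w ->; rewrite /D; ring.
pose A := D @^-1` `[0, +oo[%classic.
have sA : <<s G >> A by move/meas_gP : mD; apply; exact: measurable_itv.
have mA := Gm _ sA.
have DT : Rint P D = 0.
  rewrite -(D0 setT (@sigma_setT _ _ _)); apply: eq_Rint => w.
  by rewrite indicE in_setT mul1r.
have nD : Rint P (fun w => `|D w|) = 0.
  have -> : Rint P (fun w => `|D w|) = Rint P (fun w => 2 * (\1_A w * D w) - D w).
    apply: eq_Rint => w; rewrite indicE; have [Dw|Dw] := leP 0 (D w).
      by rewrite mem_set ?mul1r; [rewrite ger0_norm//; ring | rewrite /A/= in_itv/= Dw].
    rewrite memNset; first by rewrite mul0r mulr0 sub0r ltr0_norm.
    by rewrite /A/= in_itv/= leNgt Dw.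
  rewrite RintB//; last by apply: itgZ; exact: itg_indic_mul.
  by rewrite RintZ ?D0 ?DT ?mulr0 ?subrr//; exact: itg_indic_mul.
have := Rint_eq0_ae (itg_norm iD) (fun w => normr_ge0 _) nD.
by apply: filterS => w /eqP; rewrite normr_eq0 subr_eq0 => /eqP.
Qed.

End conditional_expectation.

(** * Equilibrium *)

Lemma gradient_gap (R : realFieldType) (x y p q r k c : R) :
  p - k * q - 2 * c * x = 0 -> r - k * q - 2 * c * y = 0 -> p - r <= 0 ->
  2 * c * (x - y) <= 0.
Proof. by move=> h1 h2; rewrite mulrBr; lra. Qed.

Section game.
Context d (Omega : measurableType d) (R : realType) (P : probability Omega R).
Variables (T : R) (W W0 : R -> {RV P >-> R}) (xi0 : {RV P >-> R}).
Variables (delta cp ci ca sigma sigma0 L : R) (price : R -> R -> R).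
Hypotheses (P_complete : measure_is_complete P) (T0 : 0 < T).
Hypothesis W_indep_W0 : independent P <<s history W T >> <<s history W0 T >>.
Hypothesis xi0_indep : independent P <<s generators xi0 >>
  <<s history W T `|` history W0 T >>.
Hypotheses (delta0 : 0 <= delta) (ca0 : 0 < ca).
Hypothesis price_integrable : forall x, lebesgue_measure.-integrable `[0, T]
  (EFin \o (fun t => price t x)).
Hypothesis price_lipschitz : forall t x y, t \in `[0, T] ->
  `|price t x - price t y| <= L * `|x - y|.
Hypothesis price_decreasing : forall t x y, t \in `[0, T] -> x <= y ->
  price t y <= price t x.
Local Notation leb := (@lebesgue_measure R).
Local Notation TR := (measurableTypeR R).
Local Notation m := (leb \x P)%E.

Let F := full_filtration P xi0 W W0.
Let F0 := common_filtration P W0.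
Let filF : complete_filtration P F.
Proof. exact: full_filtration_complete. Qed.
Let filF0 : complete_filtration P F0.
Proof. exact: common_filtration_complete. Qed.

(* Set to 0 outside [0, T], where nothing is assumed about the price. *)
Definition net_price (t x : R) : R := \1_(`[0, T]%classic) t * (price t x - cp).
Local Notation pr := net_price.

Lemma lipschitz_constant_ge0 : 0 <= L.
Proof.
have := @price_lipschitz 0 1 0; rewrite in_itv/= lexx ltW// subr0 normr1 mulr1.
by move=> /(_ isT); apply: le_trans.
Qed.
Let L0 := lipschitz_constant_ge0.

Lemma net_price_itg x : itg leb (pr ^~ x).
Proof.
have iI : itg leb (fun t => \1_(`[0, T]%classic) t * price t x).
  have := price_integrable x; move=> /integrable_mkcond => /(_ (measurable_itv _)).
  rewrite /itg; congr (integrable _ _ _); apply/funext => s.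
  by rewrite /patch indicE; case: (s \in _); rewrite ?mul1r ?mul0r.
apply: (eq_itg (f := fun t : TR => \1_(`[0, T]%classic) t * price t x
  - cp * \1_(`[0, T]%classic) t)); last by apply: itgB => //; apply: itgZ; exact: itg_itv.
by move=> t; rewrite /net_price mulrBr [cp * _]mulrC.
Qed.

Lemma net_price_measurable x : measurable_fun setT (pr ^~ x : TR -> R).
Proof. exact: itg_meas (net_price_itg x). Qed.

Lemma net_price_lip t x y : `|pr t x - pr t y| <= L * `|x - y|.
Proof.
rewrite /pr ind_itv; case: ifPn => tT; last by rewrite !mul0r subr0 normr0 mulr_ge0.
rewrite !mul1r opprB addrA subrK; apply: price_lipschitz; by rewrite in_itv.
Qed.

Lemma net_price_decr t x y : x <= y -> pr t y <= pr t x.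
Proof.
move=> xy; rewrite /pr ind_itv; case: ifPn => tT; last by rewrite !mul0r.
by rewrite !mul1r lerD2r; apply: price_decreasing; rewrite ?in_itv.
Qed.

Lemma net_price_supp t x : ~ (0 <= t <= T) -> pr t x = 0.
Proof. by move=> /negP/negbTE nt; rewrite /pr ind_itv nt mul0r. Qed.

Lemma net_priceE t x : 0 <= t <= T -> pr t x = price t x - cp.
Proof. by move=> tT; rewrite /pr ind_itv tT mul1r. Qed.

Lemma cut_supp (f : R * Omega -> R) : supp T f -> cut T (fun t w => f (t, w)) = f.
Proof. by move=> sf; apply/funext => -[t w]; rewrite /cut (supp_ind (t, w) sf). Qed.

Variable zeta : R * Omega -> R.
Hypothesis Sz : S2 P T F zeta.
Hypothesis zetaE : {ae P, forall w t, 0 <= t <= T ->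
  zeta (t, w) = xi0 w + sigma * W t w + sigma0 * W0 t w}.
Local Notation x1 := (free_state T delta zeta).
Local Notation st := (state T delta x1).
Local Notation form := (profit_form P T pr delta ci ca x1).
Local Notation grad := (gradient T pr delta ci ca).
Local Notation optimal := (is_optimal P T W W0 xi0 delta cp ci ca sigma sigma0 price).

Let Sx1 : S2 P T F x1.
Proof. exact: S2_free_state. Qed.

Lemma profit_stateE mu b Y : V P T F (cut T mu) -> V P T F (cut T b) ->
  is_state P T W W0 xi0 delta sigma sigma0 b Y ->
  profit P T cp ci ca price mu b Y = (form (cut T mu) (cut T b))%:E.
Proof.
move=> Vmu Vb sY; have [pY _ _] := sY.
apply: (profitE T0 filF L0 delta0 net_price_measurable net_price_lip (net_price_itg 0)
  net_price_supp ci ca Sx1 net_priceE pY Vmu Vb).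
exact: (state_unique P_complete T0 delta0 Sz zetaE Vb sY).
Qed.

Lemma optimal_gradient mu b X : V P T F (cut T mu) -> optimal mu b X ->
  forall v, V P T F v -> dot m (grad (cut T mu) (cut T b)) v = 0.
Proof.
move=> Vmu [hb sX opt]; have Vb := calH2_V T0 filF hb.
apply: (profit_form_critical T0 filF L0 delta0 net_price_measurable net_price_lip
  (net_price_itg 0) ca0 Vmu Vb (x1 := x1)) => c Vc.
have [sc _ _] := Vc.
have := opt _ _ (V_calH2 Vc)
  (state_exists P_complete T0 delta0 Sz zetaE Vc).
rewrite (profit_stateE Vmu Vb sX).
rewrite profit_stateE//; last exact: (state_exists P_complete T0 delta0 Sz zetaE Vc).
  by rewrite cut_supp// lee_fin.
by rewrite cut_supp.
Qed.

Lemma gradient_optimal mu a : V P T F (cut T mu) -> V P T F a ->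
  (forall v, V P T F v -> dot m (grad (cut T mu) a) v = 0) ->
  optimal mu (fun t w => a (t, w)) (fun t w => st a (t, w)).
Proof.
move=> Vmu Va ga; have [sa _ _] := Va.
have sta := state_exists P_complete T0 delta0 Sz zetaE Va.
split; [exact: (V_calH2 Va) | exact: sta |].
move=> b Y hb sY; have Vb := calH2_V T0 filF hb.
rewrite (profit_stateE Vmu Vb sY) profit_stateE//; last by rewrite cut_supp.
rewrite cut_supp// lee_fin.
exact: (profit_form_max T0 filF L0 delta0 net_price_measurable net_price_lip
  (net_price_itg 0) x1 ca0 Vmu Va ga Vb).
Qed.

Variable zeta0 : R * Omega -> R.
Hypothesis Sz0 : S2 P T F0 zeta0.
Local Notation x0 := (free_state T delta zeta0).
Local Notation st0 := (state T delta x0).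
Hypothesis mean_x : forall t A, 0 <= t <= T -> <<s F0 T >> A ->
  Rint P (fun w => \1_A w * (x1 (t, w) - x0 (t, w))) = 0.

Let Sx0 : S2 P T F0 x0.
Proof. exact: S2_free_state. Qed.

Let S2_st0 a : V P T F0 a -> S2 P T F0 (st0 a).
Proof. by move=> Va; apply: S2D => //; exact: S2_KP. Qed.

Let S2_st a : V P T F a -> S2 P T F (st a).
Proof. by move=> Va; apply: S2D => //; exact: S2_KP. Qed.

(** The critical point is computed in the common filtration with the state [st0]; [full_orthogonal]
    then admits all F-progressive test controls, the price being still driven by [st0 a]. *)
Lemma equilibrium_gradient : exists2 a, V P T F0 a &
  forall v, V P T F v -> dot m (grad (st0 a) a) v = 0.
Proof.
have Vx0 := S2_V T0 filF0 Sx0.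
have [a Va a0] := critical_point T0 filF0 L0 delta0 net_price_measurable net_price_lip
  (net_price_itg 0) net_price_decr net_price_supp ci ca0 Vx0.
exists a => //; have Vs := S2_V T0 filF0 (S2_st0 Va).
have [sa pa La] := Va; have [ss ps Ls] := Vs.
apply: (full_orthogonal P_complete T0 W_indep_W0 xi0_indep).
- move=> z nz; rewrite /gradient /GP sa// ind_itv.
  by move: nz => /negP/negbTE ->; rewrite mul0r !mulr0 !subr0.
- exact: (L2_gradient T0 filF0 L0 delta0 net_price_measurable net_price_lip
    (net_price_itg 0) ci ca Vs Va).
- have mI : measurable_fun setT (fun z : TR * g_sigma_algebraType (F0 T) =>
      \1_(`[0, T]%classic) z.1 : R).
    exact: measurable_indT.
  apply: measurable_funB.
    apply: measurable_funB; last by apply: measurable_funM.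
    have ms : measurable_fun setT (st0 a : TR * g_sigma_algebraType (F0 T) -> R).
      exact: (prog_measT T0 ps ss).
    exact: (measurable_GP T delta net_price_measurable net_price_lip ms).
  by apply: measurable_funM => //; exact: (prog_measT T0 pa sa).
- exact: a0.
Qed.

(** [st a] and [st0 a] differ by [x1 - x0] whatever the control, so consistency reduces to [mean_x]
    and holds for non-optimal controls too. *)
Lemma equilibrium_cond_exp a t : V P T F0 a -> 0 <= t <= T ->
  is_cond_exp P (F0 t) (fun w => st a (t, w)) (fun w => st0 a (t, w)).
Proof.
move=> Va tT; have /andP[t0 tT'] := tT; have VFa : V P T F a by exact: V_common_full.
have [_ ps _ _] := S2_st0 Va.
have Ls := S2_section filF (S2_st VFa) tT; have Ls0 := S2_section filF0 (S2_st0 Va) tT.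
apply: orthogonal_cond_exp.
- exact: (fil_meas filF0).
- exact: L2_itg.
- exact: L2_itg.
- exact: (prog_adapted ps tT).
- move=> A sA; rewrite -(mean_x tT (fil_mono filF0 tT' sA)).
  by apply: eq_Rint => w; rewrite /state opprD addrACA subrr addr0.
Qed.

Lemma equilibrium_solution a : V P T F0 a ->
  (forall v, V P T F v -> dot m (grad (st0 a) a) v = 0) ->
  mfg_solution P T W W0 xi0 delta cp ci ca sigma sigma0 price
    (fun t w => st0 a (t, w)) (fun t w => a (t, w)).
Proof.
move=> Va ga; have VFa : V P T F a by exact: V_common_full.
have S0 := S2_st0 Va; have SF0 : S2 P T F (st0 a) by exact: S2_common_full.
have [ss ps _ _] := S0; have VFs := S2_V T0 filF SF0.
split; first exact: (S2_calL2 T0 SF0).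
exists (fun t w => st a (t, w)); split.
  by apply: gradient_optimal; rewrite ?cut_supp.
by move=> t; rewrite in_itv/=; exact: equilibrium_cond_exp.
Qed.

Lemma measurable_net_price t : measurable_fun setT (pr t : TR -> R).
Proof.
have h := measurable_gp net_price_measurable net_price_lip
  (u := fun z : TR * TR => z.2) (measurable_snd).
exact: (measurableT_comp h (pair1_measurable t)).
Qed.

(* The price only depends on the common noise, so X - X' may be replaced by its
   conditional expectation mu - mu'. *)
Lemma dot_price_projection a b mu' X' : V P T F0 a -> V P T F b -> V P T F (cut T mu') ->
  {ae P, forall w t, 0 <= t <= T -> X' t w = st b (t, w)} ->
  (forall t, 0 <= t <= T -> is_cond_exp P (F0 t) (X' t) (mu' t)) ->
  dot m (fun z => gp pr (cut T mu') z - gp pr (st0 a) z)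
    (KP T delta (fun z => b z - a z)) =
  dot m (fun z => gp pr (cut T mu') z - gp pr (st0 a) z)
    (fun z => cut T mu' z - st0 a z).
Proof.
move=> Va Vb Vu' XE ceX; have VFa : V P T F a by exact: V_common_full.
set u' := cut T mu' in Vu' *; set u := st0 a.
have SF0 : S2 P T F u by apply: S2_common_full; exact: S2_st0.
have Vu := S2_V T0 filF SF0.
have VK := S2_V T0 filF (S2_KP T0 delta0 (V_B Vb VFa)).
have [_ _ LK] := VK; have [_ _ Luu] := V_B Vu' Vu.
have Lq := L2_gpB T0 filF net_price_measurable net_price_lip Vu' Vu.
apply/eqP; rewrite -subr_eq0 -dotBr//; apply/eqP.
pose q (z : R * Omega) := gp pr u' z - gp pr u z.
pose f (z : R * Omega) := q z * (KP T delta (fun z => b z - a z) z - (u' z - u z)).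
have fi : itg m f := itg_dot Lq (L2B LK Luu).
have [fi1 [fi2 fE]] := itg_fubini1 fi.
apply: (etrans fE); rewrite -[RHS](Rint0 leb).
apply: Rint_ae; [exact: itg_meas fi2 | exact: measurable_cst |].
(* Time is the outer variable, since the conditional expectations are available at each fixed
   time. *)
apply: filterS fi1 => t ft.
have [tT|nt] := pselect (0 <= t <= T); last first.
  rewrite -[RHS](Rint0 P); apply: eq_Rint => w.
  by rewrite /f /q /gp !net_price_supp// subrr mul0r.
have ceX' := ceX _ tT; have ce := equilibrium_cond_exp Va tT.
have [iX' iu' mu'G _] := ceX'; have [iX iu muG _] := ce.
(* As [X' - st a] is [KP] of [b - a], this is the second factor of [f] at time [t], rewritten as a
   difference of two conditional expectation errors, each orthogonal to F0_t. *)
pose D w := (X' t w - mu' t w) - (st a (t, w) - u (t, w)).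
have iD : itg P D by apply: itgB; exact: itgB.
pose Z w := pr t (mu' t w) - pr t (u (t, w)).
have mZ : measurable_fun setT (Z : g_sigma_algebraType (F0 t) -> R).
  by apply: measurable_funB; exact: (measurableT_comp (measurable_net_price t)).
have Gm := fil_meas filF0 (t := t).
have D0 A : <<s F0 t >> A -> Rint P (fun w => \1_A w * D w) = 0.
  move=> sA; have mA := Gm _ sA.
  have i1 : itg P (fun w => \1_A w * (X' t w - mu' t w)).
    by apply: itg_indic_mul => //; exact: itgB.
  have i2 : itg P (fun w => \1_A w * (st a (t, w) - u (t, w))).
    by apply: itg_indic_mul => //; exact: itgB.
  rewrite (@eq_Rint _ _ _ P _ (fun w => \1_A w * (X' t w - mu' t w)
      - \1_A w * (st a (t, w) - u (t, w)))); last by move=> w; rewrite mulrBr.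
  rewrite RintB// (cond_exp_orthogonal Gm ceX' sA) (cond_exp_orthogonal Gm ce sA).
  exact: subrr.
have mZD : measurable_fun setT (fun w => Z w * D w).
  by apply: measurable_funM; [exact: meas_g_sub Gm mZ | exact: itg_meas iD].
have aeE : {ae P, forall w, f (t, w) = Z w * D w}.
  apply: filterS2 XE (KP_B_paths delta0 Vb VFa) => w Xw KPw.
  rewrite /f /q /gp /Z /D KPw Xw// /u' cutE// /state.
  by congr (_ * _); move: (KP _ _ _ _) (KP _ _ _ _) (x1 _) (u _) => k1 k2 k3 k4; ring.
rewrite (Rint_ae (itg_meas ft) mZD aeE).
apply: (Rint_vanish Gm iD D0 mZ).
exact: itg_ae ft mZD aeE.
Qed.

(** The controls are compared first, in L2(dt x P); this makes the states agree, and the conditional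
    means follow at each time. *)
Lemma solution_unique a mu' alpha' : V P T F0 a ->
  (forall v, V P T F v -> dot m (grad (st0 a) a) v = 0) ->
  mfg_solution P T W W0 xi0 delta cp ci ca sigma sigma0 price mu' alpha' ->
  (forall t, t \in `[0, T] -> {ae P, forall w, mu' t w = st0 a (t, w)}) /\
  {ae m, forall z : R * Omega, z.1 \in `[0, T] -> alpha' z.1 z.2 = a z}.
Proof.
move=> Va ga [/(calL2_calH2 T0 filF) hmu [X' [opt' ceX]]].
have [hal sX' _] := opt'.
have Vu' := calH2_V T0 filF hmu; have Vb := calH2_V T0 filF hal.
have gb := optimal_gradient Vu' opt'.
have XE := state_unique P_complete T0 delta0 Sz zetaE Vb sX'.
have VFa : V P T F a by exact: V_common_full.
have {}ceX t : 0 <= t <= T -> is_cond_exp P (F0 t) (X' t) (mu' t).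
  by move=> tT; apply: ceX; rewrite in_itv.
have dE := dot_price_projection Va Vb Vu' XE ceX.
set u' := cut T mu' in Vu' gb dE; set b := cut T alpha' in Vb gb XE dE.
have SF0 : S2 P T F (st0 a) by apply: S2_common_full; exact: S2_st0.
have Vu := S2_V T0 filF SF0.
have Vv := V_B Vb VFa; pose v z := b z - a z.
have [_ _ Lv] := Vv; have [_ _ Lb] := Vb; have [_ _ La] := VFa.
have vv0 : dot m v v = 0.
  have e1 := gb _ Vv; have e2 := ga _ Vv.
  rewrite (dot_gradient T0 filF L0 delta0 net_price_measurable net_price_lip
    (net_price_itg 0) ci ca Vu' Vb Vv) in e1.
  rewrite (dot_gradient T0 filF L0 delta0 net_price_measurable net_price_lip
    (net_price_itg 0) ci ca Vu VFa Vv) in e2.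
  have e3 := duality_diff T0 filF L0 delta0 net_price_measurable net_price_lip
    (net_price_itg 0) net_price_supp Vu' Vu Vv.
  have e4 := gpB_mono T0 filF net_price_measurable net_price_lip net_price_decr Vu' Vu.
  rewrite -dE -e3 in e4.
  have e5 : dot m v v = dot m b v - dot m a v by exact: dotBl.
  have v0 := dot_ge0 m v.
  apply/eqP; rewrite eq_le v0 andbT -(pmulr_rle0 _ (mulr_gt0 (ltr0Sn R 1) ca0)) e5.
  rewrite -/v in e1 e2 e4.
  exact: (gradient_gap e1 e2 e4).
have [_ [iv2 e]] := itg_fubini2 Lv.2.
(* Zero energy on almost every path makes the states agree at every time and not only at almost
   every time. *)
have vpath : {ae P, forall w, Rint leb (fun t => v (t, w) ^+ 2) = 0}.
  apply: (Rint_eq0_ae iv2) => [w|]; first by apply: Rint_ge0 => t; exact: sqr_ge0.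
  by rewrite -e -(dot_sqr m v).
split.
  move=> t; rewrite in_itv/= => tT.
  have XX : {ae P, forall w, X' t w = st a (t, w)}.
    have ae2 : {ae P, forall w, X' t w = st b (t, w) /\
        KP T delta v (t, w) = KP T delta b (t, w) - KP T delta a (t, w)}.
      by apply: filterS2 XE (KP_B_paths delta0 Vb VFa) => w h1 h2; split; [exact: h1|exact: h2].
    apply: filterS3 ae2 vpath (V_paths Vv) => w [-> hK] v0 [Lvw _].
    have := sqr_Kp_le delta0 tT Lvw; rewrite v0 mulr0 => h.
    have {}h : Kp delta (fun s => v (s, w)) t = 0.
      by apply/eqP; rewrite -sqrf_eq0 eq_le h sqr_ge0.
    move: hK; rewrite {1}/KP h mulr0 => /eqP; rewrite eq_sym subr_eq0 => /eqP hK.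
    by rewrite /state hK.
  apply: (cond_exp_unique (fil_meas filF0 (t := t)) (ceX _ tT) (equilibrium_cond_exp Va tT) XX).
apply: (filterS (F := almost_everywhere m) _ (dot_eq0_ae Lv vv0)) => -[t w] /= vz.
rewrite in_itv/= => tT; move/eqP: vz.
by rewrite subr_eq0 /b cutE// => /eqP.
Qed.

End game.

Lemma expectation_L2 d (Omega : measurableType d) (R : realType) (P : probability Omega R)
    (X : {RV P >-> R}) : ('E_P[fun w => (X w ^+ 2)%R] < +oo)%E -> L2 P X.
Proof.
rewrite unlock => hX; split; first exact: measurable_funPT.
apply/integrableP; split.
  by apply/measurable_EFinP; apply: measurable_funX; exact: measurable_funPT.
by under eq_integral do rewrite abse_EFin ger0_norm ?sqr_ge0//.
Qed.

Theorem theorem7 (d : measure_display) (Omega : measurableType d)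
    (R : realType) (P : probability Omega R) (T : R)
    (W W0 : R -> {RV P >-> R}) (xi0 : {RV P >-> R})
    (delta cp ci ca sigma sigma0 L : R) (price : R -> R -> R)
    (P_complete : measure_is_complete P)
    (T_gt0 : 0 < T)
    (W_brownian : brownian_motion T W)
    (W0_brownian : brownian_motion T W0)
    (W_indep_W0 : independent P <<s history W T >> <<s history W0 T >>)
    (xi0_indep : independent P <<s generators xi0 >>
                                <<s history W T `|` history W0 T >>)
    (xi0_ge0 : {ae P, forall w, 0 <= xi0 w})
    (xi0_L2 : ('E_P[fun w => (xi0 w ^+ 2)%R] < +oo)%E)
    (delta_gt0 : 0 < delta) (delta_lt1 : delta < 1)
    (cp_gt0 : 0 < cp) (ci_gt0 : 0 < ci) (ca_gt0 : 0 < ca)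
    (sigma_neq0 : sigma != 0) (sigma0_neq0 : sigma0 != 0)
    (price_integrable : forall x, lebesgue_measure.-integrable `[0, T]
       (EFin \o (fun t => price t x)))
    (price_lipschitz : forall t x y, t \in `[0, T] ->
       `|price t x - price t y| <= L * `|x - y|)
    (price_decreasing : forall t x y, t \in `[0, T] -> x <= y ->
       price t y <= price t x) :
  exists mu alpha : R -> Omega -> R,
    mfg_solution P T W W0 xi0 delta cp ci ca sigma sigma0 price mu alpha /\
    forall mu' alpha' : R -> Omega -> R,
      mfg_solution P T W W0 xi0 delta cp ci ca sigma sigma0 price mu' alpha' ->
      (forall t, t \in `[0, T] -> {ae P, forall w, mu' t w = mu t w}) /\
      {ae (lebesgue_measure \x P)%E, forall z : R * Omega,
        z.1 \in `[0, T] -> alpha' z.1 z.2 = alpha z.1 z.2}.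
Proof.
have d0 := ltW delta_gt0.
have Lxi := expectation_L2 xi0_L2.
have [zeta [zeta0 [Sz Sz0 zE dzE]]] := forcing sigma sigma0 P_complete T_gt0
  W_brownian W0_brownian Lxi.
have mean_x := mean_free_state P_complete T_gt0 d0 W_brownian W_indep_W0 xi0_indep Lxi
  Sz Sz0 dzE.
have [a Va ga] := equilibrium_gradient cp ci P_complete T_gt0 W_indep_W0 xi0_indep d0 ca_gt0
  price_integrable price_lipschitz price_decreasing Sz0.
exists (fun t w => state T delta (free_state T delta zeta0) a (t, w)), (fun t w => a (t, w)).
split.
  exact: (equilibrium_solution P_complete T_gt0 d0 ca_gt0 price_integrable price_lipschitz
    Sz zE Sz0 mean_x Va ga).
move=> mu' alpha' sol.
have [h1 h2] := solution_unique P_complete T_gt0 d0 ca_gt0 price_integrable price_lipschitz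
  price_decreasing Sz zE Sz0 mean_x Va ga sol.
split=> //; apply: (filterS (F := almost_everywhere _) _ h2) => -[t w] /=.
exact.
Qed.
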